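(* Let $A\to B$ be a finite étale homomorphism of noetherian rings. Then the operator trace $$\operatorname{tr}^{\mathrm{oper}}_{B/A}:(B,\rho^{\mathrm{eet}}_{B/A})\to(A,\rho^{\mathrm{tau}}_{A/A})$$ is a nondegenerate rigid backward morphism in $\mathsf{D}(A)$ over $B/A$.
   Context: All rings are commutative. $\operatorname{tr}^{\mathrm{oper}}_{B/A}:B\to A$ is the $A$-linear homomorphism which, locally on $\operatorname{Spec}(A)$ where $B$ is a free $A$-module, sends $b$ to the trace of the matrix of multiplication by $b$ on $B$. A backward morphism $\theta:N\to M$ over $A\to B$, for $N\in\mathsf{D}(B)$, $M\in\mathsf{D}(A)$, is a morphism in $\mathsf{D}(A)$ from the restriction of $N$ to $M$; it is nondegenerate if the corresponding (by adjunction) morphism $N\to\operatorname{RHom}_A(B,M)$ in $\mathsf{D}(B)$ is an isomorphism. Square. For a flat ring homomorphism $A\to B$ and $M\in\mathsf{D}(B)$, the square of $M$ over $B/A$ is $\operatorname{Sq}_{B/A}(M)=\operatorname{RHom}_{B\otimes_AB}(B,M\otimes^{\mathrm{L}}_AM)\in\mathsf{D}(B)$, where $B$ is a $(B\otimes_AB)$-module by multiplication, and $B$ acts on the square through the first argument of $\operatorname{RHom}$. In particular $\operatorname{Sq}_{A/A}(M)=\operatorname{RHom}_A(A,M\otimes^{\mathrm{L}}_AM)$. For a backward morphism $\theta:N\to M$ over $u:A\to B$, $\operatorname{Sq}_{u/A}(\theta):\operatorname{Sq}_{B/A}(N)\to\operatorname{Sq}_{A/A}(M)$ is the morphism $\operatorname{RHom}_{B\otimes_AB}(B,N\otimes^{\mathrm{L}}_AN)\to\operatorname{RHom}_A(A,M\otimes^{\mathrm{L}}_AM)$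 in $\mathsf{D}(A)$ induced by $u$ and $\theta\otimes^{\mathrm{L}}\theta$. A rigid complex over $B/A$ is a pair $(M,\rho)$ with $M\in\mathsf{D}(B)$ having bounded, finitely generated cohomology and finite flat dimension over $A$, and $\rho:M\to\operatorname{Sq}_{B/A}(M)$ an isomorphism in $\mathsf{D}(B)$. A rigid backward morphism $\theta:(N,\sigma)\to(M,\rho)$ over $B/A$, from a rigid complex over $B/A$ to a rigid complex over $A/A$, is a backward morphism over $u:A\to B$ with $\rho\circ\theta=\operatorname{Sq}_{u/A}(\theta)\circ\sigma$. The tautological rigid complex over $A/A$ is $(A,\rho^{\mathrm{tau}}_{A/A})$, where $\rho^{\mathrm{tau}}_{A/A}:=\mathrm{id}_A$ under $\operatorname{Sq}_{A/A}(A)=\operatorname{Hom}_A(A,A\otimes_AA)=A$. The rigidifying isomorphism $\rho^{\mathrm{eet}}_{B/A}:B\to\operatorname{Sq}_{B/A}(B)=\operatorname{Hom}_{B\otimes_AB}(B,B\otimes_AB)$ (note that $B$ is a projective $(B\otimes_AB)$-module since $A\to B$ is étale) is the standard rigidifying isomorphism of an essentially smooth homomorphism, in differential relative dimension $0$. Explicitly: put $B^{\mathrm{en}}:=B\otimes_AB$ and $\mathrm{I}:=\operatorname{Ker}(\operatorname{mult}:B^{\mathrm{en}}\to B)$. There is a unique $B$-module isomorphism $B\otimes_{B^{\mathrm{en}}}B^{\mathrm{en}}\to\operatorname{Hom}_{B^{\mathrm{en}}}(B,B^{\mathrm{en}})$ whose localization at every $s\in B^{\mathrm{en}}$ with $B_s\ne0$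 and $\mathrm{I}_s=0$ sends $1\otimes\mu\mapsto(1\mapsto\mu)$; $\rho^{\mathrm{eet}}_{B/A}$ is its composition with the canonical isomorphism $B\cong B\otimes_{B^{\mathrm{en}}}B^{\mathrm{en}}$. Equivalently, it sends $b$ to the homomorphism $b'\mapsto \operatorname{sec}_{B/A}(b\,b')$, where $\operatorname{sec}_{B/A}:B\to B\otimes_AB$ is the unique $(B\otimes_AB)$-module homomorphism with $\operatorname{mult}_{B/A}\circ\operatorname{sec}_{B/A}=\mathrm{id}_B$. *)

(* Defs.v *)
From HB Require Import structures.
From mathcomp Require Import all_boot all_algebra.
From mathcomp Require Import generic_quotient.
From mathcomp Require Import boolp classical_sets functions.

Set Implicit Arguments.
Unset Strict Implicit.
Unset Printing Implicit Defensive.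

Local Open Scope quotient_scope.
Import GRing.Theory.
Local Open Scope ring_scope.

(* Rings are [comPzRingType]: commutative, with the zero ring allowed. *)

Definition restr (R S : comPzRingType) (u : {rmorphism R -> S})
  (X : lmodType S) : Type := X.

Section Restr.
Variables (R S : comPzRingType) (u : {rmorphism R -> S}) (X : lmodType S).
HB.instance Definition _ := GRing.Zmodule.copy (restr u X) X.
Let scale (a : R) (x : restr u X) : restr u X := u a *: (x : X).
Fact restr_scaleA a b x : scale a (scale b x) = scale (a * b) x.
Proof. by rewrite /scale scalerA rmorphM. Qed.
Fact restr_scale1 : left_id 1 scale.
Proof. by move=> x; rewrite /scale rmorph1 scale1r. Qed.
Fact restr_scaleDr : right_distributive scale +%R.
Proof. by move=> a x y; rewrite /scale scalerDr. Qed.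
Fact restr_scaleDl x : {morph scale^~ x : a b / a + b}.
Proof. by move=> a b; rewrite /scale rmorphD scalerDl. Qed.
HB.instance Definition _ := GRing.Zmodule_isLmodule.Build R (restr u X)
  restr_scaleA restr_scale1 restr_scaleDr restr_scaleDl.
End Restr.

(* [coind u X] is Hom_R(S, X), with S acting through the source. *)
Section Coind.
Variables (R S : comPzRingType) (u : {rmorphism R -> S}) (X : lmodType R).

Definition coind_pred : {pred (S -> X)} := fun f =>
  `[< (forall s t, f (s + t) = f s + f t) /\
      (forall a s, f (u a * s) = a *: f s) >].

Fact coind_zmod_closed : zmod_closed coind_pred.
Proof.
split=> [|f g /asboolP[fD fZ] /asboolP[gD gZ]]; apply/asboolP; split.
- by move=> s t; exact/esym/addr0.
- by move=> a s; exact/esym/scaler0.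
- move=> s t; change (f (s + t) - g (s + t) = (f s - g s) + (f t - g t)).
  by rewrite fD gD opprD addrACA.
- move=> a s; change (f (u a * s) - g (u a * s) = a *: (f s - g s)).
  by rewrite fZ gZ scalerBr.
Qed.
HB.instance Definition _ :=
  GRing.isZmodClosed.Build (S -> X) coind_pred coind_zmod_closed.

Record coind := Coind { coind_fun :> S -> X; _ : coind_fun \in coind_pred }.
HB.instance Definition _ := [isSub for coind_fun].
HB.instance Definition _ := [Choice of coind by <:].
HB.instance Definition _ := [SubChoice_isSubZmodule of coind by <:].

Lemma coindP (f : coind) : coind_fun f \in coind_pred.
Proof. by case: f. Qed.

Lemma coind_funD (f : coind) s t : f (s + t) = f s + f t.
Proof. by case/asboolP: (coindP f). Qed.

Lemma coind_funZ (f : coind) a s : f (u a * s) = a *: f s.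
Proof. by case/asboolP: (coindP f). Qed.

Lemma coind_eqP (f g : coind) : (forall s, f s = g s) -> f = g.
Proof. by move=> fg; apply: val_inj; apply: funext. Qed.

Lemma coindDE (f g : coind) s : (f + g) s = f s + g s.
Proof. by []. Qed.

Fact coind_scale_subproof (s : S) (f : coind) :
  (fun t => f (t * s)) \in coind_pred.
Proof.
apply/asboolP; split=> [t t'|a t]; first by rewrite mulrDl coind_funD.
by rewrite -mulrA coind_funZ.
Qed.
Definition coind_scale s f := Coind (coind_scale_subproof s f).

Fact coind_scaleA a b x : coind_scale a (coind_scale b x) = coind_scale (a * b) x.
Proof. by apply: coind_eqP => t /=; rewrite mulrA. Qed.
Fact coind_scale1 : left_id 1 coind_scale.
Proof. by move=> x; apply: coind_eqP => t /=; rewrite mulr1. Qed.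
Fact coind_scaleDr : right_distributive coind_scale +%R.
Proof. by move=> a x y; apply: coind_eqP. Qed.
Fact coind_scaleDl x : {morph coind_scale^~ x : a b / a + b}.
Proof. by move=> a b; apply: coind_eqP => t /=; rewrite mulrDr coind_funD. Qed.
HB.instance Definition _ := GRing.Zmodule_isLmodule.Build S coind
  coind_scaleA coind_scale1 coind_scaleDr coind_scaleDl.

Lemma coindZE (a : S) (f : coind) s : (a *: f) s = f (s * a).
Proof. by []. Qed.
End Coind.

Section CoindMap.
Variables (R S : comPzRingType) (u : {rmorphism R -> S}).

Fact coind_map_subproof (X Y : lmodType R) (h : {linear X -> Y})
    (f : coind u X) : (fun s => h (f s)) \in @coind_pred _ _ u Y.
Proof.
apply/asboolP; split=> [s t|a s]; first by rewrite coind_funD raddfD.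
by rewrite coind_funZ linearZ.
Qed.
Definition coind_map (X Y : lmodType R) (h : {linear X -> Y}) f :=
  Coind (coind_map_subproof h f).
Fact coind_map_linear X Y h : linear (@coind_map X Y h).
Proof. by move=> a f g; apply: coind_eqP => s /=; rewrite raddfD. Qed.
HB.instance Definition _ X Y h :=
  GRing.isLinear.Build S (coind u X) (coind u Y) _ (@coind_map X Y h)
    (@coind_map_linear X Y h).
End CoindMap.

(* [tens M N] is the direct sum over i of the M_i (x)_A N_i, constructed as
   formal sums of pure tensors modulo the congruence [tens_rel]; the family
   version is what the degrees of a tensor product of complexes require. *)
Section Tens.
Variables (I : choiceType) (A : comPzRingType) (M N : I -> lmodType A).

Definition pure := {i : I & (M i * N i)%type}.
Definition mkpure i (x : M i) (y : N i) : pure :=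
  existT (fun i => (M i * N i)%type) i (x, y).

Inductive tens_rel : seq pure -> seq pure -> Prop :=
| tens_refl s : tens_rel s s
| tens_sym s t : tens_rel s t -> tens_rel t s
| tens_trans s t r : tens_rel s t -> tens_rel t r -> tens_rel s r
| tens_cat s s' t t' :
    tens_rel s s' -> tens_rel t t' -> tens_rel (s ++ t) (s' ++ t')
| tens_comm s t : tens_rel (s ++ t) (t ++ s)
| tens_zero i (y : N i) : tens_rel [:: mkpure 0 y] [::]
| tens_addl i (x x' : M i) (y : N i) :
    tens_rel [:: mkpure (x + x') y] [:: mkpure x y; mkpure x' y]
| tens_addr i (x : M i) (y y' : N i) :
    tens_rel [:: mkpure x (y + y')] [:: mkpure x y; mkpure x y']
| tens_scale i a (x : M i) (y : N i) :
    tens_rel [:: mkpure (a *: x) y] [:: mkpure x (a *: y)].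

Definition tens_relb (s t : seq pure) := `[< tens_rel s t >].
Fact tens_equiv : equiv_class_of tens_relb.
Proof.
split=> [s|s t|t s r].
- exact/asboolP/tens_refl.
- by apply/asboolP/asboolP=> ?; exact: tens_sym.
- by move=> /asboolP st /asboolP tr; apply/asboolP; exact: tens_trans tr.
Qed.
Canonical tens_equiv_rel := EquivRelPack tens_equiv.

Definition tens : Type := {eq_quot tens_equiv_rel}.
HB.instance Definition _ := Choice.on tens.

Definition tclass (s : seq pure) : tens := \pi_({eq_quot tens_equiv_rel}) s.
Definition trepr (t : tens) : seq pure := repr (t : {eq_quot tens_equiv_rel}).
Definition tensor i (x : M i) (y : N i) : tens := tclass [:: mkpure x y].

Lemma tclassP s t : tens_rel s t <-> tclass s = tclass t.
Proof.
split=> [st|/eqmodP/asboolP //]; apply/eqmodP; exact/asboolP.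
Qed.
Lemma treprK t : tclass (trepr t) = t.
Proof. exact: reprK. Qed.

Definition opp_pure (e : pure) : pure :=
  mkpure (- (projT2 e).1) (projT2 e).2.
Definition scale_pure a (e : pure) : pure :=
  mkpure (a *: (projT2 e).1) (projT2 e).2.

Lemma scale_rel a s t :
  tens_rel s t -> tens_rel (map (scale_pure a) s) (map (scale_pure a) t).
Proof.
elim=> {s t} [s|s t _|s t r _ st _|s s' t t' _ ss' _|s t|i y|i x x' y|
  i x y y'|i b x y].
- exact: tens_refl.
- exact: tens_sym.
- exact: tens_trans.
- by rewrite !map_cat; exact: tens_cat.
- by rewrite !map_cat; exact: tens_comm.
- by rewrite /scale_pure /= scaler0; exact: tens_zero.
- by rewrite /scale_pure /= scalerDr; exact: tens_addl.
- exact: tens_addr.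
- by rewrite /scale_pure /= scalerA mulrC -scalerA; exact: tens_scale.
Qed.

Lemma opp_scale : opp_pure =1 scale_pure (- 1).
Proof. by case=> i [x y]; rewrite /opp_pure /scale_pure scaleN1r. Qed.

Definition tadd (s t : tens) := tclass (trepr s ++ trepr t).
Definition topp (s : tens) := tclass (map opp_pure (trepr s)).
Definition tscale a (s : tens) := tclass (map (scale_pure a) (trepr s)).

Lemma trepr_rel s : tens_rel (trepr (tclass s)) s.
Proof. by apply/tclassP; rewrite treprK. Qed.

Lemma taddE s t : tadd (tclass s) (tclass t) = tclass (s ++ t).
Proof. by apply/tclassP/tens_cat; exact: trepr_rel. Qed.
Lemma tscaleE a s : tscale a (tclass s) = tclass (map (scale_pure a) s).
Proof. by apply/tclassP/scale_rel; exact: trepr_rel. Qed.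
Lemma toppE s : topp (tclass s) = tclass (map opp_pure s).
Proof. by rewrite !(eq_map opp_scale) -tscaleE /topp (eq_map opp_scale). Qed.

Fact taddA : associative tadd.
Proof.
move=> s t r; rewrite -[s]treprK -[t]treprK -[r]treprK.
by rewrite !taddE catA.
Qed.
Fact taddC : commutative tadd.
Proof.
move=> s t; rewrite -[s]treprK -[t]treprK !taddE; exact/tclassP/tens_comm.
Qed.
Fact tadd0 : left_id (tclass [::]) tadd.
Proof. by move=> s; rewrite -[s]treprK taddE. Qed.
Fact taddN : left_inverse (tclass [::]) topp tadd.
Proof.
move=> s; rewrite -[s]treprK toppE taddE; apply/tclassP.
elim: (trepr s) => [|[i [x y]] l IH]; first exact: tens_refl.
have -> : map opp_pure (existT _ i (x, y) :: l) ++ existT _ i (x, y) :: l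
  = [:: mkpure (- x) y] ++ (map opp_pure l ++ ([:: mkpure x y] ++ l)) by [].
apply: (@tens_trans _
  ([:: mkpure (- x) y] ++ ([:: mkpure x y] ++ (map opp_pure l ++ l)))).
  apply: tens_cat; first exact: tens_refl.
  rewrite !catA; apply: tens_cat; [exact: tens_comm | exact: tens_refl].
rewrite catA -[X in tens_rel _ X]cats0; apply: tens_cat; last exact: IH.
apply: tens_trans (tens_sym (tens_addl _ _ _)) _.
by rewrite addNr; exact: tens_zero.
Qed.
HB.instance Definition _ := GRing.isZmodule.Build tens taddA taddC tadd0 taddN.

Lemma tensDE s t : tclass s + tclass t = tclass (s ++ t).
Proof. exact: taddE. Qed.

Lemma tens_ind (P : tens -> Prop) :
  P 0 -> (forall s t, P s -> P t -> P (s + t)) ->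
  (forall i x y, P (@tensor i x y)) -> forall t, P t.
Proof.
move=> P0 PD Pp t; rewrite -[t]treprK.
elim: (trepr t) => [//|[i [x y]] s IH]; rewrite -cat1s -tensDE.
by apply: PD => //; exact: Pp.
Qed.

Fact tscaleA a b x : tscale a (tscale b x) = tscale (a * b) x.
Proof.
rewrite -[x]treprK !tscaleE -map_comp; congr tclass; apply: eq_map.
by case=> i [y z]; rewrite /scale_pure /= scalerA.
Qed.
Fact tscale1 : left_id 1 tscale.
Proof.
move=> x; rewrite -[x]treprK tscaleE; congr tclass.
rewrite -[RHS]map_id; apply: eq_map.
by case=> i [y z]; rewrite /scale_pure /= scale1r.
Qed.
Fact tscaleDr : right_distributive tscale +%R.
Proof.
move=> a x y; rewrite -[x]treprK -[y]treprK [in LHS]tensDE !tscaleE tensDE.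
by rewrite map_cat.
Qed.
Fact tscaleDl x : {morph tscale^~ x : a b / a + b}.
Proof.
move=> a b; move: x; apply: tens_ind.
- by rewrite /= !tscaleE /= addr0.
- by move=> s t Hs Ht; rewrite !tscaleDr Hs Ht addrACA.
move=> i x y; rewrite !tscaleE !tensDE; apply/tclassP => /=.
by rewrite /scale_pure /= scalerDl; exact: tens_addl.
Qed.
HB.instance Definition _ := GRing.Zmodule_isLmodule.Build A tens
  tscaleA tscale1 tscaleDr tscaleDl.

Lemma tensorDl i (x x' : M i) (y : N i) :
  tensor (x + x') y = tensor x y + tensor x' y.
Proof. by rewrite tensDE; apply/tclassP/tens_addl. Qed.
Lemma tensorDr i (x : M i) (y y' : N i) :
  tensor x (y + y') = tensor x y + tensor x y'.
Proof. by rewrite tensDE; apply/tclassP/tens_addr. Qed.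
Lemma tensorZl i a (x : M i) (y : N i) : tensor (a *: x) y = a *: tensor x y.
Proof. by rewrite [RHS]tscaleE. Qed.
Lemma tensorZr i a (x : M i) (y : N i) : tensor x (a *: y) = a *: tensor x y.
Proof. by rewrite -tensorZl; symmetry; apply/tclassP/tens_scale. Qed.

Section Lift.
Variables (X : lmodType A) (g : forall i, M i -> N i -> X).

Definition bilin := forall i,
  (forall y, linear (fun x => @g i x y)) /\ (forall x, linear (@g i x)).

Definition tlift_fun (t : tens) : X :=
  \sum_(e <- trepr t) g (projT2 e).1 (projT2 e).2.

Hypothesis gP : bilin.

Let gDl i x x' y : @g i (x + x') y = g x y + g x' y.
Proof. by have := (gP i).1 y 1 x x'; rewrite !scale1r. Qed.
Let gDr i x y y' : @g i x (y + y') = g x y + g x y'.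
Proof. by have := (gP i).2 x 1 y y'; rewrite !scale1r. Qed.
Let g0l i y : @g i 0 y = 0.
Proof. by apply: (addrI (g 0 y)); rewrite -gDl !addr0. Qed.
Let g0r i x : @g i x 0 = 0.
Proof. by apply: (addrI (g x 0)); rewrite -gDr !addr0. Qed.
Let gZl i a x y : @g i (a *: x) y = a *: g x y.
Proof. by have := (gP i).1 y a x 0; rewrite !addr0 g0l addr0. Qed.
Let gZr i a x y : @g i x (a *: y) = a *: g x y.
Proof. by have := (gP i).2 x a y 0; rewrite !addr0 g0r addr0. Qed.

Lemma tlift_rel s t : tens_rel s t ->
  \sum_(e <- s) g (projT2 e).1 (projT2 e).2
  = \sum_(e <- t) g (projT2 e).1 (projT2 e).2.
Proof.
elim=> {s t} [s|s t _ <-|s t r _ -> _ ->|s s' t t' _ ss' _ tt'|s t|i y|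
  i x x' y|i x y y'|i b x y] //.
- by rewrite !big_cat /= ss' tt'.
- by rewrite !big_cat /= addrC.
- by rewrite big_seq1 big_nil /= g0l.
- by rewrite big_seq1 big_cons big_seq1 /= gDl.
- by rewrite big_seq1 big_cons big_seq1 /= gDr.
- by rewrite !big_seq1 /= gZl gZr.
Qed.

Lemma tlift_class s :
  tlift_fun (tclass s) = \sum_(e <- s) g (projT2 e).1 (projT2 e).2.
Proof. exact/tlift_rel/trepr_rel. Qed.

Lemma tlift_tensor i x y : tlift_fun (@tensor i x y) = g x y.
Proof. by rewrite tlift_class big_seq1. Qed.

Fact tlift_linear : linear tlift_fun.
Proof.
move=> a s t; rewrite -[s]treprK -[t]treprK [a *: _]tscaleE tensDE.
rewrite !tlift_class big_cat /= big_map; congr (_ + _).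
by rewrite scaler_sumr; apply: eq_bigr => e _ /=; rewrite gZl.
Qed.
Definition tlift (_ : bilin) := tlift_fun.
HB.instance Definition _ :=
  GRing.isLinear.Build A tens X _ (tlift gP) tlift_linear.
End Lift.
End Tens.

Section TensMap.
Variables (I J : choiceType) (h : I -> J) (A : comPzRingType).
Variables (M N : I -> lmodType A) (M' N' : J -> lmodType A).
Variables (f : forall i, {linear M i -> M' (h i)}).
Variables (g : forall i, {linear N i -> N' (h i)}).
Fact tens_map_bilin :
  bilin (fun i (x : M i) (y : N i) => tensor (f i x) (g i y)).
Proof.
by move=> i; split=> z a x y; rewrite linearP
  ?(tensorDl, tensorDr, tensorZl, tensorZr).
Qed.
Definition tens_map : {linear tens M N -> tens M' N'} := tlift tens_map_bilin.
End TensMap.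

Section Act.
Variables (A B : comPzRingType) (u : {rmorphism A -> B}).
Variables (I : choiceType) (P Q : I -> lmodType B).
Let M i : lmodType A := restr u (P i).
Let N i : lmodType A := restr u (Q i).

Definition scale_tensor (b c : B) i (x : M i) (y : N i) : tens M N :=
  tensor (b *: (x : P i) : M i) (c *: (y : Q i) : N i).

Fact scale_tensor_bilin b c : bilin (scale_tensor b c).
Proof.
move=> i; rewrite /scale_tensor; split=> z a x y.
  have -> : b *: ((a *: x + y : M i) : P i) =
    a *: (b *: (x : P i) : M i) + (b *: (y : P i) : M i).
    change (b *: (u a *: (x : P i) + y) = u a *: (b *: (x : P i)) + b *: (y : P i)).
    by rewrite scalerDr !scalerA mulrC.
  by rewrite tensorDl tensorZl.
have -> : c *: ((a *: x + y : N i) : Q i) =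
  a *: (c *: (x : Q i) : N i) + (c *: (y : Q i) : N i).
  change (c *: (u a *: (x : Q i) + y) = u a *: (c *: (x : Q i)) + c *: (y : Q i)).
  by rewrite scalerDr !scalerA mulrC.
by rewrite tensorDr tensorZr.
Qed.
Definition scale_tens b c : {linear tens M N -> tens M N} :=
  tlift (scale_tensor_bilin b c).

Lemma scale_tensE b c i x y :
  scale_tens b c (@tensor _ _ M N i x y)
  = tensor (b *: (x : P i) : M i) (c *: (y : Q i) : N i).
Proof. exact: (tlift_tensor (scale_tensor_bilin b c)). Qed.

Let E := tens (fun _ : unit => restr u B^o) (fun _ : unit => restr u B^o).

Fact en_act_bilin (t : tens M N) :
  bilin (fun (_ : unit) (b c : restr u B^o) => scale_tens b c t).
Proof.
move=> []; split=> z a x y; elim/tens_ind: t => [|s t Hs Ht|i p q].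
- by rewrite !linear0 addr0.
- by rewrite !linearD /= Hs Ht addrACA.
- rewrite !scale_tensE.
  rewrite -tensorZl -tensorDl; congr (tensor _ _).
  exact: (etrans (scalerDl _ _ _)
     (congr1 (fun w => w + y *: (p : P i)) (esym (scalerA _ _ _)))).
- by rewrite !linear0 addr0.
- by rewrite !linearD /= Hs Ht addrACA.
- rewrite !scale_tensE.
  rewrite -tensorZr -tensorDr; congr (tensor _ _).
  exact: (etrans (scalerDl _ _ _)
     (congr1 (fun w => w + y *: (q : Q i)) (esym (scalerA _ _ _)))).
Qed.

(* The action of B (x)_A B: (b (x) c) (x (x) y) = b x (x) c y. *)
Definition en_act (z : E) (t : tens M N) : tens M N := tlift (en_act_bilin t) z.

Lemma en_act_tensor (b c : restr u B^o) t :
  en_act (@tensor _ _ (fun=> restr u B^o) (fun=> restr u B^o) tt b c) t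
  = scale_tens b c t.
Proof. exact: (tlift_tensor (en_act_bilin t)). Qed.

Fact en_actDl t : {morph en_act^~ t : z w / z + w}.
Proof. by move=> z w; rewrite /en_act raddfD. Qed.

Fact en_actDr : right_distributive en_act +%R.
Proof.
move=> z s t; elim/tens_ind: z => [|z w Hz Hw|[] b c].
- by rewrite /en_act !raddf0 addr0.
- by rewrite !en_actDl Hz Hw addrACA.
- by rewrite !en_act_tensor raddfD.
Qed.

Fact en_act0r z : en_act z 0 = 0.
Proof. by apply: (addrI (en_act z 0)); rewrite -en_actDr !addr0. Qed.
End Act.

Section En.
Variables (A B : comPzRingType) (u : {rmorphism A -> B}).

Definition en : Type :=
  tens (fun _ : unit => restr u B^o) (fun _ : unit => restr u B^o).
HB.instance Definition _ := GRing.Lmodule.on en.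

Definition en_pure (b c : B) : en :=
  @tensor _ _ (fun=> restr u B^o) (fun=> restr u B^o) tt b c.

Let mul (z w : en) : en := @en_act _ _ u unit (fun=> B^o) (fun=> B^o) z w.

Lemma en_ind (P : en -> Prop) :
  P 0 -> (forall s t, P s -> P t -> P (s + t)) ->
  (forall b c, P (en_pure b c)) -> forall t, P t.
Proof. by move=> P0 PD Pp; apply: tens_ind => // -[]; exact: Pp. Qed.

Let mulE b c b' c' :
  mul (en_pure b c) (en_pure b' c') = en_pure (b * b') (c * c').
Proof. by rewrite /mul en_act_tensor scale_tensE. Qed.
Let mulDl : left_distributive mul +%R.
Proof. by move=> x y z; exact: en_actDl. Qed.
Let mulDr : right_distributive mul +%R.
Proof. by move=> x y z; exact: en_actDr. Qed.
Let mul0 z : mul 0 z = 0.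
Proof. by apply: (addrI (mul 0 z)); rewrite -mulDl !addr0. Qed.
Let mulz0 z : mul z 0 = 0.
Proof. by apply: (addrI (mul z 0)); rewrite -mulDr !addr0. Qed.

Fact en_mulC : commutative mul.
Proof.
move=> x y; elim/en_ind: x => [|x x' Hx Hx'|b c].
- by rewrite mul0 mulz0.
- by rewrite mulDl mulDr Hx Hx'.
elim/en_ind: y => [|y y' Hy Hy'|b' c'].
- by rewrite mul0 mulz0.
- by rewrite mulDl mulDr Hy Hy'.
by rewrite !mulE mulrC [c * _]mulrC.
Qed.
Fact en_mulA : associative mul.
Proof.
move=> x y z; elim/en_ind: x => [|x x' Hx Hx'|b c].
- by rewrite !mul0.
- by rewrite !mulDl Hx Hx'.
elim/en_ind: y => [|y y' Hy Hy'|b' c'].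
- by rewrite mul0 mulz0 mul0.
- by rewrite mulDl !mulDr Hy Hy' mulDl.
elim/en_ind: z => [|z z' Hz Hz'|b'' c''].
- by rewrite !mulz0.
- by rewrite !mulDr Hz Hz'.
by rewrite !mulE !mulrA.
Qed.
Fact en_mul1 : left_id (en_pure 1 1) mul.
Proof.
move=> x; elim/en_ind: x => [|x x' Hx Hx'|b c].
- by rewrite mulz0.
- by rewrite mulDr Hx Hx'.
by rewrite mulE !mul1r.
Qed.
HB.instance Definition _ := GRing.Zmodule_isComPzRing.Build en
  en_mulA en_mulC en_mul1 mulDl.

Lemma en_pureM b c b' c' :
  en_pure b c * en_pure b' c' = en_pure (b * b') (c * c').
Proof. exact: mulE. Qed.

Definition to_en (a : A) : en := en_pure (u a) 1.
Fact to_en_zmod : zmod_morphism to_en.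
Proof.
move=> a b; apply/eqP; rewrite eq_sym subr_eq /to_en -tensorDl; apply/eqP.
by congr (tensor _ _); rewrite raddfB /= subrK.
Qed.
Fact to_en_monoid : monoid_morphism to_en.
Proof.
split=> [|a b]; first by rewrite /to_en rmorph1.
by rewrite /to_en en_pureM rmorphM mulr1.
Qed.
HB.instance Definition _ := GRing.isZmodMorphism.Build A en to_en to_en_zmod.
HB.instance Definition _ := GRing.isMonoidMorphism.Build A en to_en to_en_monoid.

Let mult_op (_ : unit) (b c : restr u B^o) : restr u B^o := (b : B) * (c : B).
Fact mult_bilin : bilin mult_op.
Proof.
move=> i; split=> z a x y; rewrite /mult_op.
  by rewrite [(_ : B) * _]mulrDl -[in LHS]mulrA.
by rewrite [(_ : B) * _]mulrDr [in LHS]mulrCA.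
Qed.
Definition mult (z : en) : B := tlift mult_bilin z.
Lemma mult_pure b c : mult (en_pure b c) = b * c.
Proof. exact: (tlift_tensor mult_bilin). Qed.
Fact mult_zmod : zmod_morphism mult.
Proof. by move=> x y; rewrite /mult raddfB. Qed.
Let multD x y : mult (x + y) = mult x + mult y.
Proof. by rewrite /mult raddfD. Qed.
Let mult0 : mult 0 = 0.
Proof. by rewrite /mult raddf0. Qed.
HB.instance Definition _ := GRing.isZmodMorphism.Build en B mult mult_zmod.
Fact mult_monoid : monoid_morphism mult.
Proof.
split=> [|x y]; first by rewrite mult_pure mulr1.
elim/en_ind: x => [|x x' Hx Hx'|b c].
- by rewrite mul0r !mult0 mul0r.
- by rewrite mulrDl !multD Hx Hx' mulrDl.
elim/en_ind: y => [|y y' Hy Hy'|b' c'].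
- by rewrite mulr0 !mult0 mulr0.
- by rewrite mulrDr !multD Hy Hy' mulrDr.
by rewrite en_pureM !mult_pure mulrACA.
Qed.
HB.instance Definition _ := GRing.isMonoidMorphism.Build en B mult mult_monoid.
End En.
Arguments mult {A B} u z.

Definition tenm (A B : comPzRingType) (u : {rmorphism A -> B})
  (I : choiceType) (P Q : I -> lmodType B) : Type :=
  tens (fun i => restr u (P i)) (fun i => restr u (Q i)).

Section Tenm.
Variables (A B : comPzRingType) (u : {rmorphism A -> B}).
Variables (I : choiceType) (P Q : I -> lmodType B).
Let T := tenm u P Q.
HB.instance Definition _ := GRing.Zmodule.on T.
Let scale (z : en u) (t : T) : T := en_act z t.
Fact tenm_scaleA z w x : scale z (scale w x) = scale (z * w) x.
Proof.
rewrite /scale; elim/en_ind: z => [|z z' Hz Hz'|b c].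
- by rewrite mul0r /en_act !raddf0.
- by rewrite mulrDl !en_actDl Hz Hz'.
elim/en_ind: w => [|w w' Hw Hw'|b' c'].
- by rewrite mulr0 [en_act 0 x]raddf0 en_act0r.
- by rewrite mulrDr !en_actDl en_actDr Hw Hw'.
rewrite en_pureM; elim/tens_ind: x => [|x x' Hx Hx'|i x y].
- by rewrite !en_act0r.
- by rewrite !en_actDr Hx Hx'.
rewrite !en_act_tensor !scale_tensE; congr (tensor _ _).
  exact: (@scalerA B (P i)).
exact: (@scalerA B (Q i)).
Qed.
Fact tenm_scale1 : left_id 1 scale.
Proof.
move=> x; rewrite /scale; elim/tens_ind: x => [|x x' Hx Hx'|i x y].
- by rewrite en_act0r.
- by rewrite en_actDr Hx Hx'.
rewrite en_act_tensor scale_tensE; congr (tensor _ _).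
  exact: (@scale1r B (P i)).
exact: (@scale1r B (Q i)).
Qed.
Fact tenm_scaleDr : right_distributive scale +%R.
Proof. by move=> z s t; exact: en_actDr. Qed.
Fact tenm_scaleDl x : {morph scale^~ x : a b / a + b}.
Proof. by move=> z s; exact: en_actDl. Qed.
HB.instance Definition _ := GRing.Zmodule_isLmodule.Build (en u) T
  tenm_scaleA tenm_scale1 tenm_scaleDr tenm_scaleDl.
End Tenm.

Record cplx (R : comPzRingType) := Cplx {
  ob :> int -> lmodType R;
  dif : forall i, {linear ob i -> ob (i + 1)};
  dif2 : forall i x, dif (i + 1) (dif i x) = 0 }.

Record cmap (R : comPzRingType) (X Y : cplx R) := Cmap {
  cm :> forall i, {linear X i -> Y i};
  cm_dif : forall i x, cm (i + 1) (dif X i x) = dif Y i (cm i x) }.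

Section Complexes.
Variable R : comPzRingType.
Implicit Types X Y Z : cplx R.

Definition cid_map X : cmap X X := @Cmap R X X (fun i => idfun) (fun i x => erefl).

Fact ccomp_subproof X Y Z (g : cmap Y Z) (f : cmap X Y) i x :
  (g (i + 1) \o f (i + 1)) (dif X i x) = dif Z i ((g i \o f i) x).
Proof. by rewrite /= !cm_dif. Qed.
Definition ccomp X Y Z (g : cmap Y Z) (f : cmap X Y) : cmap X Z :=
  @Cmap R X Z (fun i => g i \o f i) (ccomp_subproof g f).

(* Degrees are written i + 1, which covers all of them since i ranges over Z
   and spares transports between X i and X (i - 1 + 1). *)
Definition exact_at X (i : int) :=
  forall x : X (i + 1), dif X (i + 1) x = 0 -> exists y, x = dif X i y.

Definition acyclic X := forall i, exact_at X i.

Definition null_homotopic X Y (f : cmap X Y) :=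
  exists h : forall i, {linear X (i + 1) -> Y i},
    forall i x, f (i + 1) x = dif Y i (h i x) + h (i + 1) (dif X (i + 1) x).

(* The map induced on H^(i+1) is injective and surjective for all i. *)
Definition qis X Y (f : cmap X Y) := forall i,
  (forall x, dif X (i + 1) x = 0 -> (exists y, f (i + 1) x = dif Y i y) ->
     exists x', x = dif X i x') /\
  (forall y, dif Y (i + 1) y = 0 ->
     exists2 x, dif X (i + 1) x = 0 & exists y', f (i + 1) x - y = dif Y i y').

Definition kinjective Y :=
  forall X (f : cmap X Y), acyclic X -> null_homotopic f.

(* The derived category, as the localization of the category of complexes
   at the quasi-isomorphisms: morphisms are formal composites of maps of
   complexes and of inverses of quasi-isomorphisms, modulo [deq]. *)

Inductive dmor : cplx R -> cplx R -> Type :=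
| dhom X Y : cmap X Y -> dmor X Y
| dinv X Y (s : cmap X Y) : qis s -> dmor Y X
| dcomp X Y Z : dmor Y Z -> dmor X Y -> dmor X Z.

Inductive deq : forall X Y, dmor X Y -> dmor X Y -> Prop :=
| deq_refl X Y (f : dmor X Y) : deq f f
| deq_sym X Y (f g : dmor X Y) : deq f g -> deq g f
| deq_trans X Y (f g h : dmor X Y) : deq f g -> deq g h -> deq f h
| deq_cong X Y Z (g g' : dmor Y Z) (f f' : dmor X Y) :
    deq g g' -> deq f f' -> deq (dcomp g f) (dcomp g' f')
| deq_assoc W X Y Z (h : dmor Y Z) (g : dmor X Y) (f : dmor W X) :
    deq (dcomp h (dcomp g f)) (dcomp (dcomp h g) f)
| deq_idl X Y (f : dmor X Y) : deq (dcomp (dhom (cid_map Y)) f) f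
| deq_idr X Y (f : dmor X Y) : deq (dcomp f (dhom (cid_map X))) f
| deq_ext X Y (f g : cmap X Y) : (forall i, f i =1 g i) -> deq (dhom f) (dhom g)
| deq_hom X Y Z (g : cmap Y Z) (f : cmap X Y) :
    deq (dcomp (dhom g) (dhom f)) (dhom (ccomp g f))
| deq_invl X Y (s : cmap X Y) (qs : qis s) :
    deq (dcomp (dinv qs) (dhom s)) (dhom (cid_map X))
| deq_invr X Y (s : cmap X Y) (qs : qis s) :
    deq (dcomp (dhom s) (dinv qs)) (dhom (cid_map Y)).

Definition diso X Y (f : dmor X Y) :=
  exists2 g : dmor Y X,
    deq (dcomp g f) (dhom (cid_map X)) & deq (dcomp f g) (dhom (cid_map Y)).

(* [cplx0 X] is X in degree 0; the zero module is rendered by row vectors of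
   size 0. *)
Definition ob0 (X : lmodType R) (i : int) : lmodType R :=
  if i is Posz 0 then X else 'rV[R]_0.
Definition cplx0 (X : lmodType R) : cplx R :=
  @Cplx R (ob0 X) (fun i => \0) (fun i x => erefl).

Section From0.
Variables (X : lmodType R) (Y : cplx R) (g : {linear X -> Y 0}).
Hypothesis gd : forall x, dif Y 0 (g x) = 0.
Definition from0_fun i : {linear ob0 X i -> Y i} :=
  match i with Posz 0 => g | Posz i.+1 => \0 | Negz i => \0 end.
Fact from0_subproof i x :
  from0_fun (i + 1) (dif (cplx0 X) i x) = dif Y i (from0_fun i x).
Proof. by rewrite linear0; case: i x => [[|i]|i] x //=; rewrite ?gd ?linear0. Qed.
Definition from0 : cmap (cplx0 X) Y := Cmap from0_subproof.
End From0.

Definition cmap0 (X Y : lmodType R) (g : {linear X -> Y}) :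
  cmap (cplx0 X) (cplx0 Y) := @from0 X (cplx0 Y) g (fun x => erefl).

Definition bounded_cohomology X :=
  exists n : nat, forall i : int, (n < absz (i + 1)%R)%N -> exact_at X i.

Definition fg_cohomology X := forall i : int,
  exists k (z : 'I_k -> X (i + 1)),
    (forall j, dif X (i + 1) (z j) = 0) /\
    forall x, dif X (i + 1) x = 0 ->
      exists (b : 'I_k -> R) (y : X i), x = \sum_j b j *: z j + dif X i y.
End Complexes.

Notation "f =D g" := (deq f g) (at level 70).
Notation "g \oD f" := (dcomp g f) (at level 50, left associativity).

Section ResCoind.
Variables (R S : comPzRingType) (u : {rmorphism R -> S}).

Definition restr_fun (X Y : lmodType S) (f : {linear X -> Y}) :
  restr u X -> restr u Y := f.
Fact restr_fun_linear (X Y : lmodType S) (f : {linear X -> Y}) :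
  linear (restr_fun f).
Proof. by move=> a x y; exact: (linearP f (u a)). Qed.
HB.instance Definition _ (X Y : lmodType S) (f : {linear X -> Y}) :=
  GRing.isLinear.Build R (restr u X) (restr u Y) _ (restr_fun f)
    (restr_fun_linear f).

Definition res (X : cplx S) : cplx R :=
  @Cplx R (fun i => restr u (X i)) (fun i => restr_fun (dif X i)) (dif2 (c := X)).

Definition res_map (X Y : cplx S) (f : cmap X Y) : cmap (res X) (res Y) :=
  @Cmap R (res X) (res Y) (fun i => restr_fun (f i)) (cm_dif f).

Lemma res_qis (X Y : cplx S) (f : cmap X Y) : qis f -> qis (res_map f).
Proof. by []. Qed.

Fixpoint dres (X Y : cplx S) (f : dmor X Y) : dmor (res X) (res Y) :=
  match f with
  | dhom _ _ h => dhom (res_map h)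
  | dinv _ _ s qs => dinv (res_qis qs)
  | dcomp _ _ _ g h => dres g \oD dres h
  end.

Definition res0_fun (X : lmodType S) i : {linear res (cplx0 X) i -> ob0 (restr u X) i} :=
  match i with Posz 0 => idfun | Posz i.+1 => \0 | Negz i => \0 end.
Fact res0_subproof (X : lmodType S) i x :
  res0_fun X (i + 1) (dif (res (cplx0 X)) i x)
  = dif (cplx0 (restr u X)) i (res0_fun X i x).
Proof. exact: linear0. Qed.
Definition res0 (X : lmodType S) : cmap (res (cplx0 X)) (cplx0 (restr u X)) :=
  @Cmap R (res (cplx0 X)) (cplx0 (restr u X)) (res0_fun X) (@res0_subproof X).

Fact coind_dif2 (X : cplx R) i (f : coind u (X i)) :
  coind_map (dif X (i + 1)) (coind_map (dif X i) f) = 0 :> coind u (X (i + 1 + 1)).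
Proof. by apply: coind_eqP => s /=; rewrite dif2. Qed.
Definition coind_cplx (X : cplx R) : cplx S :=
  @Cplx S (fun i => coind u (X i)) (fun i => coind_map (dif X i)) (@coind_dif2 X).

Fact coind_cmap_subproof (X Y : cplx R) (f : cmap X Y) i (g : coind u (X i)) :
  coind_map (f (i + 1)) (coind_map (dif X i) g)
  = coind_map (dif Y i) (coind_map (f i) g).
Proof. by apply: coind_eqP => s /=; rewrite cm_dif. Qed.
Definition coind_cmap (X Y : cplx R) (f : cmap X Y) :
    cmap (coind_cplx X) (coind_cplx Y) :=
  @Cmap S (coind_cplx X) (coind_cplx Y) (fun i => coind_map (f i))
    (@coind_cmap_subproof X Y f).

(* [adj g] is the map N -> Hom_R(S, Y) of S-complexes adjoint to g : N -> Y. *)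
Section Adjoint.
Variables (N : cplx S) (Y : cplx R) (g : cmap (res N) Y).
Fact adj_subproof i (x : N i) : (fun s => g i (s *: x)) \in @coind_pred _ _ u (Y i).
Proof.
apply/asboolP; split=> [s t|a s]; first by rewrite scalerDl raddfD.
by rewrite -scalerA; exact: (linearZ_LR (g i) a (s *: x)).
Qed.
Definition adj_fun i (x : N i) : coind u (Y i) := Coind (adj_subproof x).
Fact adj_linear i : linear (@adj_fun i).
Proof.
move=> a x y; apply: coind_eqP => s.
by rewrite coindDE coindZE /= scalerDr scalerA raddfD.
Qed.
HB.instance Definition _ i :=
  GRing.isLinear.Build S (N i) (coind u (Y i)) _ (@adj_fun i) (@adj_linear i).
Fact adj_dif i x :
  adj_fun (dif N i x) = coind_map (dif Y i) (@adj_fun i x).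
Proof.
apply: coind_eqP => s; change (g (i + 1) (s *: dif N i x) = dif Y i (g i (s *: x))).
have -> : s *: dif N i x = dif N i (s *: x) by rewrite linearZ.
exact: (cm_dif g (s *: x)).
Qed.
Definition adj : cmap N (coind_cplx Y) :=
  @Cmap S N (coind_cplx Y) (fun i => @adj_fun i) adj_dif.
End Adjoint.
End ResCoind.

Definition to_res_id (R : comPzRingType) (X : lmodType R) (x : X) :
  restr (idfun : {rmorphism R -> R}) X := x.
Fact to_res_id_linear (R : comPzRingType) (X : lmodType R) :
  linear (@to_res_id R X).
Proof. by []. Qed.
HB.instance Definition _ (R : comPzRingType) (X : lmodType R) :=
  GRing.isLinear.Build R X (restr idfun X) _ (@to_res_id R X)
    (@to_res_id_linear R X).
Definition res_id (R : comPzRingType) (X : cplx R) :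
    cmap X (res (idfun : {rmorphism R -> R}) X) :=
  @Cmap R X (res idfun X) (fun i => @to_res_id R (X i)) (fun i x => erefl).

(* Degree n of a tensor product is the sum over the pairs (i, j) : idx n with
   i + j = n; [idxl] and [idxr] raise i and j by 1. *)
Definition idx (n : int) := {p : int * int | p.1 + p.2 == n}.

Fact idxl_subproof n (p : idx n) : ((val p).1 + 1) + (val p).2 == n + 1.
Proof. by rewrite addrAC (eqP (valP p)). Qed.
Fact idxr_subproof n (p : idx n) : (val p).1 + ((val p).2 + 1) == n + 1.
Proof. by rewrite addrA (eqP (valP p)). Qed.
Definition idxl n (p : idx n) : idx (n + 1) :=
  exist _ ((val p).1 + 1, (val p).2) (idxl_subproof p).
Definition idxr n (p : idx n) : idx (n + 1) :=
  exist _ ((val p).1, (val p).2 + 1) (idxr_subproof p).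

Section TensorComplex.
Variables (A : comPzRingType) (X Y : cplx A).

Definition tob n : lmodType A :=
  tens (fun p : idx n => X (val p).1) (fun p : idx n => Y (val p).2).
Definition ttensor n (p : idx n) (x : X (val p).1) (y : Y (val p).2) : tob n :=
  @tensor _ _ (fun p : idx n => X (val p).1) (fun p : idx n => Y (val p).2) p x y.

(* d (x (x) y) = d x (x) y + (-1)^i x (x) d y for x of degree i. *)
Definition tdif_pure n (p : idx n) (x : X (val p).1) (y : Y (val p).2) :
    tob (n + 1) :=
  @ttensor _ (idxl p) (dif X _ x) y
  + (-1) ^+ absz (val p).1 *: @ttensor _ (idxr p) x (dif Y _ y).

Fact tdif_bilin n : bilin (@tdif_pure n).
Proof.
move=> p; split=> z a x y; rewrite /tdif_pure /ttensor linearP.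
  by rewrite !tensorDl !tensorZl !scalerDr !scalerA mulrC addrACA.
by rewrite !tensorDr !tensorZr !scalerDr !scalerA mulrC addrACA.
Qed.
Definition tdif n : {linear tob n -> tob (n + 1)} := tlift (@tdif_bilin n).

Lemma tdifE n p x y : tdif n (@ttensor n p x y) = tdif_pure x y.
Proof. exact: (tlift_tensor (@tdif_bilin n)). Qed.
End TensorComplex.

Section TensorComplex2.
Variables (A : comPzRingType).

Lemma ttensorDl (X Y : cplx A) n (p : idx n) x x' y :
  @ttensor A X Y n p (x + x') y = ttensor x y + ttensor x' y.
Proof. exact: tensorDl. Qed.
Lemma ttensorDr (X Y : cplx A) n (p : idx n) x y y' :
  @ttensor A X Y n p x (y + y') = ttensor x y + ttensor x y'.
Proof. exact: tensorDr. Qed.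
Lemma ttensorZl (X Y : cplx A) n (p : idx n) a x y :
  @ttensor A X Y n p (a *: x) y = a *: ttensor x y.
Proof. exact: tensorZl. Qed.
Lemma ttensorZr (X Y : cplx A) n (p : idx n) a x y :
  @ttensor A X Y n p x (a *: y) = a *: ttensor x y.
Proof. exact: tensorZr. Qed.
Lemma ttensor0l (X Y : cplx A) n (p : idx n) y : @ttensor A X Y n p 0 y = 0.
Proof. by apply: (addrI (ttensor 0 y)); rewrite -ttensorDl !addr0. Qed.
Lemma ttensor0r (X Y : cplx A) n (p : idx n) x : @ttensor A X Y n p x 0 = 0.
Proof. by apply: (addrI (ttensor x 0)); rewrite -ttensorDr !addr0. Qed.

Lemma ttensor_irr (X Y : cplx A) n i j (e e' : i + j == n) x y :
  @ttensor A X Y n (exist _ (i, j) e) x y = @ttensor A X Y n (exist _ (i, j) e') x y.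
Proof. by rewrite (bool_irrelevance e e'). Qed.

Lemma tob_ind (X Y : cplx A) n (P : tob X Y n -> Prop) :
  P 0 -> (forall s t, P s -> P t -> P (s + t)) ->
  (forall p x y, P (@ttensor A X Y n p x y)) -> forall t, P t.
Proof. exact: tens_ind. Qed.

Lemma sign_absz (i : int) : (-1) ^+ absz (i + 1)%R = - (-1) ^+ absz i :> A.
Proof.
have sgS (n : nat) : (-1) ^+ n.+1 = - (-1) ^+ n :> A by rewrite exprS mulN1r.
case: i => [n|[|n]]; first by rewrite -sgS -PoszD addn1.
  by rewrite /= expr0 expr1 opprK.
have -> : Negz n.+1 + 1 = Negz n by rewrite !NegzE -(addn1 n.+1) PoszD opprD subrK.
by rewrite /= [in RHS]sgS opprK.
Qed.

Fact tdif2 (X Y : cplx A) n t : tdif X Y (n + 1) (tdif X Y n t) = 0.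
Proof.
elim/tob_ind: t => [|s t Hs Ht|p x y]; first by rewrite !linear0.
  by rewrite !linearD /= Hs Ht addr0.
rewrite tdifE linearD linearZ_LR /= !tdifE /tdif_pure /=.
rewrite !dif2 ttensor0l ttensor0r add0r scaler0 addr0 sign_absz.
rewrite scaleNr; apply: etrans (addNr _); congr (- _ + _).
by congr (_ *: _); exact: ttensor_irr.
Qed.

Definition tcplx (X Y : cplx A) : cplx A :=
  @Cplx A (tob X Y) (tdif X Y) (@tdif2 X Y).

Section Map.
Variables (X Y X' Y' : cplx A) (f : cmap X X') (g : cmap Y Y').
Definition tmap_fun n : {linear tob X Y n -> tob X' Y' n} :=
  @tens_map _ _ id A (fun p : idx n => X (val p).1) (fun p => Y (val p).2)
    (fun p : idx n => X' (val p).1) (fun p => Y' (val p).2)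
    (fun p => f (val p).1) (fun p => g (val p).2).
Lemma tmap_funE n p x y :
  tmap_fun n (@ttensor A X Y n p x y) = @ttensor A X' Y' n p (f _ x) (g _ y).
Proof. exact: (tlift_tensor (tens_map_bilin (h := id) _ _)). Qed.
Fact tmap_subproof n t : tmap_fun (n + 1) (tdif X Y n t) = tdif X' Y' n (tmap_fun n t).
Proof.
elim/tob_ind: t => [|s t Hs Ht|p x y]; first by rewrite !linear0.
  by rewrite !linearD /= Hs Ht.
by rewrite tmap_funE !tdifE linearD linearZ_LR !tmap_funE /= !cm_dif.
Qed.
Definition tmap : cmap (tcplx X Y) (tcplx X' Y') :=
  @Cmap A (tcplx X Y) (tcplx X' Y') tmap_fun tmap_subproof.
End Map.

Definition kflat (P : cplx A) := forall N : cplx A, acyclic N -> acyclic (tcplx P N).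

(* The cohomology of M (x)^L_A N is bounded uniformly in the module N. *)
Definition finite_flat_dim (M : cplx A) :=
  exists (P : cplx A) (p : cmap P M), [/\ kflat P, qis p &
    exists n : nat, forall (N : lmodType A) (i : int),
      (n < absz (i + 1)%R)%N -> exact_at (tcplx P (cplx0 N)) i].
End TensorComplex2.

Section EnComplex.
Variables (A B : comPzRingType) (u : {rmorphism A -> B}).

(* [ten P Q] is P (x)_A Q with its action of B (x)_A B; its carriers and its
   differential are those of [tcplx (res u P) (res u Q)]. *)
Section Ten.
Variables P Q : cplx B.

Definition eob n : lmodType (en u) :=
  tenm u (fun p : idx n => P (val p).1) (fun p : idx n => Q (val p).2).
Definition edif n (t : eob n) : eob (n + 1) := tdif (res u P) (res u Q) n t.

Lemma eob_ind n (F : eob n -> Prop) :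
  F 0 -> (forall s t, F s -> F t -> F (s + t)) ->
  (forall p x y, F (@ttensor A (res u P) (res u Q) n p x y)) -> forall t, F t.
Proof. exact: tens_ind. Qed.

Lemma eobZ n (z : en u) (t : eob n) : z *: t = en_act z t.
Proof. by []. Qed.
Lemma edifD n (s t : eob n) : edif (s + t) = edif s + edif t.
Proof. exact: (linearD (tdif (res u P) (res u Q) n) s t). Qed.
Lemma edif0 n : edif (0 : eob n) = 0.
Proof. exact: (linear0 (tdif (res u P) (res u Q) n)). Qed.

Lemma scale_ttensor n b c p x y :
  en_pure u b c *: (@ttensor A (res u P) (res u Q) n p x y : eob n)
  = @ttensor A (res u P) (res u Q) n p (b *: (x : P _)) (c *: (y : Q _)).
Proof. by rewrite eobZ en_act_tensor scale_tensE. Qed.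

Fact edif_linear n : linear (@edif n).
Proof.
move=> z s t; rewrite edifD; congr (_ + _).
elim/en_ind: z => [|z z' Hz Hz'|b c].
- by rewrite !scale0r edif0.
- by rewrite !scalerDl edifD Hz Hz'.
elim/eob_ind: s => [|s s' Hs Hs'|p x y].
- by rewrite scaler0 edif0 scaler0.
- by rewrite scalerDr !edifD Hs Hs' scalerDr.
rewrite scale_ttensor.
rewrite /edif !tdifE /tdif_pure.
set a : A := _ ^+ _.
transitivity (en_pure u b c *:
  (@ttensor A (res u P) (res u Q) _ (idxl p) (dif P _ x) y : eob (n + 1)) +
  en_pure u b c *:
  (a *: @ttensor A (res u P) (res u Q) _ (idxr p) x (dif Q _ y) : eob (n + 1)));
  last by rewrite -scalerDr.
by rewrite -!ttensorZr !scale_ttensor /= /restr_fun !linearZ.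
Qed.
HB.instance Definition _ n :=
  GRing.isLinear.Build (en u) (eob n) (eob (n + 1)) _ (@edif n) (@edif_linear n).
Definition ten : cplx (en u) :=
  @Cplx (en u) eob (fun n => @edif n) (@tdif2 A (res u P) (res u Q)).

Definition ten_res_fun n (t : tob (res u P) (res u Q) n) :
  restr (to_en u) (eob n) := t.
Fact ten_res_linear n : linear (@ten_res_fun n).
Proof.
move=> a s t; change (a *: s + t = (to_en u a *: (s : eob n) : eob n) + t).
congr (_ + _); elim/eob_ind: s => [|s s' Hs Hs'|p x y].
- by rewrite !scaler0.
- by rewrite !scalerDr Hs Hs'.
by rewrite scale_ttensor scale1r -ttensorZl.
Qed.
HB.instance Definition _ n := GRing.isLinear.Build A
  (tob (res u P) (res u Q) n) (restr (to_en u) (eob n)) _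
  (@ten_res_fun n) (@ten_res_linear n).
Definition ten_res : cmap (tcplx (res u P) (res u Q)) (res (to_en u) ten) :=
  @Cmap A (tcplx (res u P) (res u Q)) (res (to_en u) ten)
    (fun n => @ten_res_fun n) (fun n t => erefl).
End Ten.

Section TenMap.
Variables (P P' : cplx B) (p : cmap P P').
Definition ten_fun n (t : eob P P n) : eob P' P' n :=
  tmap_fun (res_map u p) (res_map u p) n t.
Fact ten_fun_linear n : linear (@ten_fun n).
Proof.
have fD (s t : eob P P n) : ten_fun (s + t) = ten_fun s + ten_fun t.
  exact: (linearD (tmap_fun (res_map u p) (res_map u p) n) s t).
have f0 : @ten_fun n 0 = 0.
  exact: (linear0 (tmap_fun (res_map u p) (res_map u p) n)).
move=> z s t; rewrite fD; congr (_ + _).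
elim/en_ind: z => [|z z' Hz Hz'|b c].
- by rewrite !scale0r f0.
- by rewrite !scalerDl fD Hz Hz'.
elim/eob_ind: s => [|s s' Hs Hs'|q x y].
- by rewrite scaler0 f0 scaler0.
- by rewrite scalerDr !fD Hs Hs' scalerDr.
by rewrite scale_ttensor /ten_fun !tmap_funE scale_ttensor /= /restr_fun !linearZ.
Qed.
HB.instance Definition _ n := GRing.isLinear.Build (en u)
  (eob P P n) (eob P' P' n) _ (@ten_fun n) (@ten_fun_linear n).
Definition ten_map : cmap (ten P P) (ten P' P') :=
  @Cmap (en u) (ten P P) (ten P' P') (fun n => @ten_fun n)
    (tmap_subproof (res_map u p) (res_map u p)).
End TenMap.
End EnComplex.

Section Ev.
Variables (A B : comPzRingType) (u : {rmorphism A -> B}) (Y : cplx (en u)).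

(* Evaluation at 1 is the morphism RHom_{B (x)_A B}(B, Y) -> RHom_A(A, Y) = Y
   induced by u. *)
Definition ev_fun n (f : restr u (coind (mult u) (Y n))) : restr (to_en u) (Y n) :=
  (f : coind (mult u) (Y n)) 1.
Fact ev_linear n : linear (@ev_fun n).
Proof.
move=> a f g; rewrite /ev_fun.
change ((u a *: (f : coind (mult u) (Y n)) + (g : coind (mult u) (Y n))) 1
  = to_en u a *: (f : coind (mult u) (Y n)) 1 + (g : coind (mult u) (Y n)) 1).
rewrite coindDE coindZE; congr (_ + _).
by rewrite mul1r -coind_funZ mulr1 /to_en /= mult_pure mulr1.
Qed.
HB.instance Definition _ n := GRing.isLinear.Build A
  (restr u (coind (mult u) (Y n))) (restr (to_en u) (Y n)) _
  (@ev_fun n) (@ev_linear n).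
Definition ev : cmap (res u (coind_cplx (mult u) Y)) (res (to_en u) Y) :=
  @Cmap A (res u (coind_cplx (mult u) Y)) (res (to_en u) Y)
    (fun n => @ev_fun n) (fun n f => erefl).
End Ev.

(* A computation of RHom_{B (x)_A B}(B, M (x)^L_A M) by resolutions: M is
   replaced by a complex of B-modules which is K-flat over A, and its tensor
   square by a K-injective complex of (B (x)_A B)-modules. *)
Record square (A B : comPzRingType) (u : {rmorphism A -> B}) (M : cplx B) := Square {
  sqP : cplx B;
  sqp : cmap sqP M;
  sqI : cplx (en u);
  sqj : cmap (ten u sqP sqP) sqI;
  sqP_kflat : kflat (res u sqP);
  sqp_qis : qis sqp;
  sqI_kinj : kinjective sqI;
  sqj_qis : qis sqj }.

Definition Sq (A B : comPzRingType) (u : {rmorphism A -> B}) (M : cplx B)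
  (S : square u M) : cplx B := coind_cplx (mult u) (sqI S).

(* [phi] is Sq_{u/A}(theta). Here P, q, f represent theta by maps from a complex
   K-flat over A, so that g is theta (x)^L theta read through the resolutions;
   both squares are then compared in D(A) by evaluation at 1. *)
Definition is_Sq_mor (A B : comPzRingType) (u : {rmorphism A -> B})
    (N : cplx B) (M : cplx A) (SN : square u N) (SM : square idfun M)
    (theta : dmor (res u N) M) (phi : dmor (res u (Sq SN)) (Sq SM)) :=
  exists (P : cplx A) (q : cmap P (res u (sqP SN)))
    (f : cmap P (res idfun (sqP SM)))
    (g : dmor (res (to_en u) (sqI SN)) (res (to_en idfun) (sqI SM))),
  [/\ kflat P, qis q,
      dhom (res_id M) \oD theta \oD dhom (res_map u (sqp SN)) \oD dhom q
        =D dhom (res_map idfun (sqp SM)) \oD dhom f,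
      g \oD dhom (res_map (to_en u) (sqj SN)) \oD dhom (ten_res u _ _)
          \oD dhom (tmap q q)
        =D dhom (res_map (to_en idfun) (sqj SM)) \oD dhom (ten_res idfun _ _)
             \oD dhom (tmap f f)
    & dhom (ev (sqI SM)) \oD dhom (res_id (Sq SM)) \oD phi
        =D g \oD dhom (ev (sqI SN))].

Definition rigid_complex (A B : comPzRingType) (u : {rmorphism A -> B})
    (M : cplx B) (S : square u M) (rho : dmor M (Sq S)) :=
  [/\ bounded_cohomology M, fg_cohomology M, finite_flat_dim (res u M)
    & diso rho].

Definition rigid_backward (A B : comPzRingType) (u : {rmorphism A -> B})
    (N : cplx B) (SN : square u N) (sigma : dmor N (Sq SN))
    (M : cplx A) (SM : square idfun M) (rho : dmor M (Sq SM))
    (theta : dmor (res u N) M) :=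
  exists2 phi : dmor (res u (Sq SN)) (Sq SM),
    is_Sq_mor theta phi & rho \oD theta =D phi \oD dres u sigma.

(* RHom_A(B, M) is Hom_A(B, J) for a K-injective resolution J of M; [g] is a
   map of complexes representing [theta], which exists and is unique up to
   homotopy because J is K-injective. *)
Definition nondegenerate_backward (A B : comPzRingType) (u : {rmorphism A -> B})
    (N : cplx B) (M : cplx A) (theta : dmor (res u N) M) :=
  forall (J : cplx A) (r : cmap M J) (g : cmap (res u N) J),
    kinjective J -> qis r -> dhom g =D dhom r \oD theta ->
    diso (dhom (adj g)).

Section Rho.
Variables (A B : comPzRingType) (u : {rmorphism A -> B}).

(* [en_deg0] identifies B (x)_A B with the degree 0 part of B[0] (x)_A B[0]. *)
Let B0 := cplx0 B^o.
Definition idx00 (_ : unit) : idx 0 := exist _ (0, 0) (eqxx 0).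
Definition en_deg0_lin : {linear en u -> tob (res u B0) (res u B0) 0} :=
  @tens_map unit _ idx00 A (fun=> restr u B^o) (fun=> restr u B^o)
    (fun p : idx 0 => (res u B0) (val p).1) (fun p => (res u B0) (val p).2)
    (fun=> idfun) (fun=> idfun).
Definition en_deg0 (z : en u) : eob u B0 B0 0 := en_deg0_lin z.

Lemma en_deg0_pure b c :
  en_deg0 (en_pure u b c) = @ttensor A (res u B0) (res u B0) 0 (idx00 tt) b c.
Proof. exact: (tlift_tensor (tens_map_bilin (h := idx00) _ _)). Qed.
Lemma en_deg0D z w : en_deg0 (z + w) = en_deg0 z + en_deg0 w.
Proof. exact: (linearD en_deg0_lin). Qed.
Lemma en_deg00 : en_deg0 0 = 0.
Proof. exact: (linear0 en_deg0_lin). Qed.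
Lemma en_deg0M z w : en_deg0 (z * w) = z *: en_deg0 w.
Proof.
elim/en_ind: z => [|z z' Hz Hz'|b c].
- by rewrite mul0r scale0r en_deg00.
- by rewrite mulrDl scalerDl en_deg0D Hz Hz'.
elim/en_ind: w => [|w w' Hw Hw'|b' c'].
- by rewrite mulr0 en_deg00 scaler0.
- by rewrite mulrDr !en_deg0D scalerDr Hw Hw'.
by rewrite en_pureM !en_deg0_pure scale_ttensor.
Qed.

Variable s : {linear restr (mult u) B^o -> (en u)^o}.

(* [rho0] is b |-> (b' |-> s (b b')), from B to Hom_{B (x)_A B}(B, B (x)_A B). *)
Fact rho0_subproof (b : B) :
  (fun b' : B => en_deg0 (s (b * b'))) \in @coind_pred _ _ (mult u) (eob u B0 B0 0).
Proof.
apply/asboolP; split=> [x y|z x]; first by rewrite mulrDr raddfD en_deg0D.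
rewrite mulrCA -en_deg0M; congr en_deg0.
exact: (linearZ_LR s z (b * x : B)).
Qed.
Definition rho0_fun (b : B^o) : coind (mult u) (eob u B0 B0 0) :=
  Coind (rho0_subproof b).
Fact rho0_linear : linear rho0_fun.
Proof.
move=> a x y; apply: coind_eqP => b.
rewrite coindDE coindZE /= -en_deg0D -raddfD; congr (en_deg0 (s _)).
change ((a * x + y) * b = x * (b * a) + y * b).
by rewrite mulrDl -mulrA mulrCA [a * b]mulrC.
Qed.
HB.instance Definition _ := GRing.isLinear.Build B B^o
  (coind (mult u) (eob u B0 B0 0)) _ rho0_fun rho0_linear.
Fact rho0_dif b :
  dif (coind_cplx (mult u) (ten u B0 B0)) 0 (rho0_fun b) = 0.
Proof.
apply: coind_eqP => b' /=; elim/en_ind: (s _) => [|z w Hz Hw|x y].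
- by rewrite en_deg00 edif0.
- by rewrite en_deg0D edifD Hz Hw addr0.
rewrite en_deg0_pure /edif tdifE /tdif_pure /=.
by rewrite ttensor0l ttensor0r scaler0 addr0.
Qed.
Definition rho0 : cmap B0 (coind_cplx (mult u) (ten u B0 B0)) :=
  @from0 B B^o (coind_cplx (mult u) (ten u B0 B0)) rho0_fun rho0_dif.

(* [rho] is [rho0] followed by the canonical morphism
   Hom_{B (x)_A B}(B, B (x)_A B) -> Sq_{B/A}(B), which is induced by the map [c]
   from B (x)_A B to its resolution. *)
Definition is_rho (S : square u B0) (rho : dmor B0 (Sq S)) :=
  exists2 c : cmap (ten u B0 B0) (sqI S),
    dhom c \oD dhom (ten_map u (sqp S)) =D dhom (sqj S)
    & rho =D dhom (coind_cmap (mult u) c) \oD dhom rho0.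
End Rho.

Definition is_section (A B : comPzRingType) (u : {rmorphism A -> B})
    (s : {linear restr (mult u) B^o -> (en u)^o}) :=
  forall b : B, mult u (s b) = b.

(* The section of mult is unique if it exists; the value is 0 otherwise. *)
Definition sec (A B : comPzRingType) (u : {rmorphism A -> B}) :
    {linear restr (mult u) B^o -> (en u)^o} :=
  if pselect (exists s, @is_section A B u s) is left h then sval (cid h) else \0.

Definition is_rho_eet (A B : comPzRingType) (u : {rmorphism A -> B})
    (S : square u (cplx0 B^o)) (rho : dmor (cplx0 B^o) (Sq S)) :=
  is_rho (sec u) rho.

Section Tau.
Variable A : comPzRingType.
Let i := (idfun : {rmorphism A -> A}).
Definition tau_fun (a : restr (mult i) A^o) : (en i)^o := en_pure i a 1.
Fact tau_linear : linear tau_fun.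
Proof.
have tD (x y : A) : tau_fun (x + y) = tau_fun x + tau_fun y by exact: tensorDl.
move=> z x y; rewrite [LHS]tD; congr (_ + _).
change (tau_fun (mult i z * (x : A)) = z * tau_fun x).
elim/en_ind: z => [|z z' Hz Hz'|b c].
- by rewrite rmorph0 !mul0r; apply: (addrI (tau_fun 0)); rewrite -tD !addr0.
- by rewrite rmorphD !mulrDl tD Hz Hz'.
rewrite mult_pure en_pureM mulr1 /tau_fun mulrAC mulrC.
rewrite -[in RHS](mulr1 c).
transitivity (c *: (en_pure i (b * x) 1 : en i)); first by rewrite -tensorZl.
by rewrite -tensorZr.
Qed.
HB.instance Definition _ := GRing.isLinear.Build (en i)
  (restr (mult i) A^o) (en i)^o _ tau_fun tau_linear.
End Tau.

(* [tau_fun] is A = A (x)_A A, for which [rho0] is the identification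
   A = Hom_{A (x)_A A}(A, A (x)_A A). *)
Definition is_rho_tau (A : comPzRingType) (S : square (idfun : {rmorphism A -> A}) (cplx0 A^o))
    (rho : dmor (cplx0 A^o) (Sq S)) :=
  is_rho (@tau_fun A) rho.

(* [l] exhibits [L] as the localization of [R] at the powers of [s]. *)
Definition is_localization (R L : comPzRingType) (s : R) (l : {rmorphism R -> L}) :=
  [/\ exists y, l s * y = 1,
      forall z, exists n a, l s ^+ n * z = l a
    & forall a, l a = 0 -> exists n, s ^+ n * a = 0].

Definition is_basis (A B : comPzRingType) (v : {rmorphism A -> B}) n
    (e : 'I_n -> B) :=
  forall b, exists! c : 'rV[A]_n, b = \sum_i v (c 0 i) * e i.

(* Wherever B becomes free on a basic open subset D(s) of Spec(A), [tr b] is the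
   trace of the matrix T of multiplication by b in a basis e. *)
Definition is_tr_oper (A B : comPzRingType) (u : {rmorphism A -> B})
    (tr : {linear restr u B^o -> A^o}) :=
  forall (s : A) (As Bs : comPzRingType) (lA : {rmorphism A -> As})
    (lB : {rmorphism B -> Bs}) (v : {rmorphism As -> Bs}) n (e : 'I_n -> Bs),
  is_localization s lA -> is_localization (u s) lB ->
  (forall a, v (lA a) = lB (u a)) -> is_basis v e ->
  forall (b : B) (T : 'M[As]_n),
    (forall j, lB b * e j = \sum_i v (T i j) * e i) -> lA (tr b) = \tr T.

(* There is exactly one such map when B is finite and locally free over A. *)
Definition tr_oper (A B : comPzRingType) (u : {rmorphism A -> B}) :
    {linear restr u B^o -> A^o} :=
  if pselect (exists t, @is_tr_oper A B u t) is left h then sval (cid h) else \0.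

Definition tr_backward (A B : comPzRingType) (u : {rmorphism A -> B}) :
    dmor (res u (cplx0 B^o)) (cplx0 A^o) :=
  dhom (ccomp (cmap0 (tr_oper u)) (res0 u B^o)).

Definition noetherian (R : comPzRingType) :=
  forall I : set R, I 0 -> (forall x y, I x -> I y -> I (x + y)) ->
    (forall a x, I x -> I (a * x)) ->
  exists n (g : 'I_n -> R), (forall i, I (g i)) /\
    forall x, I x -> exists c : 'I_n -> R, x = \sum_i c i * g i.

Section Homs.
Variables (A B : comPzRingType) (u : {rmorphism A -> B}).

Definition finite_hom :=
  exists n (g : 'I_n -> B), forall b, exists c : 'I_n -> A,
    b = \sum_i u (c i) * g i.

Definition finite_type_hom :=
  exists n (g : 'I_n -> B), forall C : set B,
    (forall a, C (u a)) -> (forall i, C (g i)) ->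
    (forall x y, C x -> C y -> C (x + y)) ->
    (forall x y, C x -> C y -> C (x * y)) -> forall b, C b.

Definition flat_hom :=
  forall (M N : lmodType A) (f : {linear M -> N}), injective f ->
    injective (@tens_map unit unit id A (fun=> restr u B^o) (fun=> M)
      (fun=> restr u B^o) (fun=> N) (fun=> idfun) (fun=> f)).

(* Every A-derivation of B into a B-module vanishes, i.e. Omega_{B/A} = 0. *)
Definition unramified_hom :=
  forall (M : lmodType B) (D : B -> M),
    (forall x y, D (x + y) = D x + D y) ->
    (forall x y, D (x * y) = x *: D y + y *: D x) ->
    (forall a, D (u a) = 0) -> forall b, D b = 0.

(* Over a noetherian ring, finite type is finite presentation. *)
Definition etale_hom := [/\ finite_type_hom, flat_hom & unramified_hom].
End Homs.

(* Main.v *)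
(* Write e for the image of 1 under the section of mult : B (x) B -> B; it exists
   because the kernel I of mult is finitely generated and satisfies I = I^2.
   The functor Hom(B, -) over B (x) B is the direct summand e(-) of the identity,
   hence exact, so the squares are computed by B (x) B itself.
   Since A is noetherian, B is projective over A, with dual basis (phi_p, m_p), and
   the operator trace is b |-> sum_p phi_p (b m_p); uniqueness of the latter is
   checked on basic open sets over which B is free.
   Writing e = sum_k x_k (x) y_k, one computes
     sum_k tr(b x_k) y_k = sum_p m_p b (sum_k phi_p(x_k) y_k) = b mult(e) = b.
   Thus (tr(- x_k), y_k) is a dual basis, which gives nondegeneracy, and applying tr
   gives (tr (x) tr)(sec b) = tr b (x) 1, which is rigidity of the trace. *)
Require Import Defs.
From HB Require Import structures.
From mathcomp Require Import all_boot all_algebra.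
From mathcomp Require Import generic_quotient ring_quotient.
From mathcomp Require Import boolp classical_sets functions.
From mathcomp Require Import perm ring.
Import GRing.Theory.
Set Implicit Arguments.
Unset Strict Implicit.
Unset Printing Implicit Defensive.
Local Open Scope quotient_scope.
Local Open Scope ring_scope.
(** * Cohomology of morphisms of the derived category *)

(** The squares come with arbitrary K-flat and K-injective resolutions, and equality in the derived
    category is an inductively generated congruence [deq]. An equation there is exploited through an
    invariant, the relation [drel] induced on cohomology, and is established by rewriting zigzags.
    The zigzags become computable because B has a dual basis over A: every K-flat resolution P ->
    B[0] then has an A-linear section q at the level of complexes, so that theta and theta (x) theta
    are represented by honest maps out of B[0] and B[0] (x) B[0], and rigidity becomes an equation
    between elements of A (x) A. The trace is specified only on the basic open sets where B is free.
    Its uniqueness is proved without prime ideals or ranks: if d is the difference of two candidate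
    values, the radical of the annihilator of d is shown to contain 1, by localizing at explicit
    determinants. *)

Section CohomologyRelation.
Variable R : comPzRingType.
Implicit Types X Y Z : cplx R.

Definition cohomologous X i (x x' : X (i + 1)) := exists w : X i, x - x' = dif X i w.

Lemma cohomologous_refl X i (x : X (i + 1)) : cohomologous x x.
Proof. by exists 0; rewrite subrr linear0. Qed.

Lemma cohomologous_sym X i (x y : X (i + 1)) : cohomologous x y -> cohomologous y x.
Proof. by case=> w E; exists (- w); rewrite linearN /= -E opprB. Qed.

Lemma cohomologous_trans X i (y x z : X (i + 1)) :
  cohomologous x y -> cohomologous y z -> cohomologous x z.
Proof. by case=> v E [w F]; exists (v + w); rewrite linearD /= -E -F addrA subrK. Qed.

Lemma cohomologous_cm X Y (f : cmap X Y) i (x y : X (i + 1)) :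
  cohomologous x y -> cohomologous (f _ x) (f _ y).
Proof. by case=> w E; exists (f i w); rewrite -cm_dif -E linearB. Qed.

Lemma cm_cocycle X Y (f : cmap X Y) i (x : X i) : dif X i x = 0 -> dif Y i (f i x) = 0.
Proof. by move=> dx; rewrite -cm_dif dx linear0. Qed.

(* A morphism of the derived category is followed on cocycles as a relation,
   because the inverse of a quasi-isomorphism is not a map of complexes. *)
Fixpoint drel X Y (f : dmor X Y) i : X (i + 1) -> Y (i + 1) -> Prop :=
  match f in dmor X Y return X (i + 1) -> Y (i + 1) -> Prop with
  | dhom _ _ h => fun x y => cohomologous (h _ x) y
  | dinv _ _ s _ => fun y x => cohomologous (s _ x) y
  | dcomp _ Y' _ g f => fun x z =>
      exists y : Y' (i + 1), [/\ dif Y' _ y = 0, drel f x y & drel g y z]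
  end.

Lemma drel_cohomologous X Y (f : dmor X Y) i (x x' : X (i + 1)) (y y' : Y (i + 1)) :
  cohomologous x x' -> cohomologous y y' -> drel f x y -> drel f x' y'.
Proof.
elim: f x x' y y' => {X Y} [X Y h|X Y s qs|X Y Z g IHg f IHf] x x' y y' xx' yy' /=.
- move=> hxy; apply: (cohomologous_trans (y := h _ x)).
    exact/cohomologous_sym/cohomologous_cm.
  exact: cohomologous_trans yy'.
- move=> syx; apply: (cohomologous_trans (y := s _ y)).
    exact/cohomologous_sym/cohomologous_cm.
  exact: cohomologous_trans xx'.
case=> z [dz xz zy]; exists z; split=> //.
  exact: IHf xx' (cohomologous_refl z) xz.
exact: IHg (cohomologous_refl z) yy' zy.
Qed.

Lemma qis_inj X Y (f : cmap X Y) (qf : qis f) i (x x' : X (i + 1)) :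
  dif X _ x = 0 -> dif X _ x' = 0 ->
  cohomologous (f _ x) (f _ x') -> cohomologous x x'.
Proof.
move=> dx dx' [w E]; have [||z zE] := (qf i).1 (x - x').
- by rewrite linearB /= dx dx' subrr.
- by exists w; rewrite -E linearB.
- by exists z.
Qed.

Lemma qis_surj X Y (f : cmap X Y) (qf : qis f) i (y : Y (i + 1)) :
  dif Y _ y = 0 -> exists2 x, dif X _ x = 0 & cohomologous (f _ x) y.
Proof. by case: (qf i) => _ h /h[x dx [w E]]; exists x => //; exists w. Qed.

Lemma qisI X Y (f : cmap X Y) :
  (forall i (x : X (i + 1)), dif X _ x = 0 -> cohomologous (f _ x) 0 ->
     cohomologous x 0) ->
  (forall i (y : Y (i + 1)), dif Y _ y = 0 ->
     exists2 x, dif X _ x = 0 & cohomologous (f _ x) y) -> qis f.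
Proof.
move=> fi fs i; split=> [x dx [y E]|y dy].
  case: (fi i x dx) => [|w]; first by exists y; rewrite subr0.
  by rewrite subr0 => ->; exists w.
by have [x dx [w E]] := fs i y dy; exists x => //; exists w.
Qed.

(** By induction on [deq]; the cancellation rules for [dinv] rest on the injectivity and
    surjectivity of a quasi-isomorphism on cohomology. Through this invariant an equation in the
    localization yields facts about elements. *)
Lemma drel_deq X Y (f g : dmor X Y) : f =D g ->
  forall i (x : X (i + 1)) (y : Y (i + 1)), dif X _ x = 0 -> dif Y _ y = 0 ->
  drel f x y <-> drel g x y.
Proof.
elim=> {X Y f g}.
- by [].
- by move=> X Y f g _ IH i x y dx dy; rewrite IH.
- by move=> X Y f g h _ IH _ IH' i x y dx dy; rewrite IH // IH'.
- move=> X Y Z g g' f f' _ IHg _ IHf i x z dx dz /=.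
  by split=> -[y [dy xy yz]]; exists y; split=> //;
    [rewrite -IHf|rewrite -IHg|rewrite IHf|rewrite IHg].
- move=> W X Y Z h g f i x z dx dz /=; split.
    move=> [y [dy [y' [dy' xy' y'y] yz]]]; exists y'; split=> //.
    by exists y.
  move=> [y [dy xy [y' [dy' yy' y'z]]]]; exists y'; split=> //.
  by exists y.
- move=> X Y f i x y dx dy /=; split=> [[y' [dy' xy' y'y]]|xy].
    exact: drel_cohomologous (cohomologous_refl x) y'y xy'.
  by exists y; split=> //; exact: cohomologous_refl.
- move=> X Y f i x y dx dy /=; split=> [[x' [dx' xx' x'y]]|xy].
    exact: drel_cohomologous (cohomologous_sym xx') (cohomologous_refl y) x'y.
  by exists x; split=> //; exact: cohomologous_refl.
- by move=> X Y f g E i x y dx dy /=; rewrite E.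
- move=> X Y Z g f i x z dx dz /=; split=> [[y [dy xy yz]]|xz].
    exact: cohomologous_trans (cohomologous_cm g xy) yz.
  by exists (f _ x); split=> //; [exact: cm_cocycle | exact: cohomologous_refl].
- move=> X Y s qs i x y dx dy /=; split=> [[z [dz xz yz]]|xy].
    apply: (qis_inj qs) => //.
    exact: cohomologous_trans xz (cohomologous_sym yz).
  exists (s _ x); split; [exact: cm_cocycle | exact: cohomologous_refl |].
  exact/cohomologous_cm/cohomologous_sym.
- move=> X Y s qs i x y dx dy /=; split=> [[z [dz xz yz]]|xy].
    exact: cohomologous_trans (cohomologous_sym xz) yz.
  have [z dz zx] := qis_surj qs dx; exists z; split=> //.
  exact: cohomologous_trans zx xy.
Qed.

(** Two out of three, for a triangle that commutes only in the derived category; this is how the map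
    [c] of [is_rho] is given. *)
Lemma qis_right X Y Z (f : cmap Y Z) (p : cmap X Y) (h : cmap X Z) :
  dhom f \oD dhom p =D dhom h -> qis p -> qis h -> qis f.
Proof.
move=> fp qp qh.
have E i (x : X (i + 1)) : dif X _ x = 0 -> cohomologous (f _ (p _ x)) (h _ x).
  move=> dx; have dhx := cm_cocycle h dx.
  have [_] := drel_deq fp dx dhx; case=> [|y [dy xy yz]].
    exact: cohomologous_refl.
  exact: cohomologous_trans (cohomologous_cm f xy) yz.
apply: qisI => i y dy.
  have [x dx xy] := qis_surj qp dy => fy.
  apply: (cohomologous_trans (cohomologous_sym xy)).
  rewrite -(linear0 (p (i + 1))); apply: cohomologous_cm.
  apply: (qis_inj qh) => //; first by rewrite linear0.
  rewrite linear0; apply: cohomologous_trans (cohomologous_sym (E _ _ dx)) _.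
  exact: cohomologous_trans (cohomologous_cm f xy) fy.
have [x dx xy] := qis_surj qh dy; exists (p _ x); first exact: cm_cocycle.
exact: cohomologous_trans (E _ _ dx) xy.
Qed.

Lemma qis_left X Y Z (g : cmap Y Z) (f : cmap X Y) (h : cmap X Z) :
  (forall i x, g i (f i x) = h i x) -> qis g -> qis h -> qis f.
Proof.
move=> gf qg qh; apply: qisI => i.
  move=> x dx fx; apply: (qis_inj qh) => //; first by rewrite linear0.
  by rewrite -!gf linear0; exact: cohomologous_cm.
move=> y dy; have [x dx xy] := qis_surj qh (cm_cocycle g dy).
exists x => //; apply: (qis_inj qg) => //; first exact: cm_cocycle.
by rewrite gf.
Qed.

Lemma qis_ext X Y (f g : cmap X Y) : (forall i, f i =1 g i) -> qis f -> qis g.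
Proof.
move=> fg qf i; have [fi fs] := qf i; split=> [x dx [y E]|y dy].
  by apply: fi => //; exists y; rewrite fg.
by have [x dx [y' E]] := fs y dy; exists x => //; exists y'; rewrite -fg.
Qed.

Lemma qis_comp X Y Z (g : cmap Y Z) (f : cmap X Y) :
  qis g -> qis f -> qis (ccomp g f).
Proof.
move=> qg qf; apply: qisI => i /=.
  move=> x dx gfx; apply: (qis_inj qf) => //; first by rewrite linear0.
  rewrite linear0; apply: (qis_inj qg); rewrite ?linear0 //; exact: cm_cocycle.
move=> z dz; have [y dy yz] := qis_surj qg dz.
have [x dx xy] := qis_surj qf dy; exists x => //.
exact: cohomologous_trans (cohomologous_cm g xy) yz.
Qed.

Lemma qis_bij X Y (f : cmap X Y) :
  (forall i x, f i x = 0 -> x = 0) -> (forall i y, exists x, f i x = y) -> qis f.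
Proof.
move=> fi fs; apply: qisI => i.
  move=> x dx [y]; have [w <-] := fs i y; rewrite -cm_dif subr0 => E.
  exists w; rewrite subr0; apply/eqP; rewrite -subr_eq0; apply/eqP.
  by apply: fi; rewrite linearB /= E subrr.
move=> y dy; have [x E] := fs _ y; exists x.
  by apply: fi; rewrite cm_dif E.
by rewrite E; exact: cohomologous_refl.
Qed.

Lemma diso_qis X Y (f : cmap X Y) : qis f -> diso (dhom f).
Proof. by move=> qf; exists (dinv qf); [exact: deq_invl | exact: deq_invr]. Qed.

Lemma diso_deq X Y (f g : dmor X Y) : f =D g -> diso f -> diso g.
Proof.
move=> fg [h hf fh]; exists h.
  by apply: deq_trans hf; apply: deq_cong; [exact: deq_refl | exact: deq_sym].
by apply: deq_trans fh; apply: deq_cong; [exact: deq_sym | exact: deq_refl].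
Qed.

Lemma deq_congl X Y Z (g g' : dmor Y Z) (f : dmor X Y) :
  g =D g' -> g \oD f =D g' \oD f.
Proof. by move=> gg'; apply: deq_cong => //; exact: deq_refl. Qed.

Lemma deq_congr X Y Z (g : dmor Y Z) (f f' : dmor X Y) :
  f =D f' -> g \oD f =D g \oD f'.
Proof. by move=> ff'; apply: deq_cong => //; exact: deq_refl. Qed.

Lemma deq_cancel_qis X Y Z (s : cmap Y Z) (f g : dmor X Y) :
  qis s -> dhom s \oD f =D dhom s \oD g -> f =D g.
Proof.
move=> qs E.
have K (h : dmor X Y) : dinv qs \oD (dhom s \oD h) =D h.
  apply: deq_trans (deq_assoc _ _ _) _.
  apply: deq_trans (deq_congl _ (deq_invl qs)) _; exact: deq_idl.
apply: deq_trans (deq_sym (K f)) _; apply: deq_trans (K g); exact: deq_congr.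
Qed.

Lemma deq_comp_ext W X Y Z (g : cmap Y Z) (f : cmap X Y) (g' : cmap W Z) (f' : cmap X W) :
  (forall i x, g i (f i x) = g' i (f' i x)) ->
  dhom g \oD dhom f =D dhom g' \oD dhom f'.
Proof.
move=> E; apply: deq_trans (deq_hom _ _) _; apply: deq_trans (deq_sym (deq_hom _ _)).
exact: deq_ext.
Qed.
End CohomologyRelation.

Lemma dres_deq (R S : comPzRingType) (u : {rmorphism R -> S}) (X Y : cplx S)
  (f g : dmor X Y) : f =D g -> dres u f =D dres u g.
Proof.
elim=> {X Y f g} /=.
- by move=> *; exact: deq_refl.
- by move=> *; exact: deq_sym.
- by move=> X Y f g h _ fg _ gh; exact: deq_trans gh.
- by move=> *; exact: deq_cong.
- by move=> *; exact: deq_assoc.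
- move=> X Y f; apply: deq_trans (deq_idl _); apply: deq_congl; exact: deq_ext.
- move=> X Y f; apply: deq_trans (deq_idr _); apply: deq_congr; exact: deq_ext.
- by move=> X Y f g E; exact: deq_ext.
- by move=> X Y Z g f; apply: deq_trans (deq_hom _ _) _; exact: deq_ext.
- by move=> X Y s qs; apply: deq_trans (deq_invl _) _; exact: deq_ext.
- by move=> X Y s qs; apply: deq_trans (deq_invr _) _; exact: deq_ext.
Qed.

(** * Quotients of modules and flatness *)

Record submodule (R : comPzRingType) (X : lmodType R) := Submodule {
  smem :> X -> Prop;
  smem0 : smem 0;
  smemD : forall x y, smem x -> smem y -> smem (x + y);
  smemZ : forall a x, smem x -> smem (a *: x) }.

Section QuotientModule.
Variables (R : comPzRingType) (X : lmodType R) (N : submodule X).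

Definition smem_pred : {pred X} := fun x => `[< N x >].
Fact smem_zmod_closed : zmod_closed smem_pred.
Proof.
split=> [|x y /asboolP Nx /asboolP Ny]; apply/asboolP; first exact: smem0.
by rewrite -scaleN1r; apply: smemD => //; exact: smemZ.
Qed.
HB.instance Definition _ := GRing.isZmodClosed.Build X smem_pred smem_zmod_closed.

Definition qmod := Quotient.quot smem_pred.
HB.instance Definition _ := GRing.Zmodule.on qmod.
HB.instance Definition _ := EqQuotient.on qmod.

Definition qproj (x : X) : qmod := \pi_(Quotient.quot smem_pred) x.
Definition qrepr (q : qmod) : X := repr (q : Quotient.quot smem_pred).

Lemma qreprK q : qproj (qrepr q) = q.
Proof. exact: reprK. Qed.

Lemma qproj_eq (x y : X) : qproj x = qproj y <-> N (x - y).
Proof.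
have E : (x - y \in smem_pred) = (qproj x == qproj y).
  exact: (Quotient.idealrBE smem_pred x y).
split=> [xy|Nxy]; first by apply/asboolP; rewrite -[`[< _ >]]/(x - y \in smem_pred) E xy.
by apply/eqP; rewrite -E; apply/asboolP.
Qed.

Let projD (x y : X) : qproj (x + y) = qproj x + qproj y.
Proof. exact: (Quotient.pi_add smem_pred x y). Qed.

Let scale (a : R) (q : qmod) : qmod := qproj (a *: qrepr q).
Let scaleE a x : scale a (qproj x) = qproj (a *: x).
Proof. by apply/qproj_eq; rewrite -scalerBr; apply: smemZ; apply/qproj_eq/qreprK. Qed.
Fact qmod_scaleA a b x : scale a (scale b x) = scale (a * b) x.
Proof. by rewrite -[x]qreprK !scaleE scalerA. Qed.
Fact qmod_scale1 : left_id 1 scale.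
Proof. by move=> x; rewrite -[x]qreprK !scaleE scale1r. Qed.
Fact qmod_scaleDr : right_distributive scale +%R.
Proof. by move=> a x y; rewrite -[x]qreprK -[y]qreprK -projD !scaleE scalerDr projD. Qed.
Fact qmod_scaleDl x : {morph scale^~ x : a b / a + b}.
Proof. by move=> a b; rewrite -[x]qreprK !scaleE scalerDl projD. Qed.
HB.instance Definition _ := GRing.Zmodule_isLmodule.Build R qmod
  qmod_scaleA qmod_scale1 qmod_scaleDr qmod_scaleDl.

Fact qproj_linear : linear qproj.
Proof. by move=> a x y; rewrite projD -scaleE. Qed.
HB.instance Definition _ := GRing.isLinear.Build R X qmod _ qproj qproj_linear.

Lemma qproj_eq0 x : qproj x = 0 <-> N x.
Proof. by rewrite -[x in N x]subr0 -qproj_eq linear0. Qed.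

Section Lift.
Variables (Y : lmodType R) (g : {linear X -> Y}).
Hypothesis gN : forall x, N x -> g x = 0.
Definition qlift_fun (q : qmod) : Y := g (qrepr q).
Let qlift_funE x : qlift_fun (qproj x) = g x.
Proof.
apply/eqP; rewrite -subr_eq0 -linearB /= gN //; exact/qproj_eq/qreprK.
Qed.
Fact qlift_linear : linear qlift_fun.
Proof.
move=> a x y; rewrite -[x]qreprK -[y]qreprK -linearP !qlift_funE.
exact: linearP.
Qed.
Definition qlift (_ : forall x, N x -> g x = 0) := qlift_fun.
HB.instance Definition _ := GRing.isLinear.Build R qmod Y _ (qlift gN) qlift_linear.
Lemma qlift_proj x : qlift gN (qproj x) = g x.
Proof. exact: qlift_funE. Qed.
End Lift.
End QuotientModule.

Section Kernel.
Variables (R : comPzRingType) (X Y : lmodType R) (g : {linear X -> Y}).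
Definition kernel : submodule X.
Proof.
exists (fun x => g x = 0) => [|x y gx gy|a x gx]; first exact: linear0.
  by rewrite linearD /= gx gy addr0.
by rewrite linearZ /= gx scaler0.
Defined.
Definition image_sub : submodule Y.
Proof.
exists (fun y => exists x, y = g x) => [|_ _ [x ->] [y ->]|a _ [x ->]].
- by exists 0; rewrite linear0.
- by exists (x + y); rewrite linearD.
- by exists (a *: x); rewrite linearZ.
Defined.
End Kernel.

Section FlatExact.
Variables (A B : comPzRingType) (u : {rmorphism A -> B}).

Definition btens (M : lmodType A) : lmodType A :=
  tens (fun _ : unit => restr u B^o) (fun _ : unit => M).
Definition bpure (M : lmodType A) (b : B) (x : M) : btens M :=
  @tensor unit A (fun=> restr u B^o) (fun=> M) tt b x.
Definition bmap (M N : lmodType A) (f : {linear M -> N}) :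
    {linear btens M -> btens N} :=
  @tens_map unit unit id A (fun=> restr u B^o) (fun=> M)
      (fun=> restr u B^o) (fun=> N) (fun=> idfun) (fun=> f).

Lemma bmap_pure (M N : lmodType A) (f : {linear M -> N}) b x :
  bmap f (bpure b x) = bpure b (f x).
Proof. exact: (tlift_tensor (tens_map_bilin (h := id) _ _)). Qed.

Lemma btens_ind (M : lmodType A) (P : btens M -> Prop) :
  P 0 -> (forall s t, P s -> P t -> P (s + t)) ->
  (forall b x, P (bpure b x)) -> forall t, P t.
Proof. by move=> P0 PD Pp; apply: tens_ind => // -[]; exact: Pp. Qed.

(** [flat_hom] speaks of injections only, so g is factored as N -> N / ker g -> P, whose second map
    stays injective after tensoring. The projection of B (x) N onto the cokernel of [bmap f] factors
    through B (x) (N / ker g) by a map h, so whatever the first map kills lies in the image of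
    [bmap f]. *)
Lemma flat_exact (M N P : lmodType A) (f : {linear M -> N}) (g : {linear N -> P}) :
  flat_hom u -> (forall y, g y = 0 -> exists x, y = f x) ->
  forall z, bmap g z = 0 -> exists w, z = bmap f w.
Proof.
move=> flat_u fg z gz.
pose g' := qlift (N := kernel g) (fun _ h => h).
have g'_inj : injective g'.
  move=> p q; rewrite -[p]qreprK -[q]qreprK /g' !qlift_proj => gpq.
  by apply/eqP; rewrite -subr_eq0 -linearB; apply/eqP/qproj_eq0; rewrite /= linearB /= gpq subrr.
pose I := image_sub (bmap f).
have hb : bilin (fun (_ : unit) (b : restr u B^o) (q : qmod (kernel g)) =>
                   qproj I (bpure b (qrepr q))).
  have E (b : B) (x y : N) : g x = g y ->
      qproj I (bpure b x) = qproj I (bpure b y).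
    move=> gxy; apply/eqP; rewrite -subr_eq0 -linearB; apply/eqP/qproj_eq0.
    have [|w /eqP] := fg (x - y); first by rewrite linearB /= gxy subrr.
    rewrite subr_eq => /eqP ->; exists (bpure b w).
    by rewrite bmap_pure /bpure tensorDr addrK.
  move=> _; split=> q a x y; first by rewrite /bpure tensorDl tensorZl linearP.
  rewrite -linearP /= -tensorZr -tensorDr; apply: E.
  by rewrite [RHS]linearP; exact: (linearP g').
pose h : {linear btens (qmod (kernel g)) -> qmod I} := tlift hb.
have hg t : h (bmap (qproj (kernel g)) t) = qproj I t.
  elim/btens_ind: t => [|s t hs ht|b x]; first by rewrite !linear0.
    by rewrite !linearD /= hs ht.
  rewrite bmap_pure [LHS](tlift_tensor hb).
  apply/eqP; rewrite -subr_eq0 -linearB; apply/eqP/qproj_eq0.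
  rewrite -[bpure b x]/(@tensor unit A (fun=> restr u B^o) (fun=> N) tt b x).
  have [|w /eqP] := fg (qrepr (qproj (kernel g) x) - x).
    by rewrite linearB /= -[g (qrepr _)]/(g' _) /g' qlift_proj subrr.
  rewrite subr_eq => /eqP ->; exists (bpure b w).
  by rewrite bmap_pure /bpure tensorDr addrK.
have gE t : bmap g' (bmap (qproj (kernel g)) t) = bmap g t.
  elim/btens_ind: t => [|s t hs ht|b x]; first by rewrite !linear0.
    by rewrite !linearD /= hs ht.
  by rewrite !bmap_pure /= /g' qlift_proj.
have : bmap (qproj (kernel g)) z = 0.
  apply: (flat_u _ _ g' g'_inj).
  exact: etrans (gE z) (etrans gz (esym (linear0 (bmap g')))).
by move/(congr1 h); rewrite hg linear0 => /qproj_eq0.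
Qed.
End FlatExact.

(** * K-flat complexes *)

(* Transport between the degrees [i] and [j] of a complex, 0 if they differ. *)
Section DegreeCast.
Variables (R : comPzRingType) (X : cplx R).
Definition degree_cast i j : {linear X i -> X j} :=
  match i =P j with
  | ReflectT e => match e in _ = k return {linear X i -> X k} with erefl => idfun end
  | ReflectF _ => \0
  end.
Lemma degree_cast_id i (x : X i) : degree_cast i i x = x.
Proof. by rewrite /degree_cast; case: eqP => // e; rewrite (eq_axiomK e). Qed.
End DegreeCast.

Section Cone.
Variables (R : comPzRingType) (X Y : cplx R) (f : cmap X Y).

Definition cone_ob (i : int) : lmodType R := prod (X (i + 1)) (Y i).
Definition cone_dif (i : int) (p : cone_ob i) : cone_ob (i + 1) :=
  (- dif X (i + 1) p.1, f (i + 1) p.1 + dif Y i p.2).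
Fact cone_dif_linear i : linear (@cone_dif i).
Proof.
move=> a [x y] [x' y']; rewrite /cone_dif /= !linearP /=.
by congr (_, _); rewrite /= ?opprD ?scalerN // scalerDr addrACA.
Qed.
HB.instance Definition _ i := GRing.isLinear.Build R (cone_ob i) (cone_ob (i + 1)) _
  (@cone_dif i) (@cone_dif_linear i).
Fact cone_dif2 i p : cone_dif (@cone_dif i p) = 0.
Proof.
by rewrite /cone_dif /= !linearN linearD /= !dif2 cm_dif addr0 addNr !oppr0.
Qed.
Definition cone : cplx R := @Cplx R cone_ob (fun i => @cone_dif i) cone_dif2.

Lemma qis_cone : qis f -> acyclic cone.
Proof.
move=> qf i [x y] [/eqP]; rewrite oppr_eq0 => /eqP dx fxy.
have [||x' E] := (qf (i + 1)).1 x; first exact: dx.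
  by exists (- y); rewrite linearN; apply/eqP; rewrite -addr_eq0 fxy.
have [|x'' dx'' [y' E']] := (qf i).2 (f _ x' + y).
  by rewrite linearD /= -cm_dif -E.
exists (x'' - x', - y'); congr (_, _) => /=.
  by rewrite linearB /= dx'' sub0r opprK.
rewrite linearN -E' linearB /= opprB; move: (f _ x') (f _ x'') => v w.
by rewrite [RHS]addrC addrA subrK addrAC subrr add0r.
Qed.

Lemma cone_qis : acyclic cone -> qis f.
Proof.
(* The cone carries X one degree higher, so injectivity in degree i + 2 is exactness of the cone in
   degree i + 1; writing the index as a successor avoids a cast. *)
move=> ac i; rewrite -(subrK 1 i); move: (i - 1) => {}i; split.
  move=> x dx [y E].
  have [|[x' y'] [-> _]] := ac i (x, - y); last by exists (- x'); rewrite linearN.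
  by congr (_, _); rewrite /= ?dx ?oppr0 // E linearN subrr.
move=> y dy; have [|[x y'] /= [/eqP]] := ac (i + 1) (0, y).
  by congr (_, _); rewrite /= !linear0 ?oppr0 // add0r.
rewrite eq_sym oppr_eq0 => /eqP dx E; exists x => //; exists (- y').
by rewrite E linearN opprD addrA subrr add0r.
Qed.
End Cone.

Section TensorCone.
Variables (A : comPzRingType) (P X Y : cplx A) (f : cmap X Y).
Let C := cone f.
Let sg (i : int) : A := (-1) ^+ absz i.
Let sg2 i : sg i * sg i = 1.
Proof. by rewrite -expr2 sqrr_sign. Qed.
Let T := tmap (cid_map P) f.

(** The isomorphism from P (x) cone f to cone (P (x) f). The Koszul sign comes from moving x past
    the degree shift of X in the cone, and it matches the negated differential there. *)
Let phi (n : int) (p : idx n) (x : P (val p).1) (z : C (val p).2) : cone T n :=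
  (sg (val p).1 *: @ttensor A P X _ (idxr p) x z.1, @ttensor A P Y n p x z.2).
Fact tens_cone_bilin n : bilin (@phi n).
Proof.
move=> p; split=> z a x y; rewrite /phi.
  by rewrite !(ttensorDl, ttensorZl) scalerDr !scalerA mulrC -scalerA.
by rewrite !(ttensorDr, ttensorZr) scalerDr !scalerA mulrC -scalerA.
Qed.
Definition tens_cone n : {linear tob P C n -> cone T n} := tlift (@tens_cone_bilin n).

Lemma tens_coneE n p x z : tens_cone n (@ttensor A P C n p x z) = phi x z.
Proof. exact: (tlift_tensor (@tens_cone_bilin n)). Qed.

Lemma tens_cone_dif (n : int) t :
  tens_cone (n + 1) (tdif P C n t) = dif (cone T) n (tens_cone n t).
Proof.
elim/tob_ind: t => [|s t Hs Ht|[[i j] e] x z]; first by rewrite !linear0.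
  by rewrite !linearD /= Hs Ht.
rewrite tens_coneE tdifE linearD linearZ_LR !tens_coneE; congr (_, _).
  apply: etrans (esym (congr1 -%R _)); last first.
    by rewrite linearZ_LR tdifE.
  rewrite /= /= /sg sign_absz.
  rewrite scalerDr opprD scaleNr; congr (- _ + _).
    by congr (_ *: _); exact: ttensor_irr.
  by rewrite -[- dif X _ _]scaleN1r ttensorZr scaleN1r !scalerN.
have -> : T (n + 1) (phi x z).1
    = sg i *: @ttensor A P Y _ (idxr (exist _ (i, j) e)) x (f (j + 1) z.1).
  by rewrite linearZ_LR; congr (_ *: _); exact: tmap_funE.
rewrite [dif (tcplx P Y) _ _]tdifE /tdif_pure /= ttensorDr scalerDr.
by rewrite addrCA.
Qed.

(** An ingredient of the inverse isomorphism. An element of X j lies in the cone in degree j - 1,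
    whose first component is X (j - 1 + 1); this degree equals j only propositionally, whence the
    cast. *)
Let coerce (j : int) (x : X j) : C (j - 1) := (degree_cast X j (j - 1 + 1) x, 0).
Fact cone_coerce_linear j : linear (@coerce j).
Proof. by move=> a x y; rewrite /coerce linearP; congr (_, _); rewrite /= scaler0 addr0. Qed.
HB.instance Definition _ j := GRing.isLinear.Build A (X j) (C (j - 1)) _
  (@coerce j) (@cone_coerce_linear j).
Let inr_lin (j : int) (y : Y j) : C j := (0, y).
Fact cone_inr_linear j : linear (@inr_lin j).
Proof. by move=> a x y; congr (_, _); rewrite /= scaler0 addr0. Qed.
HB.instance Definition _ j := GRing.isLinear.Build A (Y j) (C j) _
  (@inr_lin j) (@cone_inr_linear j).

Fact idx_pred_subproof n (p : idx (n + 1)) : (val p).1 + ((val p).2 - 1) == n.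
Proof. by rewrite addrA (eqP (valP p)) addrK. Qed.
Let idx_pred n (p : idx (n + 1)) : idx n :=
  exist _ ((val p).1, (val p).2 - 1) (idx_pred_subproof p).

Let from_X n : {linear tob P X (n + 1) -> tob P C n} :=
  @tens_map _ _ (@idx_pred n) A (fun p : idx (n + 1) => P (val p).1)
    (fun p => X (val p).2) (fun p : idx n => P (val p).1) (fun p => C (val p).2)
    (fun p => sg (val p).1 \*: (idfun : {linear P (val p).1 -> P (val p).1}))
    (fun p => @coerce (val p).2).
Let from_Y n : {linear tob P Y n -> tob P C n} :=
  @tens_map _ _ id A (fun p : idx n => P (val p).1)
    (fun p => Y (val p).2) (fun p : idx n => P (val p).1) (fun p => C (val p).2)
    (fun=> idfun) (fun p => @inr_lin (val p).2).

Lemma tens_coneK n t : from_X n (tens_cone n t).1 + from_Y n (tens_cone n t).2 = t.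
Proof.
elim/tob_ind: t => [|s t Hs Ht|[[i j] e] x z]; first by rewrite !linear0 addr0.
  by rewrite !linearD /= addrACA Hs Ht.
rewrite tens_coneE /= linearZ_LR.
have -> : from_X n (@ttensor A P X _ (idxr (exist _ (i, j) e)) x z.1)
    = sg i *: @ttensor A P C n (exist _ (i, j) e) x (z.1, 0).
  transitivity (@ttensor A P C n (idx_pred (idxr (exist _ (i, j) e))) (sg i *: x) (coerce z.1)).
    exact: (tlift_tensor (tens_map_bilin (h := @idx_pred n) _ _)).
  rewrite ttensorZl; congr (_ *: _).
  have E k (ek : i + k == n) : k = j ->
     @ttensor A P C n (exist _ (i, k) ek) x (degree_cast X (j + 1) (k + 1) z.1, 0) =
     @ttensor A P C n (exist _ (i, j) e) x (z.1, 0).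
    by move=> kj; subst k; rewrite degree_cast_id; exact: ttensor_irr.
  by apply: E; rewrite addrK.
have -> : from_Y n (@ttensor A P Y n (exist _ (i, j) e) x z.2)
    = @ttensor A P C n (exist _ (i, j) e) x (0, z.2).
  exact: (tlift_tensor (tens_map_bilin (h := id) _ _)).
rewrite /= scalerA sg2 scale1r -ttensorDr.
congr (@ttensor A P C n (exist _ (i, j) e) x _).
by case: z => z1 z2; congr (_, _); rewrite /= ?addr0 ?add0r.
Qed.

Lemma tens_cone_surj n w : exists t, tens_cone n t = w.
Proof.
have D (w1 w2 : cone T n) : (exists t, tens_cone n t = w1) ->
    (exists t, tens_cone n t = w2) -> exists t, tens_cone n t = w1 + w2.
  by move=> [s <-] [t <-]; exists (s + t); rewrite linearD.
case: w => t s; have -> : (t, s) = (t, 0) + (0, s) :> cone T n.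
  by congr (_, _); rewrite /= ?addr0 ?add0r.
apply: (D).
  elim/tob_ind: t => [|s' t Hs Ht|[[i j] e] x y]; first by exists 0; rewrite linear0.
    have -> : (s' + t, 0) = (s', 0) + (t, 0) :> cone T n by congr (_, _); rewrite /= addr0.
    exact: D.
  have [k jk] : exists k, j = k + 1 by exists (j - 1); rewrite subrK.
  subst j; have e' : i + k == n by rewrite -(inj_eq (addIr 1)) -addrA.
  exists (sg i *: @ttensor A P C n (exist _ (i, k) e') x (y, 0)).
  rewrite linearZ_LR tens_coneE; congr (_, _) => /=; last by rewrite ttensor0r scaler0.
  by rewrite scalerA sg2 scale1r; exact: ttensor_irr.
elim/tob_ind: s => [|s' t' Hs Ht|[[i j] e] x y]; first by exists 0; rewrite linear0.
  have -> : (0, s' + t') = (0, s') + (0, t') :> cone T n by congr (_, _); rewrite /= addr0.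
  exact: D.
exists (@ttensor A P C n (exist _ (i, j) e) x (0, y)).
by rewrite tens_coneE; congr (_, _) => /=; rewrite ttensor0r scaler0.
Qed.

(** The cone of P (x) f is P (x) cone f by [tens_cone], and K-flatness makes the latter acyclic. *)
Lemma kflat_qis : kflat P -> qis f -> qis T.
Proof.
move=> kP qf; apply: cone_qis => n w dw.
have inj m t : tens_cone m t = 0 -> t = 0.
  by move=> t0; rewrite -[t]tens_coneK t0 !linear0 addr0.
have [t tw] := tens_cone_surj w.
have [|s st] := kP C (qis_cone qf) n t.
  by apply: inj; apply: etrans (tens_cone_dif t) _; rewrite tw.
by exists (tens_cone n s); rewrite -tens_cone_dif -tw; congr (tens_cone _ _).
Qed.
End TensorCone.

Section Swap.
Variables (A : comPzRingType).
Let sg (i : int) : A := (-1) ^+ absz i.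

Section SwapMap.
Variables X Y : cplx A.

Fact idx_swap_subproof n (p : idx n) : (val p).2 + (val p).1 == n.
Proof. by rewrite addrC (valP p). Qed.
Definition idx_swap n (p : idx n) : idx n :=
  exist _ ((val p).2, (val p).1) (idx_swap_subproof p).

Let swp (n : int) (p : idx n) (x : X (val p).1) (y : Y (val p).2) : tob Y X n :=
  sg (val p).1 ^+ absz (val p).2 *: @ttensor A Y X n (idx_swap p) y x.
Fact tens_swap_bilin n : bilin (@swp n).
Proof.
move=> p; split=> z a x y; rewrite /swp.
  by rewrite ttensorDr ttensorZr scalerDr !scalerA mulrC.
by rewrite ttensorDl ttensorZl scalerDr !scalerA mulrC.
Qed.
Definition tens_swap_fun (n : int) : {linear tob X Y n -> tob Y X n} :=
  tlift (@tens_swap_bilin n).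
Lemma tens_swapE n p x y : tens_swap_fun n (@ttensor A X Y n p x y) = swp x y.
Proof. exact: (tlift_tensor (@tens_swap_bilin n)). Qed.

Fact tens_swap_dif (n : int) t :
  tens_swap_fun (n + 1) (tdif X Y n t) = tdif Y X n (tens_swap_fun n t).
Proof.
elim/tob_ind: t => [|s t Hs Ht|[[i j] e] x y]; first by rewrite !linear0.
  by rewrite !linearD /= Hs Ht.
rewrite tens_swapE tdifE linearD !linearZ_LR /= !tens_swapE /swp /= tdifE.
have E1 : sg (i + 1) ^+ `|j| = sg i ^+ `|j| * (-1) ^+ `|j|.
  by rewrite /sg sign_absz [(- (_ ^+ _)) ^+ _]exprNn mulrC.
have E2 : (-1) ^+ `|i| * sg i ^+ `|j + 1| = sg i ^+ `|j|.
  rewrite /sg exprAC sign_absz [(- (_ ^+ _)) ^+ _]exprNn mulrA.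
  by rewrite -expr2 sqrr_sign mul1r exprAC.
rewrite /tdif_pure /= [LHS]addrC scalerDr !scalerA E2 -E1.
by congr (_ *: _ + _ *: _); exact: ttensor_irr.
Qed.
Definition tens_swap : cmap (tcplx X Y) (tcplx Y X) :=
  @Cmap A (tcplx X Y) (tcplx Y X) tens_swap_fun tens_swap_dif.
End SwapMap.

Lemma tens_swapK X Y n t : tens_swap Y X n (tens_swap X Y n t) = t.
Proof.
elim/tob_ind: t => [|s t Hs Ht|[[i j] e] x y]; first by rewrite !linear0.
  by rewrite !linearD /= Hs Ht.
rewrite [tens_swap X Y _ _]tens_swapE linearZ_LR /= tens_swapE /= scalerA.
rewrite [sg j ^+ _]exprAC -expr2 -exprM mulnC exprM sqrr_sign expr1n scale1r.
exact: ttensor_irr.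
Qed.

Lemma qis_swap X Y : qis (tens_swap X Y).
Proof.
apply: qis_bij => i x; last by exists (tens_swap Y X i x); exact: tens_swapK.
by move=> E; rewrite -[x]tens_swapK E linear0.
Qed.

(** f (x) g is f (x) Q after X (x) g. K-flatness of X handles X (x) g, and that of Q handles f (x) Q
    once the factors are exchanged. The use is for sqp (x) sqp, from a K-flat resolution to B[0]. *)
Lemma qis_tmap (X Y P Q : cplx A) (f : cmap X Y) (g : cmap P Q) :
  kflat X -> kflat Q -> qis f -> qis g -> qis (tmap f g).
Proof.
move=> kX kQ qf qg.
have qfQ : qis (tmap f (cid_map Q)).
  have sE n t : tens_swap Q Y n (tmap (cid_map Q) f n (tens_swap X Q n t))
      = tmap f (cid_map Q) n t.
    elim/tob_ind: t => [|s t Hs Ht|[[i j] e] x y]; first by rewrite !linear0.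
      by rewrite !linearD /= Hs Ht.
    have -> : tmap (cid_map Q) f n (tens_swap X Q n (ttensor x y))
        = sg i ^+ absz j *: @ttensor A Q Y n (idx_swap (exist _ (i, j) e)) y (f i x).
      rewrite [tens_swap X Q _ _]tens_swapE linearZ_LR; congr (_ *: _).
      exact: tmap_funE.
    have -> : tmap f (cid_map Q) n (ttensor x y)
        = @ttensor A Y Q n (exist _ (i, j) e) (f i x) y by exact: tmap_funE.
    rewrite linearZ_LR /= tens_swapE /= scalerA.
    rewrite [sg j ^+ _]exprAC -expr2 -exprM mulnC exprM sqrr_sign expr1n scale1r.
    exact: ttensor_irr.
  apply: (qis_ext (f := ccomp (tens_swap Q Y) (ccomp (tmap (cid_map Q) f) (tens_swap X Q)))).
    by move=> n t; exact: sE.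
  apply: qis_comp (qis_swap _ _) _; apply: qis_comp (qis_swap _ _).
  exact: kflat_qis.
apply: (qis_ext (f := ccomp (tmap f (cid_map Q)) (tmap (cid_map X) g))).
  move=> n t; change (tmap f (cid_map Q) n (tmap (cid_map X) g n t) = tmap f g n t).
  elim/tob_ind: t => [|s t Hs Ht|p x y]; first by rewrite !linear0.
    by rewrite !linearD /= Hs Ht.
  rewrite [tmap (cid_map X) g _ _]tmap_funE.
  exact: etrans (tmap_funE f (cid_map Q) _ _) (esym (tmap_funE f g x y)).
by apply: qis_comp => //; exact: kflat_qis.
Qed.
End Swap.

Lemma ob0_eq0 (R : comPzRingType) (X : lmodType R) (i : int) (x : ob0 X i) :
  i != 0 -> x = 0.
Proof. by case: i x => [[|i]|i] //= x _; apply/rowP; case. Qed.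

Section Degree0.
Variables (A B : comPzRingType) (u : {rmorphism A -> B}).
Let B0 := res u (cplx0 B^o).

Lemma res_deg0_eq0 (i : int) (x : B0 i) : i != 0 -> x = 0.
Proof. by move=> i0; exact: (@ob0_eq0 B B^o i x). Qed.

Section Kflat.
Variable N : cplx A.
Fact idx0_subproof (n : int) : (0 : int, n).1 + (0 : int, n).2 == n.
Proof. by rewrite add0r. Qed.
Definition idx0 (n : int) (_ : unit) : idx n := exist _ (0, n) (idx0_subproof n).

Definition btens_deg0 (n : int) : {linear btens u (N n) -> tob B0 N n} :=
  @tens_map unit _ (idx0 n) A (fun=> restr u B^o) (fun=> N n)
    (fun p : idx n => B0 (val p).1) (fun p => N (val p).2)
    (fun=> idfun) (fun=> idfun).
Lemma btens_deg0E n b y :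
  btens_deg0 n (bpure u b y) = @ttensor A B0 N n (idx0 n tt) b y.
Proof. exact: (tlift_tensor (tens_map_bilin (h := idx0 n) _ _)). Qed.

Definition deg0_btens (n : int) : {linear tob B0 N n -> btens u (N n)} :=
  @tens_map _ unit (fun=> tt) A (fun p : idx n => B0 (val p).1) (fun p => N (val p).2)
    (fun=> restr u B^o) (fun=> N n)
    (fun p => degree_cast B0 (val p).1 0) (fun p => degree_cast N (val p).2 n).

Lemma btens_deg0K n : cancel (btens_deg0 n) (deg0_btens n).
Proof.
move=> t; elim/btens_ind: t => [|s t Hs Ht|b y]; first by rewrite !linear0.
  by rewrite !linearD Hs Ht.
rewrite btens_deg0E; apply: etrans (tlift_tensor (tens_map_bilin (h := fun=> tt) _ _) _ _) _.
rewrite /= -[LHS]/(bpure u (degree_cast B0 0 0 b) (degree_cast N n n y)).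
by rewrite !degree_cast_id.
Qed.

Lemma btens_deg0_surj (n : int) t : exists s, btens_deg0 n s = t.
Proof.
elim/tob_ind: t => [|s t [s' <-] [t' <-]|[[i j] e] x y].
- by exists 0; rewrite linear0.
- by exists (s' + t'); rewrite linearD.
have [i0|i0] := eqVneq i 0; last first.
  by exists 0; rewrite linear0 (@res_deg0_eq0 i x) // ttensor0l.
subst i; have jn : j = n by rewrite -(eqP e) add0r.
subst j; exists (bpure u (x : B) y); rewrite btens_deg0E; exact: ttensor_irr.
Qed.

Lemma btens_deg0_dif (n : int) t :
  tdif B0 N n (btens_deg0 n t) = btens_deg0 (n + 1) (bmap u (dif N n) t).
Proof.
elim/btens_ind: t => [|s t Hs Ht|b y]; first by rewrite !linear0.
  by rewrite !linearD /= Hs Ht.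
rewrite btens_deg0E tdifE bmap_pure btens_deg0E /tdif_pure.
rewrite (_ : dif B0 _ (b : B0 0) = 0) // ttensor0l add0r expr0 scale1r; exact: ttensor_irr.
Qed.
End Kflat.

(** In degree n the complex B[0] (x)_A N is B (x)_A N_n, through [btens_deg0], so this is
    [flat_exact] for consecutive differentials of N. *)
Lemma kflat_deg0 : flat_hom u -> kflat B0.
Proof.
move=> flat_u N aN i z dz; have [w wz] := btens_deg0_surj z.
have dw : bmap u (dif N (i + 1)) w = 0.
  apply: (can_inj (btens_deg0K (N := N) (n := i + 1 + 1))).
  by rewrite linear0 -btens_deg0_dif wz.
have [v vw] := flat_exact flat_u (aN i) dw.
by exists (btens_deg0 N i v); rewrite -wz vw; apply: esym; exact: btens_deg0_dif.
Qed.

Lemma tcplx_deg0_eq0 (N : lmodType A) (i : int) (t : tcplx B0 (cplx0 N) i) :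
  i != 0 -> t = 0.
Proof.
move=> i0; elim/tob_ind: t => [|s t -> ->|[[j k] e] x y]; rewrite ?addr0 //.
have [j0|j0] := eqVneq j 0; last by rewrite (@res_deg0_eq0 j x) // ttensor0l.
subst j; have ki : k = i by rewrite -(eqP e) add0r.
by subst k; rewrite (@ob0_eq0 A N i y) // ttensor0r.
Qed.
End Degree0.

(** * The canonical isomorphism attached to a section of multiplication *)

Section SectionOfMult.
Variables (A B : comPzRingType) (u : {rmorphism A -> B}).
Variable s : {linear restr (mult u) B^o -> (en u)^o}.
Hypothesis sK : forall b : B, mult u (s b) = b.

Lemma secM (z : en u) (b : B) : s (mult u z * b : B) = z * s b :> en u.
Proof. exact: (linearZ_LR s z (b : restr (mult u) B^o)). Qed.

Section CoindSec.
Variable X : lmodType (en u).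
Fact coind_sec_subproof (x : X) :
  (fun b : B => (s b : en u) *: x) \in @coind_pred _ _ (mult u) X.
Proof.
apply/asboolP; split=> [b c|z b]; first by rewrite raddfD scalerDl.
by rewrite secM scalerA.
Qed.
(** With e = s 1 this is b |-> (b (x) 1) e x. Evaluation at 1 embeds Hom(B, X) in X, and [coind_sec]
    is a retraction of it. *)
Definition coind_sec (x : X) : coind (mult u) X := Coind (coind_sec_subproof x).

Lemma coind_secK (f : coind (mult u) X) : coind_sec (f 1) = f.
Proof.
apply: coind_eqP => b; transitivity (f (mult u (s b) * 1)).
  exact/esym/(coind_funZ f (s b) 1).
by rewrite sK mulr1.
Qed.
End CoindSec.

(** Cocycles and coboundaries are tested at 1, where c is a quasi-isomorphism, and brought back by
    [coind_sec]. *)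
Lemma qis_coind (X Y : cplx (en u)) (c : cmap X Y) :
  qis c -> qis (coind_cmap (mult u) c).
Proof.
move=> qc; apply: qisI => i f df.
  have d1 : dif X (i + 1) (f 1) = 0 by move: (congr1 (fun g => coind_fun g 1) df).
  case=> psi E; have [|x xE] := (qc i).1 (f 1) d1.
    by exists (psi 1); move: (congr1 (fun g => coind_fun g 1) E); rewrite subr0.
  exists (coind_sec x); rewrite subr0 -[f]coind_secK; apply: coind_eqP => b /=.
  by rewrite xE linearZ.
have d1 : dif Y (i + 1) (f 1) = 0 by move: (congr1 (fun g => coind_fun g 1) df).
have [x dx [y E]] := (qc i).2 _ d1.
exists (coind_sec x).
  by apply: coind_eqP => b /=; rewrite linearZ /= dx scaler0.
exists (coind_sec y); rewrite -[f in LHS]coind_secK; apply: coind_eqP => b /=.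
by rewrite [RHS]linearZ /= -E scalerBr -[in RHS]linearZ.
Qed.

Let B0 := cplx0 B^o.

Lemma ten_eq0 (n : int) (t : ten u B0 B0 n) : n != 0 -> t = 0.
Proof.
move=> n0; elim/eob_ind: t => [|s1 t -> ->|[[j k] e] x y]; rewrite ?addr0 //.
have [j0|j0] := eqVneq j 0; last first.
  by rewrite (@res_deg0_eq0 A B u j x) //; exact: (@ttensor0l A (res u B0) (res u B0)).
subst j; have kn : k = n by rewrite -(eqP e) add0r.
subst k; rewrite (@res_deg0_eq0 A B u n y) //; exact: (@ttensor0r A (res u B0) (res u B0)).
Qed.

Lemma ten_dif0 (n : int) (t : ten u B0 B0 n) : dif (ten u B0 B0) n t = 0.
Proof.
have [n0|n0] := eqVneq n 0; last by rewrite (ten_eq0 t n0) linear0.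
by apply: ten_eq0; rewrite n0.
Qed.

Lemma en_deg0_surj (t : eob u B0 B0 0) : exists z, en_deg0 z = t.
Proof.
elim/eob_ind: t => [|s1 t [z <-] [w <-]|[[j k] e] x y].
- by exists 0; exact: en_deg00.
- by exists (z + w); exact: en_deg0D.
have [j0|j0] := eqVneq j 0; last first.
  exists 0; rewrite en_deg00 (@res_deg0_eq0 A B u j x) //.
  exact/esym/(@ttensor0l A (res u B0) (res u B0)).
subst j; have k0 : k = 0 by rewrite -(eqP e) add0r.
subst k; exists (en_pure u x y); rewrite en_deg0_pure.
exact: (@ttensor_irr A (res u B0) (res u B0) 0 0 0).
Qed.

Lemma en_deg0_inj (z : en u) : en_deg0 z = 0 -> z = 0.
Proof.
pose g : {linear tob (res u B0) (res u B0) 0 -> en u} :=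
  @tens_map _ unit (fun=> tt) A (fun p : idx 0 => res u B0 (val p).1)
    (fun p => res u B0 (val p).2) (fun=> restr u B^o) (fun=> restr u B^o)
    (fun p => degree_cast (res u B0) (val p).1 0)
    (fun p => degree_cast (res u B0) (val p).2 0).
have gK w : g (en_deg0 w) = w.
  elim/en_ind: w => [|w w' Hw Hw'|b c]; first by rewrite en_deg00 linear0.
    by rewrite en_deg0D linearD Hw Hw'.
  rewrite en_deg0_pure.
  apply: etrans (tlift_tensor (tens_map_bilin (h := fun=> tt) _ _) _ _) _.
  change (en_pure u (degree_cast (res u B0) 0 0 b) (degree_cast (res u B0) 0 0 c)
    = en_pure u b c).
  by rewrite !degree_cast_id.
by move=> z0; rewrite -[z]gK z0 linear0.
Qed.

Lemma qis_rho0 : qis (rho0 s).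
Proof.
apply: qis_bij => i.
  have [->|i0] := eqVneq i 0; last by move=> x _; exact: (@ob0_eq0 B B^o i x).
  move=> b E; rewrite -[b]sK.
  suff -> : s b = 0 by rewrite rmorph0.
  apply: en_deg0_inj; move: (congr1 (fun g => coind_fun g 1) E) => /=.
  by rewrite mulr1.
have [->|i0] := eqVneq i 0; last first.
  by move=> f; exists 0; rewrite linear0; apply: coind_eqP => b; apply/esym/ten_eq0.
move=> f; have [w wf] := en_deg0_surj (f 1).
(* f is determined by f 1, which corresponds to w; so f b corresponds to w * s b = s (mult w * b),
   and the preimage is [mult u w]. *)
exists (mult u w : B); rewrite -[f]coind_secK; apply: coind_eqP => b /=.
by rewrite secM mulrC en_deg0M wf.
Qed.

Lemma qis_ten_map (M : square u B0) : flat_hom u -> qis (ten_map u (sqp M)).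
Proof.
move=> flat_u.
have qp : qis (res_map u (sqp M)) := sqp_qis M.
have kP : kflat (res u (sqP M)) by exact: sqP_kflat.
have q := qis_tmap kP (kflat_deg0 flat_u) qp qp.
(* [ten] and [tcplx] share carriers and differentials, and [qis] does not involve the scalars. *)
move=> i; exact: (q i).
Qed.

(** Stated for any section of multiplication, since it serves both [sec u] and the tautological
    [tau_fun]. For the flat dimension, B[0] is its own K-flat resolution. *)
Lemma rigid_of_section (M : square u B0) (rho : dmor B0 (Sq M)) :
  flat_hom u -> is_rho s rho -> rigid_complex rho.
Proof.
move=> flat_u [c cE rhoE]; split.
- exists 0%N => i i0 x _; exists 0; rewrite linear0.
  by apply: (@ob0_eq0 B B^o); case: (i + 1) i0 => [[]|].
- move=> i; have [i0|i0] := eqVneq (i + 1) 0; last first.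
    exists 0%N, (fun=> 0); split=> [|x _]; first by case.
    by exists (fun=> 0), 0; rewrite big_ord0 linear0 addr0; apply: (@ob0_eq0 B B^o).
  have -> : i = -1 by apply/eqP; rewrite -addr_eq0 i0.
  exists 1%N, (fun=> (1 : B)); split=> // x _.
  by exists (fun=> (x : B)), 0; rewrite big_ord1 linear0 addr0; exact/esym/mulr1.
- exists (res u B0), (cid_map _); split; first exact: kflat_deg0.
    by apply: qis_bij => // i y; exists y.
  exists 0%N => N i i0 x _; exists 0; rewrite linear0.
  by apply: tcplx_deg0_eq0; case: (i + 1) i0 => [[]|].
apply: diso_deq (deq_sym rhoE) _; apply: diso_deq (deq_sym (deq_hom _ _)) _.
apply: diso_qis; apply: qis_comp qis_rho0; apply: qis_coind.
exact: qis_right cE (qis_ten_map _ flat_u) (sqj_qis M).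
Qed.
End SectionOfMult.

(** * The separability idempotent *)

Section Diagonal.
Variables (A B : comPzRingType) (u : {rmorphism A -> B}).

Lemma en_pureDl b b' c : en_pure u (b + b') c = en_pure u b c + en_pure u b' c.
Proof. exact: tensorDl. Qed.
Lemma en_pureDr b c c' : en_pure u b (c + c') = en_pure u b c + en_pure u b c'.
Proof. exact: tensorDr. Qed.
Lemma en_pure_swap a b c : en_pure u (u a * b) c = en_pure u b (u a * c).
Proof.
exact: etrans (@tensorZl unit A (fun=> restr u B^o) (fun=> restr u B^o) tt a b c)
  (esym (@tensorZr unit A (fun=> restr u B^o) (fun=> restr u B^o) tt a b c)).
Qed.

Definition en_left (b : B) : en u := en_pure u b 1.
Definition en_right (b : B) : en u := en_pure u 1 b.
Fact en_left_zmod : zmod_morphism en_left.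
Proof. by move=> b c; apply/eqP; rewrite eq_sym subr_eq /en_left -en_pureDl subrK. Qed.
Fact en_left_monoid : monoid_morphism en_left.
Proof. by split=> // b c; rewrite /en_left en_pureM mulr1. Qed.
HB.instance Definition _ := GRing.isZmodMorphism.Build B (en u) en_left en_left_zmod.
HB.instance Definition _ := GRing.isMonoidMorphism.Build B (en u) en_left en_left_monoid.
Fact en_right_zmod : zmod_morphism en_right.
Proof. by move=> b c; apply/eqP; rewrite eq_sym subr_eq /en_right -en_pureDr subrK. Qed.
Fact en_right_monoid : monoid_morphism en_right.
Proof. by split=> // b c; rewrite /en_right en_pureM mulr1. Qed.
HB.instance Definition _ := GRing.isZmodMorphism.Build B (en u) en_right en_right_zmod.
HB.instance Definition _ := GRing.isMonoidMorphism.Build B (en u) en_right en_right_monoid.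

Lemma en_pureE b c : en_pure u b c = en_left b * en_right c.
Proof. by rewrite en_pureM mulr1 mul1r. Qed.
Lemma mult_left b : mult u (en_left b) = b.
Proof. by rewrite mult_pure mulr1. Qed.
Lemma mult_right b : mult u (en_right b) = b.
Proof. by rewrite mult_pure mul1r. Qed.
Lemma en_left_right a : en_left (u a) = en_right (u a).
Proof. by rewrite /en_left /en_right -[u a]mulr1 en_pure_swap. Qed.

Definition diag_diff (b : B) : en u := en_right b - en_left b.

Lemma diag_diff_sum (I : finType) (a : I -> A) (g : I -> B) :
  diag_diff (\sum_i u (a i) * g i) = \sum_i en_left (u (a i)) * diag_diff (g i).
Proof.
rewrite /diag_diff !rmorph_sum -sumrB; apply: eq_bigr => i _.
by rewrite !rmorphM /= !en_left_right mulrBr.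
Qed.

Lemma diag_diffM x y :
  diag_diff (x * y) = en_left x * diag_diff y + en_left y * diag_diff x
    + diag_diff x * diag_diff y.
Proof. by rewrite /diag_diff !rmorphM; ring. Qed.

Lemma mult_diag_diff b : mult u (diag_diff b) = 0.
Proof. by rewrite rmorphB /= mult_left mult_right subrr. Qed.

Section Generators.
Variables (n : nat) (g : 'I_n -> B).
Hypothesis gP : forall b, exists c : 'I_n -> A, b = \sum_i u (c i) * g i.

(** On a pure tensor, x (x) y - xy (x) 1 = (x (x) 1)(1 (x) y - y (x) 1), and the last factor is
    A-linear in y. So module generators of B over A yield ideal generators of the kernel of
    multiplication. *)
Lemma diag_ideal_gen (z : en u) :
  exists c : 'I_n -> en u, z - en_left (mult u z) = \sum_i c i * diag_diff (g i).
Proof.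
elim/en_ind: z => [|z w [c cE] [d dE]|x y].
- by exists (fun=> 0); rewrite !rmorph0 subrr big1 // => i _; rewrite mul0r.
- exists (fun i => c i + d i); rewrite !rmorphD opprD addrACA cE dE -big_split.
  by apply: eq_bigr => i _; rewrite mulrDl.
have [c cE] := gP y; exists (fun i => en_left x * en_left (u (c i))).
rewrite mult_pure en_pureE rmorphM -mulrBr -/(diag_diff y) {1}cE diag_diff_sum.
by rewrite mulr_sumr; apply: eq_bigr => i _; rewrite mulrA.
Qed.

(* I^2, for I the kernel of [mult u], which the [diag_diff (g i)] generate. *)
Definition diag_sq : submodule (restr en_left (en u)^o).
Proof.
apply: (@Submodule B (restr en_left (en u)^o) (fun z => exists2 M : 'I_n -> en u,
  (forall i, mult u (M i) = 0) & z = \sum_i M i * diag_diff (g i) :> en u)).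
- by exists (fun=> 0) => [i|]; rewrite ?rmorph0 ?big1 // => i _; rewrite mul0r.
- move=> _ _ [M M0 ->] [N N0 ->]; exists (fun i => M i + N i) => [i|].
    by rewrite rmorphD /= M0 N0 addr0.
  by rewrite -big_split; apply: eq_bigr => i _; rewrite mulrDl.
- move=> b _ [M M0 ->]; exists (fun i => en_left b * M i) => [i|].
    by rewrite rmorphM /= M0 mulr0.
  rewrite -[_ *: _]/(en_left b * _) mulr_sumr.
  by apply: eq_bigr => i _; rewrite mulrA.
Defined.

(* [diag_diff] is a derivation modulo I^2. *)
Lemma diag_diff_sq : unramified_hom u -> forall b, diag_sq (diag_diff b).
Proof.
move=> unr b; apply/qproj_eq0; move: b.
apply: (unr (qmod diag_sq) (fun b => qproj diag_sq (diag_diff b))).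
- move=> x y; rewrite -raddfD; congr qproj.
  by rewrite /diag_diff !rmorphD opprD addrACA.
(* The defect in the Leibniz rule is [diag_diff x * diag_diff y]; expanding the second factor in the
   generators exhibits it in I^2. *)
- move=> x y; rewrite -!linearZ -raddfD; apply/qproj_eq => /=.
  have [c cE] := diag_ideal_gen (diag_diff y).
  rewrite mult_diag_diff rmorph0 subr0 in cE.
  exists (fun i => diag_diff x * c i) => [i|].
    by rewrite rmorphM /= mult_diag_diff mul0r.
  rewrite diag_diffM -[_ *: _]/(en_left x * _) -[y *: _]/(en_left y * _).
  rewrite [LHS]addrC addKr {1}cE mulr_sumr.
  by apply: eq_bigr => i _; rewrite mulrA.
move=> a; rewrite -(linear0 (qproj diag_sq)); congr qproj.
by rewrite /diag_diff -en_left_right subrr.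
Qed.

(** Nakayama's determinant trick. The vector d of generators of I satisfies d = M d with the entries
    of M in I, so e = det (1 - M) kills d and is 1 modulo I. *)
Lemma sep_idempotent : unramified_hom u ->
  exists2 e : en u, mult u e = 1 & forall z, mult u z = 0 -> z * e = 0.
Proof.
move=> unr.
have /choice[M /all_and2[M0 ME]] : forall j, exists M : 'I_n -> en u,
    (forall i, mult u (M i) = 0) /\ diag_diff (g j) = \sum_i M i * diag_diff (g i).
  by move=> j; have [M M0 ME] := diag_diff_sq unr (g j); exists M.
pose N : 'M[en u]_n := 1%:M - \matrix_(j, i) M j i.
pose d : 'cV[en u]_n := \col_i diag_diff (g i).
have Nd : N *m d = 0.
  apply/colP => j; rewrite mulmxBl mul1mx !mxE {1}ME -sumrB big1 // => i _.
  by rewrite !mxE subrr.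
exists (\det N).
  rewrite -det_map_mx (_ : map_mx _ N = 1%:M) ?det1 //.
  apply/matrixP => i j; rewrite !mxE rmorphB /= M0 subr0.
  by case: (i == j); rewrite ?rmorph1 ?rmorph0.
move=> z z0; have [c] := diag_ideal_gen z; rewrite z0 rmorph0 subr0 => ->.
rewrite mulr_suml big1 // => i _; rewrite -mulrA [_ * \det N]mulrC.
have : (\det N *: d) i 0 = 0.
  by rewrite -mul_scalar_mx -mul_adj_mx -mulmxA Nd mulmx0 mxE.
by rewrite !mxE => ->; rewrite mulr0.
Qed.
End Generators.

Section SectionOfIdempotent.
Variable e : en u.
Hypothesis eI : forall z, mult u z = 0 -> z * e = 0.
Definition section_of (b : restr (mult u) B^o) : (en u)^o := en_left b * e.
Fact section_of_linear : linear section_of.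
Proof.
move=> z x y.
change (en_left (mult u z * (x : B) + (y : B)) * e
  = z * (en_left x * e) + en_left y * e :> en u).
apply/eqP; rewrite -subr_eq0; apply/eqP; rewrite rmorphD rmorphM /=.
(* Linearity over all of B (x) B, and not just over the left factor, holds because mult z (x) 1 - z
   lies in the kernel of multiplication, which e kills. *)
transitivity ((en_left (mult u z) - z) * e * en_left x); first by ring.
by rewrite eI ?mul0r // rmorphB /= mult_left subrr.
Qed.
End SectionOfIdempotent.

Lemma section_exists : finite_hom u -> unramified_hom u -> exists s, @is_section A B u s.
Proof.
move=> [n [g gP]] unr; have [e e1 eI] := sep_idempotent gP unr.
have lin := section_of_linear eI.
pose s : {linear restr (mult u) B^o -> (en u)^o} :=
  HB.pack (section_of e) (GRing.isLinear.Build (en u) (restr (mult u) B^o) (en u)^o _ _ lin).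
exists s => b /=.
by rewrite rmorphM /= mult_left e1 mulr1.
Qed.
End Diagonal.

Lemma secK (A B : comPzRingType) (u : {rmorphism A -> B}) :
  (exists s, @is_section A B u s) -> forall b : B, mult u (sec u b) = b.
Proof. by rewrite /sec; case: pselect => // h _; exact: svalP (cid h). Qed.

(** * Finite flat algebras are projective *)

(** Induction on n: K is an extension of its ideal of first coordinates, which is finitely
    generated, by the submodule of its vectors with first coordinate 0. *)
Lemma noetherian_rV (A : comPzRingType) n (K : submodule 'rV[A]_n) :
  noetherian A -> exists m (M : 'M[A]_(m, n)),
    (forall c : 'rV_m, K (c *m M)) /\ forall x, K x -> exists c : 'rV_m, x = c *m M.
Proof.
move=> noethA; elim: n K => [|n IH] K.
  exists 0%N, 0; split=> [c|x _]; first by rewrite mulmx0; exact: smem0.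
  by exists 0; apply/rowP => -[].
move: K; rewrite -[n.+1]/(1 + n)%N => K.
have K_sum (m : nat) (c : 'I_m -> A) (y : 'I_m -> 'rV[A]_(1 + n)) :
    (forall i, K (y i)) -> K (\sum_i c i *: y i).
  move=> Ky; elim/big_ind: _ => [|x z Kx Kz|i _]; first exact: smem0.
    exact: smemD.
  exact: smemZ.
have [||a x [y [Ky <-]]|p [a [aI aE]]] := noethA (fun a => exists x, K x /\ x 0 0 = a).
- by exists 0; split; [exact: smem0|rewrite mxE].
- move=> _ _ [x [Kx <-]] [y [Ky <-]]; exists (x + y); split; first exact: smemD.
  by rewrite mxE.
- by exists (a *: y); split; [exact: smemZ|rewrite mxE].
have /choice[y /all_and2[Ky y0]] := aI.
have [K' K'E] : exists K' : submodule 'rV[A]_n,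
    forall x, K' x <-> K (row_mx (0 : 'rV_1) x).
  have S0 : K (row_mx (0 : 'rV_1) (0 : 'rV_n)) by rewrite row_mx0; exact: smem0.
  unshelve eexists (@Submodule A 'rV[A]_n
    (fun x => K (row_mx (0 : 'rV_1) x)) S0 _ _) => //.
    move=> x z Kx Kz; have := smemD Kx Kz.
    by rewrite add_row_mx addr0.
  move=> b x Kx; have := smemZ b Kx.
  by rewrite scale_row_mx scaler0.
have [m [M [MK KM]]] := IH K'.
exists (p + m)%N, (col_mx (\matrix_i y i) (row_mx (0 : 'cV_m) M : 'M_(m, 1 + n))); split.
  move=> c; rewrite -[c]hsubmxK mul_row_col; apply: smemD.
    by rewrite mulmx_sum_row; apply: K_sum => i; rewrite rowK.
  by rewrite mul_mx_row mulmx0; apply/K'E/MK.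
move=> x Kx; have [|c cE] := aE (x 0 0); first by exists x.
pose z := x - \sum_i c i *: y i.
have Kz : K z.
  rewrite /z -scaleN1r; apply: smemD => //; apply: smemZ; exact: K_sum.
have zE : z = row_mx (0 : 'rV_1) (rsubmx (z)).
  rewrite -[LHS](@hsubmxK _ 1 1 n); congr row_mx; apply/rowP => i.
  rewrite [i]ord1 !mxE lshift0 cE summxE -sumrB big1 // => j _.
  by rewrite mxE y0 subrr.
have /K'E/KM[d dE] : K (row_mx (0 : 'rV_1) (rsubmx (z))).
  by rewrite -zE.
exists (row_mx (\row_i c i) d); rewrite mul_row_col mul_mx_row mulmx0 -dE.
rewrite -[row_mx _ _ as X in _ + X]zE mulmx_sum_row -[LHS](subrK (\sum_i c i *: y i)).
rewrite -/z [RHS]addrC; congr (_ + _); apply: eq_bigr => i _.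
by rewrite mxE rowK.
Qed.

Section DualBasis.
Variables (A B : comPzRingType) (u : {rmorphism A -> B}).

Section Coordinate.
Variables (n : nat) (i : 'I_n).
Fact coord_bilin : bilin (fun (_ : unit) (b : restr u B^o) (x : 'rV[A]_n) =>
  (u (x 0 i) * (b : B) : restr u B^o)).
Proof.
move=> _; split=> z a x y.
  change (u (z 0 i) * (u a * (x : B) + (y : B)) = u a * (u (z 0 i) * x) + u (z 0 i) * y).
  by ring.
change (u ((a *: x + y) 0 i) * (z : B) = u a * (u (x 0 i) * z) + u (y 0 i) * z).
by rewrite !mxE rmorphD rmorphM; ring.
Qed.
Definition bcoord : {linear btens u 'rV[A]_n -> restr u B^o} := tlift coord_bilin.
Lemma bcoordE b x : bcoord (bpure u b x) = u (x 0 i) * b :> B.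
Proof. exact: (tlift_tensor coord_bilin). Qed.
End Coordinate.

Lemma bpure_rV n (b : B) (x : 'rV[A]_n) :
  bpure u b x = \sum_j bpure u (u (x 0 j) * b) (delta_mx 0 j : 'rV_n).
Proof.
rewrite {1}[x]row_sum_delta.
elim/big_rec2: _ => [|j y z _ IH]; last rewrite -IH.
  by apply: (addrI (bpure u b (0 : 'rV_n))); rewrite -tensorDr !addr0.
rewrite /bpure tensorDr; congr (_ + _).
by rewrite tensorZr -tensorZl.
Qed.

Lemma bpure_suml (M : lmodType A) (I : finType) (b : I -> B) (x : M) :
  bpure u (\sum_i b i) x = \sum_i bpure u (b i) x.
Proof.
elim/big_rec2: _ => [|i y z _ IH].
  by apply: (addrI (bpure u 0 x)); rewrite -tensorDl !addr0.
by rewrite -IH; exact: tensorDl.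
Qed.

(** The equational criterion of flatness. The rows of M1 generate the relations between the g_i, and
    those of M2 the functionals on A^n that vanish on these relations; both are finite in number as
    A is noetherian. Flatness gives g_i = sum_p M2_(p,i) e_p, and row p of M2 descends to the
    functional phi_p on B. *)
Lemma dual_basis : noetherian A -> finite_hom u -> flat_hom u ->
  exists N (phi : 'I_N -> {linear restr u B^o -> A^o}) (m : 'I_N -> B),
    forall b : B, b = \sum_p u (phi p b) * m p.
Proof.
move=> noethA [n [g gP]] flat_u.
pose comb (x : 'rV[A]_n) : B := \sum_i u (x 0 i) * g i.
have combP a x y : comb (a *: x + y) = u a * comb x + comb y.
  rewrite mulr_sumr -big_split; apply: eq_bigr => i _ /=.
  by rewrite !mxE rmorphD rmorphM mulrDl mulrA.
have comb0 : comb 0 = 0.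
  by rewrite /comb big1 // => i _; rewrite mxE rmorph0 mul0r.
have [K KE] : exists K : submodule 'rV[A]_n, forall x, K x <-> comb x = 0.
  unshelve eexists (@Submodule A 'rV[A]_n (fun x => comb x = 0) comb0 _ _) => //.
    by move=> x y x0 y0; rewrite -[x]scale1r combP x0 y0 mulr0 addr0.
  by move=> a x x0; rewrite -[_ *: _]addr0 combP x0 comb0 mulr0 addr0.
have [m [M1 [M1K KM1]]] := noetherian_rV K noethA.
pose T : {linear 'rV[A]_n -> 'rV[A]_m} := mulmxr M1^T.
have [N [M2 [M2K KM2]]] := noetherian_rV (kernel T) noethA.
(* t encodes the tuple of generators; that T kills it says that the rows of M1 are relations. *)
pose t : btens u 'rV[A]_n := \sum_i bpure u (g i) (delta_mx 0 i).
have Tt : bmap u T t = 0.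
  rewrite linear_sum.
  transitivity (\sum_j bpure u (comb (row j M1)) (delta_mx 0 j : 'rV_m)); last first.
    rewrite big1 // => j _; rewrite rowE (KE _).1; last exact: M1K.
    by apply: (addrI (bpure u 0 (delta_mx 0 j : 'rV_m))); rewrite -tensorDl !addr0.
  under [RHS]eq_bigr do rewrite bpure_suml.
  rewrite exchange_big; apply: eq_bigr => i _; rewrite bmap_pure bpure_rV.
  by apply: eq_bigr => j _; rewrite /= -rowE !mxE.
have [w tw] := flat_exact flat_u (f := mulmxr M2) (fun y => KM2 y) Tt.
pose e p : B := bcoord p w.
have gE i : g i = \sum_p u (M2 p i) * e p.
  transitivity (bcoord i t : B).
    rewrite linear_sum (bigD1 i) //= bcoordE mxE !eqxx rmorph1 mul1r big1 ?addr0 //.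
    by move=> k ki; rewrite bcoordE mxE eq_sym (negPf ki) rmorph0 mul0r.
  rewrite tw /e; elim/btens_ind: w {tw e} => [|w w' Hw Hw'|b x].
  - rewrite !linear0 big1 // => p _; rewrite linear0; exact: mulr0.
  - rewrite !linearD Hw Hw' -big_split; apply: eq_bigr => p _.
    rewrite linearD; exact/esym/mulrDr.
  rewrite bmap_pure bcoordE mxE rmorph_sum mulr_suml; apply: eq_bigr => p _.
  by rewrite bcoordE rmorphM; ring.
have M21 : M2 *m M1^T = 0.
  by apply/row_matrixP => p; rewrite row_mul rowE row0; exact: (M2K (delta_mx 0 p)).
have /choice[x xE] : forall b, exists x : 'rV[A]_n, b = comb x.
  move=> b; have [c ->] := gP b; exists (\row_i c i).
  by apply: eq_bigr => i _; rewrite mxE.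
(* x is an arbitrary choice of coordinates. Two choices differ by a combination of rows of M1, which
   M2^T kills, so phi is linear all the same. *)
pose phi b := x b *m M2^T.
have phi_lin (a : A) (b c : B) : phi (u a * b + c) = a *: phi b + phi c.
  have [|d dE] := KM1 (x (u a * b + c) - (a *: x b + x c)).
    apply/KE; rewrite -[- _]scaleN1r addrC combP combP -!xE.
    by rewrite rmorphN1 mulN1r addNr.
  apply/eqP; rewrite -subr_eq0 /phi scalemxAl -mulmxDl -mulmxBl dE -mulmxA.
  by rewrite -[M1 in X in _ *m X]trmxK -trmx_mul M21 trmx0 mulmx0.
have phi_linp (p : 'I_N) : linear (fun b : restr u B^o => phi b 0 p : A^o).
  by move=> a b c; rewrite phi_lin !mxE.
pose psi p : {linear restr u B^o -> A^o} := HB.pack (fun b : restr u B^o => phi b 0 p : A^o)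
  (GRing.isLinear.Build A (restr u B^o) A^o _ _ (phi_linp p)).
exists N, psi, e => b /=.
rewrite {1}[b]xE /comb; under [LHS]eq_bigr do rewrite gE mulr_sumr.
rewrite exchange_big; apply: eq_bigr => p _; rewrite mxE rmorph_sum mulr_suml.
by apply: eq_bigr => i _; rewrite mxE rmorphM mulrA.
Qed.
End DualBasis.

(** * Localization and the operator trace *)

Section Localization.
Variables (R : comPzRingType) (s : R).

Let frac := (nat * R)%type.
(** The pair (n, a) stands for a / s^n, and the factor s^k is there for zero divisors s.
    [is_tr_oper] can be applied only to a localization that has been exhibited, whence this
    construction. *)
Definition loc_rel (p q : frac) :=
  `[< exists k, s ^+ k * (s ^+ q.1 * p.2) = s ^+ k * (s ^+ p.1 * q.2) >].
Fact loc_equiv : equiv_class_of loc_rel.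
Proof.
split=> [p|p q|q p r]; first by apply/asboolP; exists 0%N.
  by apply/asboolP/asboolP => -[k kE]; exists k; rewrite kE.
move=> /asboolP[k kE] /asboolP[l lE]; apply/asboolP; exists (k + l + q.1)%N.
transitivity (s ^+ l * s ^+ r.1 * (s ^+ k * (s ^+ q.1 * p.2))).
  by rewrite !exprD; ring.
rewrite kE; transitivity (s ^+ k * s ^+ p.1 * (s ^+ l * (s ^+ r.1 * q.2))); first by ring.
by rewrite lE !exprD; ring.
Qed.
Canonical loc_equiv_rel := EquivRelPack loc_equiv.
Definition loc := {eq_quot loc_equiv_rel}.
HB.instance Definition _ := Choice.on loc.

Definition locc (p : frac) : loc := \pi_({eq_quot loc_equiv_rel}) p.
Definition locr (x : loc) : frac := repr (x : {eq_quot loc_equiv_rel}).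
Lemma locrK x : locc (locr x) = x.
Proof. exact: reprK. Qed.
Lemma loccP p q : locc p = locc q <->
  exists k, s ^+ k * (s ^+ q.1 * p.2) = s ^+ k * (s ^+ p.1 * q.2).
Proof.
split=> [/eqmodP/asboolP //|pq]; apply/eqmodP; exact/asboolP.
Qed.

Let add (x y : loc) := locc (((locr x).1 + (locr y).1)%N,
  s ^+ (locr y).1 * (locr x).2 + s ^+ (locr x).1 * (locr y).2).
Let mul (x y : loc) := locc (((locr x).1 + (locr y).1)%N, (locr x).2 * (locr y).2).
Let opp (x : loc) := locc ((locr x).1, - (locr x).2).

Let locrE p : exists k, s ^+ k * (s ^+ p.1 * (locr (locc p)).2)
  = s ^+ k * (s ^+ (locr (locc p)).1 * p.2).
Proof. by apply/loccP; rewrite locrK. Qed.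

Let addE p q : add (locc p) (locc q)
  = locc ((p.1 + q.1)%N, s ^+ q.1 * p.2 + s ^+ p.1 * q.2).
Proof.
have [k kE] := locrE p; have [l lE] := locrE q; apply/loccP; exists (k + l)%N => /=.
move: (locr _) (locr _) kE lE => q' p' kE lE.
transitivity (s ^+ l * s ^+ q.1 * s ^+ q'.1 * (s ^+ k * (s ^+ p.1 * p'.2))
  + s ^+ k * s ^+ p.1 * s ^+ p'.1 * (s ^+ l * (s ^+ q.1 * q'.2))).
  by rewrite !exprD; ring.
by rewrite kE lE !exprD; ring.
Qed.
Let mulE p q : mul (locc p) (locc q) = locc ((p.1 + q.1)%N, p.2 * q.2).
Proof.
have [k kE] := locrE p; have [l lE] := locrE q; apply/loccP; exists (k + l)%N => /=.
move: (locr _) (locr _) kE lE => q' p' kE lE.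
transitivity ((s ^+ k * (s ^+ p.1 * p'.2)) * (s ^+ l * (s ^+ q.1 * q'.2))).
  by rewrite !exprD; ring.
by rewrite kE lE !exprD; ring.
Qed.
Let oppE p : opp (locc p) = locc (p.1, - p.2).
Proof.
have [k kE] := locrE p; apply/loccP; exists k => /=.
by rewrite !mulrN kE.
Qed.
Let ind (P : loc -> Prop) : (forall n a, P (locc (n, a))) -> forall x, P x.
Proof. by move=> H x; rewrite -[x]locrK; case: (locr x). Qed.
Let eqI n m a b : s ^+ m * a = s ^+ n * b -> locc (n, a) = locc (m, b).
Proof. by move=> E; apply/loccP; exists 0%N => /=; rewrite E. Qed.

Fact loc_addA : associative add.
Proof.
elim/ind=> n a; elim/ind=> m b; elim/ind=> p c; rewrite !addE /=; apply: eqI.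
by rewrite !exprD; ring.
Qed.
Fact loc_addC : commutative add.
Proof.
elim/ind=> n a; elim/ind=> m b; rewrite !addE /=; apply: eqI.
by rewrite !exprD; ring.
Qed.
Fact loc_add0 : left_id (locc (0%N, 0)) add.
Proof. by elim/ind=> n a; rewrite addE /=; apply: eqI; rewrite expr0; ring. Qed.
Fact loc_addN : left_inverse (locc (0%N, 0)) opp add.
Proof. by elim/ind=> n a; rewrite oppE addE /=; apply: eqI; rewrite expr0; ring. Qed.
HB.instance Definition _ := GRing.isZmodule.Build loc loc_addA loc_addC loc_add0 loc_addN.
Fact loc_mulA : associative mul.
Proof.
elim/ind=> n a; elim/ind=> m b; elim/ind=> p c; rewrite !mulE /=; apply: eqI.
by rewrite !exprD; ring.
Qed.
Fact loc_mulC : commutative mul.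
Proof.
elim/ind=> n a; elim/ind=> m b; rewrite !mulE /=; apply: eqI.
by rewrite !exprD; ring.
Qed.
Fact loc_mul1 : left_id (locc (0%N, 1)) mul.
Proof. by elim/ind=> n a; rewrite mulE /= mul1r. Qed.
Fact loc_mulDl : left_distributive mul +%R.
Proof.
elim/ind=> n a; elim/ind=> m b; elim/ind=> p c.
rewrite -[_ + _]/(add _ _) addE !mulE -[RHS]/(add _ _) addE /=; apply: eqI.
by rewrite !exprD; ring.
Qed.
HB.instance Definition _ := GRing.Zmodule_isComPzRing.Build loc
  loc_mulA loc_mulC loc_mul1 loc_mulDl.

Definition to_loc (a : R) : loc := locc (0%N, a).
Fact to_loc_zmod : zmod_morphism to_loc.
Proof.
move=> a b; rewrite -[RHS]/(add _ (opp _)) oppE addE /=; congr locc.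
by rewrite !expr0 !mul1r.
Qed.
Fact to_loc_monoid : monoid_morphism to_loc.
Proof. by split=> // a b; rewrite -[RHS]/(mul _ _) mulE. Qed.
HB.instance Definition _ := GRing.isZmodMorphism.Build R loc to_loc to_loc_zmod.
HB.instance Definition _ := GRing.isMonoidMorphism.Build R loc to_loc to_loc_monoid.

Lemma to_locP : is_localization s to_loc.
Proof.
split.
- exists (locc (1%N, 1)); rewrite -[LHS]/(mul _ _) mulE; apply: eqI.
  by rewrite /= expr0; ring.
- elim/ind=> n a; exists n, a.
  rewrite -rmorphXn -[LHS]/(mul _ _) mulE; apply: eqI.
  by rewrite /= expr0; ring.
by move=> a /loccP[k /= E]; exists k; move: E; rewrite expr0 !mul1r mulr0.
Qed.
End Localization.

Section LocExtend.
Variables (R L : comPzRingType) (s : R) (l : {rmorphism R -> L}).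
Hypothesis lP : is_localization s l.
Variables (Q : comPzRingType) (x y : Q).
Hypothesis xy : x * y = 1.
Variable h : R -> Q.
Hypotheses (hD : forall a b, h (a + b) = h a + h b) (hs : forall a, h (s * a) = x * h a).

(** A fraction a / s^n goes to y^n h(a). Asking h only to be additive and to turn s into the unit x
    covers two uses: the ring map from As to Bs, and the extension to Bs of A-linear functionals on
    B. *)
Lemma loc_extend : exists h' : L -> Q,
  [/\ forall a, h' (l a) = h a, forall w z, h' (w + z) = h' w + h' z &
      forall n a z, l s ^+ n * z = l a -> h' z = y ^+ n * h a].
Proof.
have [_ surj ker] := lP.
have hsX n a : h (s ^+ n * a) = x ^+ n * h a.
  by elim: n => [|n IH]; rewrite ?mul1r // !exprS -mulrA hs IH mulrA.
have xyX n : x ^+ n * y ^+ n = 1 by rewrite -exprMn xy expr1n.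
have h0 : h 0 = 0 by apply: (addrI (h 0)); rewrite -hD !addr0.
have hker a b : l a = l b -> h a = h b.
  move=> E; have [|n nE] := ker (a - b); first by rewrite rmorphB E subrr.
  have : x ^+ n * h a = x ^+ n * h b.
    by rewrite -!hsX; congr h; apply/eqP; rewrite -subr_eq0 -mulrBr nE.
  by move/(congr1 (fun q => y ^+ n * q)); rewrite !mulrA ![y ^+ n * _]mulrC xyX !mul1r.
have /choice[f fE] : forall z, exists p : nat * R, l s ^+ p.1 * z = l p.2.
  by move=> z; have [n [a E]] := surj z; exists (n, a).
pose h' z := y ^+ (f z).1 * h (f z).2.
have h'E n a z : l s ^+ n * z = l a -> h' z = y ^+ n * h a.
  move=> E; rewrite /h'; move: (f z) (fE z) => [m b] /= E'.
  have : x ^+ n * h b = x ^+ m * h a.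
    by rewrite -!hsX; apply: hker; rewrite !rmorphM !rmorphXn -E -E' /=; ring.
  move=> E2; transitivity ((x ^+ n * y ^+ n) * (y ^+ m * h b)); first by rewrite xyX mul1r.
  transitivity (y ^+ n * y ^+ m * (x ^+ n * h b)); first by ring.
  rewrite E2; transitivity ((x ^+ m * y ^+ m) * (y ^+ n * h a)); first by ring.
  by rewrite xyX mul1r.
exists h'; split=> // [a|w z].
  by rewrite (h'E 0%N a) ?expr0 ?mul1r.
have [n [a nE]] := surj w; have [m [b mE]] := surj z.
rewrite (h'E _ _ _ nE) (h'E _ _ _ mE) (h'E (n + m)%N (s ^+ m * a + s ^+ n * b)).
  rewrite hD !hsX exprD.
  transitivity ((x ^+ m * y ^+ m) * (y ^+ n * h a) + (x ^+ n * y ^+ n) * (y ^+ m * h b)).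
    by ring.
  by rewrite !xyX !mul1r.
by rewrite rmorphD !rmorphM !rmorphXn -nE -mE exprD /=; ring.
Qed.
End LocExtend.

Section LocMap.
Variables (A B : comPzRingType) (u : {rmorphism A -> B}) (s : A).
Variables (As Bs : comPzRingType) (lA : {rmorphism A -> As}) (lB : {rmorphism B -> Bs}).
Hypotheses (lAP : is_localization s lA) (lBP : is_localization (u s) lB).

Lemma loc_map : exists v : {rmorphism As -> Bs}, forall a, v (lA a) = lB (u a).
Proof.
have [[t tE] _ _] := lBP; have [_ surj _] := lAP.
have [||v [vl vD vE]] := @loc_extend _ _ _ _ lAP _ _ _ tE (fun a => lB (u a)).
- by move=> a b; rewrite !rmorphD.
- by move=> a; rewrite !rmorphM.
have vB : zmod_morphism v.
  by move=> a b; apply: (addIr (v b)); rewrite -vD !subrK.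
have vM : monoid_morphism v.
  split=> [|w z]; first by rewrite -(rmorph1 lA) vl !rmorph1.
  have [n [a nE]] := surj w; have [m [b mE]] := surj z.
  rewrite (vE _ _ _ nE) (vE _ _ _ mE) (vE (n + m)%N (a * b)).
    by rewrite !rmorphM exprD; ring.
  by rewrite rmorphM -nE -mE exprD; ring.
pose v' : {rmorphism As -> Bs} := HB.pack v (GRing.isZmodMorphism.Build As Bs v vB)
  (GRing.isMonoidMorphism.Build As Bs v vM).
by exists v'.
Qed.

Variable v : {rmorphism As -> Bs}.
Hypothesis vl : forall a, v (lA a) = lB (u a).

Lemma loc_linear (phi : B -> A) :
  (forall a b c, phi (u a * b + c) = a * phi b + phi c) ->
  exists phi' : Bs -> As, [/\ forall b, phi' (lB b) = lA (phi b),
    forall z w, phi' (z + w) = phi' z + phi' w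
    & forall r z, phi' (v r * z) = r * phi' z].
Proof.
move=> phiP; have [[t tE] surjA _] := lAP; have [_ surjB _] := lBP.
have phi0 : phi 0 = 0.
  by apply: (addrI (phi 0)); rewrite -{1}[phi 0]mul1r -phiP mulr0 !addr0.
have phiM a b : phi (u a * b) = a * phi b by rewrite -[_ * b]addr0 phiP phi0 addr0.
have [||f [fl fD fE]] := @loc_extend _ _ _ _ lBP _ _ _ tE (fun b => lA (phi b)).
- by move=> b c; rewrite -rmorphD -[b in LHS]mul1r -(rmorph1 u) phiP mul1r.
- by move=> b; rewrite phiM rmorphM.
exists f; split=> // r z.
have [n [a nE]] := surjA r; have [m [b mE]] := surjB z.
rewrite (fE _ _ _ mE) (fE (n + m)%N (u a * b)).
  rewrite phiM rmorphM -nE exprD.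
  transitivity ((lA s * t) ^+ n * (r * (t ^+ m * lA (phi b)))).
    by rewrite exprMn; ring.
  by rewrite tE expr1n mul1r.
by rewrite rmorphM -mE -(vl a) -nE rmorphM rmorphXn /= vl exprD; ring.
Qed.
End LocMap.

Section DetCongruence.
Variables (R : comPzRingType) (J : R -> Prop).
Hypotheses (J0 : J 0) (JD : forall x y, J x -> J y -> J (x + y))
  (JM : forall a x, J x -> J (a * x)).

(** Each product in the expansion is telescoped factor by factor. J is a bare predicate, so it can
    be the set of x with s x in a radical, and no quotient ring is formed. *)
Lemma det_congruence n (F G : 'M[R]_n) :
  (forall i j, J (F i j - G i j)) -> J (\det F - \det G).
Proof.
move=> FG; rewrite -sumrB; elim/big_ind: _ => // p _; rewrite -mulrBr; apply: JM.
elim/big_rec2: _ => [|i x y _ Jxy]; first by rewrite subrr.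
have -> : F i (p i) * y - G i (p i) * x = F i (p i) * (y - x) + x * (F i (p i) - G i (p i)).
  by ring.
by apply: JD; apply: JM.
Qed.
End DetCongruence.

Section Trace.
Variables (A B : comPzRingType) (u : {rmorphism A -> B}).
Variables (N : nat) (phi : 'I_N -> {linear restr u B^o -> A^o}) (m : 'I_N -> B).
Hypothesis phim : forall b : B, b = \sum_p u (phi p b) * m p.

Let phiP p a b c : phi p (u a * b + c) = a * phi p b + phi p c.
Proof. exact: (linearP (phi p) a b c). Qed.

Definition dual_trace (b : restr u B^o) : A^o := \sum_p phi p ((b : B) * m p).
Fact dual_trace_linear : linear dual_trace.
Proof.
move=> a x y.
change (\sum_p phi p ((u a * (x : B) + (y : B)) * m p)
  = a * (\sum_p phi p ((x : B) * m p)) + \sum_p phi p ((y : B) * m p) :> A).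
rewrite mulr_sumr -big_split; apply: eq_bigr => p _ /=.
by rewrite mulrDl -mulrA phiP.
Qed.
HB.instance Definition _ := GRing.isLinear.Build A (restr u B^o) A^o _
  dual_trace dual_trace_linear.

(** The phi_p still form a dual basis after localization, so T = C Phi, where C holds the
    coordinates of the b m_p and Phi the values phi_p(e_j). The trace of C Phi is that of Phi C,
    whose diagonal entries are the phi_p(b m_p). *)
Lemma dual_trace_oper : is_tr_oper dual_trace.
Proof.
move=> s As Bs lA lB v n e lAP lBP vl eP b T TE.
have /choice[phi' /all_and3[phil phiD phiZ]] :
    forall p, exists phi' : Bs -> As, [/\ forall b, phi' (lB b) = lA (phi p b),
    forall z w, phi' (z + w) = phi' z + phi' w
    & forall r z, phi' (v r * z) = r * phi' z].
  by move=> p; apply: (loc_linear lAP lBP vl) => a c d; exact: phiP.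
have phi_sum p (r : 'I_n -> As) (z : 'I_n -> Bs) :
    phi' p (\sum_i v (r i) * z i) = \sum_i r i * phi' p (z i).
  elim/big_rec2: _ => [|i x y _ IH]; last by rewrite phiD phiZ IH.
  by apply: (addrI (phi' p 0)); rewrite -phiD !addr0.
have [[t tE] _ _] := lAP; have [_ surj _] := lBP.
have zE z : z = \sum_p v (phi' p z) * lB (m p).
  have [k [a kE]] := surj z.
  have tk : v t ^+ k * lB (u s) ^+ k = 1 by rewrite -exprMn -vl -rmorphM mulrC tE rmorph1 expr1n.
  rewrite -[LHS]mul1r -tk -mulrA kE {1}[a]phim rmorph_sum mulr_sumr.
  apply: eq_bigr => p _; rewrite rmorphM -(vl (phi p a)) -phil -kE -(vl s).
  rewrite -[v (lA s) ^+ k]rmorphXn phiZ.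
  rewrite rmorphM [v (lA s ^+ k)]rmorphXn -[in RHS](mul1r (v _)) -tk -(vl s); ring.
have /choice[c cE] : forall p, exists c : 'rV[As]_n, lB (b * m p) = \sum_i v (c 0 i) * e i.
  by move=> p; have [c [cE _]] := eP (lB (b * m p)); exists c.
have TE' i j : T i j = \sum_p phi' p (e j) * c p 0 i.
  have [d [_ dU]] := eP (lB b * e j).
  have T1 : d = \row_i T i j by apply: dU; rewrite TE; apply: eq_bigr => k _; rewrite mxE.
  have T2 : d = \row_i \sum_p phi' p (e j) * c p 0 i.
    apply: dU; rewrite {1}[e j]zE mulr_sumr.
    under [RHS]eq_bigr do rewrite mxE rmorph_sum mulr_suml.
    rewrite exchange_big; apply: eq_bigr => p _.
    rewrite mulrCA -rmorphM cE mulr_sumr; apply: eq_bigr => k _.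
    by rewrite rmorphM mulrA.
  by have := congr1 (fun r : 'rV_n => r 0 i) T1; rewrite T2 !mxE.
rewrite /dual_trace rmorph_sum /mxtrace; under [RHS]eq_bigr do rewrite TE'.
rewrite exchange_big; apply: eq_bigr => p _; rewrite -phil cE phi_sum.
by apply: eq_bigr => i _; rewrite mulrC.
Qed.

Section Uniqueness.
Variables t1 t2 : {linear restr u B^o -> A^o}.
Hypotheses (t1P : is_tr_oper t1) (t2P : is_tr_oper t2).
Variable b : B.
Let d : A := t1 b - t2 b.
(** The radical of the annihilator of d: x belongs to it when d vanishes on D(x). Showing that it
    contains 1 replaces a covering of Spec(A). *)
Let rad x := exists k, x ^+ k * d = 0.

Let rad0 : rad 0.
Proof. by exists 1%N; rewrite expr1 mul0r. Qed.
Let radM a x : rad x -> rad (a * x).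
Proof. by move=> [k E]; exists k; rewrite exprMn -mulrA E mulr0. Qed.
Let radD x y : rad x -> rad y -> rad (x + y).
Proof.
move=> [k xk] [l yl]; exists (k + l)%N; rewrite exprDn mulr_suml big1 // => i _.
rewrite mulrnAl; have [li|il] := leqP l i.
  by rewrite -(subnK li) exprD mulrA -[_ * _ * d]mulrA yl mulr0 mul0rn.
rewrite -addnBA ?(ltnW il) // exprD.
rewrite [X in X *+ _](_ : _ = x ^+ (l - i) * y ^+ i * (x ^+ k * d)); last by ring.
by rewrite xk mulr0 mul0rn.
Qed.
Let radX k x : rad (x ^+ k) -> rad x.
Proof. by move=> [l E]; exists (k * l)%N; rewrite exprM. Qed.

Section Generated.
Variables (n : nat) (s : A) (g : 'I_n -> B) (psi : 'I_n -> B -> A).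
Hypothesis psiP : forall i a b c, psi i (u a * b + c) = a * psi i b + psi i c.
Hypothesis gP : forall b, u s * b = \sum_i u (psi i b) * g i.
Let F : 'M[A]_n := \matrix_(i, j) psi i (g j).

(** Over D(s det F) the g_i form a basis: they span since s is invertible, and applying the psi_j to
    a relation w gives F w = 0, hence w = 0. There t1 b and t2 b are both the trace of the same
    matrix, so d vanishes. *)
Lemma free_locus : rad (s * \det F).
Proof.
set s' := s * \det F.
have [As [lA lAP]] : exists (As : comPzRingType) (lA : {rmorphism A -> As}),
    is_localization s' lA by exists (loc s'), (@to_loc _ s'); exact: to_locP.
have [Bs [lB lBP]] : exists (Bs : comPzRingType) (lB : {rmorphism B -> Bs}),
    is_localization (u s') lB by exists (loc (u s')), (@to_loc _ (u s')); exact: to_locP.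
have [v vl] := loc_map lAP lBP.
have [[y yE] _ ker] := lAP; have [_ surj _] := lBP.
have det_inv : lA (\det F) * (y * lA s) = 1.
  by rewrite -yE /s' rmorphM /=; ring.
pose e i := lB (g i).
have eP : is_basis v e.
  move=> z; have [k [c kE]] := surj z.
  (* y inverts s', so y^k undoes the denominator of z, and y det F is the inverse of s needed in s c
     = sum_i psi_i(c) g_i. *)
  pose c0 := \row_i (y ^+ k * (y * lA (\det F)) * lA (psi i c)).
  have c0E : z = \sum_i v (c0 0 i) * e i.
    have zE : z = v y ^+ k * (v (y * lA (\det F)) * lB (u s * c)).
      rewrite (rmorphM lB) -(vl s) [v _ * _]mulrA -(rmorphM v) -mulrA -(rmorphM lA).
      rewrite [_ * s]mulrC -/s' [y * _]mulrC yE rmorph1 mul1r.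
      rewrite -kE mulrA -exprMn -[lB (u s')]vl -rmorphM mulrC.
      by rewrite [y * _]mulrC yE rmorph1 expr1n mulr1.
    rewrite {1}zE gP (rmorph_sum lB) !mulr_sumr; apply: eq_bigr => i _.
    by rewrite mxE /e !rmorphM rmorphXn /= !vl; ring.
  exists c0; split=> // r rE; apply/eqP; rewrite -subr_eq0; apply/eqP.
  have : \sum_i v ((c0 - r) 0 i) * e i = 0.
    under eq_bigr do rewrite mxE [(- r) 0 _]mxE rmorphB mulrBl.
    by rewrite sumrB -rE -c0E subrr.
  set w := _ - r; move: w => w w0.
  have Fw : map_mx lA F *m w^T = 0.
    apply/colP => j; rewrite !mxE; under eq_bigr do rewrite !mxE.
    have [f [fl fD fZ]] := loc_linear lAP lBP vl (psiP j).
    have f0 : f 0 = 0 by apply: (addrI (f 0)); rewrite -fD !addr0.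
    transitivity (f (\sum_i v (w 0 i) * e i)); last by rewrite w0 f0.
    rewrite (big_morph f fD f0); apply: eq_bigr => i _.
    by rewrite fZ fl mulrC.
  have : \det (map_mx lA F) *: w^T = 0.
    by rewrite -mul_scalar_mx -mul_adj_mx -mulmxA Fw mulmx0.
  rewrite det_map_mx => /(congr1 (fun q => (y * lA s) *: q)); rewrite scalerA mulrC det_inv.
  by rewrite scale1r scaler0 => /(congr1 trmx); rewrite trmxK trmx0.
have /choice[T TE] : forall j, exists T : 'rV_n, lB b * e j = \sum_i v (T 0 i) * e i.
  by move=> j; have [T [TE _]] := eP (lB b * e j); exists T.
have [|k kE] := ker d.
  pose M : 'M_n := \matrix_(i, j) T j 0 i.
  have ME j : lB b * e j = \sum_i v (M i j) * e i.
    by rewrite TE; apply: eq_bigr => i _; rewrite mxE.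
  by rewrite rmorphB /= (t1P lAP lBP vl eP ME) (t2P lAP lBP vl eP ME) subrr.
by exists k.
Qed.
End Generated.

(* Inverting a coefficient of a relation between the [g i] makes one generator
   redundant, so induction puts [s c] in the radical of the annihilator of [d] for
   every such coefficient c; modulo these, [\det F] is [s ^+ n]. *)
Lemma generated_rad n s (g : 'I_n -> B) (psi : 'I_n -> B -> A) :
  (forall i a b c, psi i (u a * b + c) = a * psi i b + psi i c) ->
  (forall b, u s * b = \sum_i u (psi i b) * g i) -> rad s.
Proof.
elim: n s g psi => [|n IH] s g psi psiP gP.
  (* Without generators B vanishes over D(s), hence is free of rank 0 there, and the empty
     determinant is 1. *)
  by have := free_locus psiP gP; rewrite det_mx00 mulr1.
pose F : 'M[A]_n.+1 := \matrix_(i, j) psi i (g j).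
have rel (c : 'I_n.+1 -> A) k : \sum_i u (c i) * g i = 0 -> rad (s * c k).
  (* The relation c expresses c_k g_k by the other generators; this eliminates g_k from the
     expansion of s c_k b and turns psi_i into c_k psi_i - c_i psi_k. *)
  move=> c0; apply: (IH (s * c k) (fun i => g (lift k i))
    (fun i x => c k * psi (lift k i) x - c (lift k i) * psi k x)).
    by move=> i a x y; rewrite !psiP; ring.
  move=> x; rewrite rmorphM mulrAC gP mulr_suml (bigD1_ord k) //=.
  have -> : u (psi k x) * g k * u (c k)
      = - \sum_i u (psi k x) * (u (c (lift k i)) * g (lift k i)).
    rewrite -mulr_sumr; move: c0; rewrite (bigD1_ord k) //= => /eqP.
    rewrite addr_eq0 => /eqP E; rewrite -mulrA [g k * _]mulrC E; ring.
  rewrite addrC -sumrB; apply: eq_bigr => i _.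
  by rewrite rmorphB !rmorphM; ring.
have FE i j : rad (s * (F i j - s%:M i j)).
  have -> : s * (F i j - s%:M i j) = -1 * (s * (s%:M i j - F i j)) by ring.
  (* Column j of s - F is a relation, because s g_j = sum_k psi_k(g_j) g_k. *)
  apply/radM/(rel (fun k => s%:M k j - F k j) i).
  under eq_bigr do rewrite rmorphB mulrBl.
  rewrite sumrB.
  have -> : \sum_k u (s%:M k j) * g k = u s * g j.
    rewrite (bigD1 j) //= mxE eqxx mulr1n big1 ?addr0 // => k kj.
    by rewrite mxE (negPf kj) rmorph0 mul0r.
  rewrite gP -sumrB big1 // => k _.
  by rewrite mxE subrr.
(* Both s det F and s (det F - s^(n+1)) lie in the radical, and their difference is s^(n+2). *)
apply: (radX (k := n.+2)).
have FdetE : rad (s * (\det F - \det (s%:M : 'M[A]_n.+1))).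
  apply: (@det_congruence A (fun x => rad (s * x))) => //.
  - by rewrite mulr0; exact: rad0.
  - by move=> x y; rewrite mulrDr; exact: radD.
  by move=> a x; rewrite mulrCA; exact: radM.
have := radD (free_locus psiP gP) (radM (-1) FdetE).
rewrite -/F det_scalar [s ^+ n.+2]exprS; move: (s ^+ n.+1) => q; congr rad; ring.
Qed.

Lemma tr_oper_unique : t1 b = t2 b.
Proof.
(* For s = 1 the dual basis is itself such a generating system, and 1 in the radical means d = 0. *)
have [||k] := @generated_rad N 1 m phi.
- by move=> i a x y; exact: phiP.
- by move=> x; rewrite rmorph1 mul1r.
by rewrite expr1n mul1r => /eqP; rewrite subr_eq0 => /eqP.
Qed.
End Uniqueness.

Lemma tr_operE (b : B) : tr_oper u b = dual_trace b.
Proof.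
rewrite /tr_oper; case: pselect => [h|[]]; last by exists dual_trace; exact: dual_trace_oper.
exact: tr_oper_unique (svalP (cid h)) dual_trace_oper b.
Qed.
End Trace.

(** * The trace dual to the separability idempotent *)

Section TraceIdentity.
Variables (A B : comPzRingType) (u : {rmorphism A -> B}).

Section Contract.
Variable f : {linear restr u B^o -> A^o}.
Fact contract_bilin : bilin (fun (_ : unit) (x y : restr u B^o) =>
  (u (f x) * (y : B) : restr u B^o)).
Proof.
move=> _; split=> z a x y.
  have fE : f (a *: x + y) = a * f x + f y :> A by exact: (linearP f a x y).
  change (u (f (a *: x + y)) * (z : B) = u a * (u (f x) * (z : B)) + u (f y) * (z : B)).
  by rewrite fE rmorphD rmorphM; ring.
change (u (f z) * (u a * (x : B) + (y : B))
  = u a * (u (f z) * (x : B)) + u (f z) * (y : B)).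
by ring.
Qed.
Definition contract (z : en u) : B := tlift contract_bilin z.
Lemma contract_pure x y : contract (en_pure u x y) = u (f x) * y.
Proof. exact: (tlift_tensor contract_bilin). Qed.
Lemma contractD z w : contract (z + w) = contract z + contract w.
Proof. exact: (linearD (tlift contract_bilin)). Qed.
Lemma contract0 : contract 0 = 0.
Proof. exact: (linear0 (tlift contract_bilin)). Qed.

Lemma contract_right z b : contract (en_right u b * z) = b * contract z.
Proof.
elim/en_ind: z => [|z w Hz Hw|x y].
- by rewrite mulr0 contract0 mulr0.
- by rewrite mulrDr !contractD Hz Hw mulrDr.
by rewrite en_pureM !contract_pure mul1r; ring.
Qed.
End Contract.

(* Multiplication by [s b] on B (x) B, as an algebra over its right factor, has
   trace b, because [(m (x) 1) s(b) = (1 (x) m) s(b)]. *)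
Lemma contract_section (s : {linear restr (mult u) B^o -> (en u)^o})
    N (phi : 'I_N -> {linear restr u B^o -> A^o}) (m : 'I_N -> B) (b : B) :
  (forall b : B, mult u (s b) = b) -> (forall b : B, b = \sum_p u (phi p b) * m p) ->
  contract (dual_trace phi m) (s b) = b.
Proof.
move=> sK phim.
have E1 z : contract (dual_trace phi m) z = \sum_p contract (phi p) (en_left u (m p) * z).
  elim/en_ind: z => [|z w Hz Hw|x y].
  - by rewrite contract0 big1 // => p _; rewrite mulr0 contract0.
  - by rewrite contractD Hz Hw -big_split; apply: eq_bigr => p _; rewrite mulrDr contractD.
  rewrite contract_pure rmorph_sum mulr_suml; apply: eq_bigr => p _.
  by rewrite en_pureM contract_pure mul1r mulrC [m p * x]mulrC mulrC.
have E2 z : \sum_p m p * contract (phi p) z = mult u z.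
  elim/en_ind: z => [|z w Hz Hw|x y].
  - by rewrite rmorph0 big1 // => p _; rewrite contract0 mulr0.
  - by rewrite rmorphD /= -Hz -Hw -big_split; apply: eq_bigr => p _; rewrite contractD mulrDr.
  rewrite mult_pure {2}[x]phim mulr_suml; apply: eq_bigr => p _.
  by rewrite contract_pure; ring.
rewrite E1 -[RHS]sK -E2; apply: eq_bigr => p _; rewrite -contract_right; congr contract.
by rewrite -!secM mult_left mult_right.
Qed.

Lemma en_sum (z : en u) : exists l : seq (B * B), z = \sum_(p <- l) en_pure u p.1 p.2.
Proof.
elim/en_ind: z => [|z w [l ->] [l' ->]|x y].
- by exists [::]; rewrite big_nil.
- by exists (l ++ l'); rewrite big_cat.
by exists [:: (x, y)]; rewrite big_seq1.
Qed.

Definition trace_dual (t : {linear restr u B^o -> A^o}) (l : seq (B * B)) :=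
  forall b : B, b = \sum_(p <- l) u (t (b * p.1 : B)) * p.2.

Lemma contract_dual (s : {linear restr (mult u) B^o -> (en u)^o}) t :
  (forall b : B, contract t (s b) = b) -> exists l, trace_dual t l.
Proof.
move=> ts; have [l lE] := en_sum (s 1); exists l => b.
have -> : \sum_(p <- l) u (t (b * p.1 : B)) * p.2 = contract t (en_left u b * s 1).
  rewrite lE mulr_sumr (big_morph (contract t) (contractD t) (contract0 t)).
  by apply: eq_bigr => p _; rewrite en_pureM contract_pure mul1r.
by rewrite -secM mult_left mulr1 ts.
Qed.
End TraceIdentity.

(** * Nondegeneracy: the adjoint of the trace is a quasi-isomorphism *)

Section Nondegenerate.
Variables (A B : comPzRingType) (u : {rmorphism A -> B}).
Variables (t : {linear restr u B^o -> A^o}) (l : seq (B * B)).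
Hypothesis tl : trace_dual t l.

Lemma coind_sum (X : lmodType A) (f : coind u X) (b : B) :
  f b = \sum_(p <- l) (t (b * p.1 : B) : A) *: f p.2.
Proof.
have f0 : f 0 = 0 by apply: (addrI (f 0)); rewrite -coind_funD !addr0.
rewrite {1}[b]tl (big_morph f (coind_funD f) f0).
by apply: eq_bigr => p _; rewrite coind_funZ.
Qed.

Section Extend.
Variables (X : lmodType A) (w : B -> X).
Fact trace_extend_subproof :
  (fun b : B => \sum_(p <- l) (t (b * p.1 : B) : A) *: w p.2) \in @coind_pred _ _ u X.
Proof.
apply/asboolP; split=> [b c|a b].
  rewrite -big_split; apply: eq_bigr => p _.
  by rewrite /= -scalerDl mulrDl; congr (_ *: _); exact: (linearD t).
rewrite scaler_sumr; apply: eq_bigr => p _; rewrite scalerA -mulrA; congr (_ *: _).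
exact: (linearZ_LR t a (b * p.1 : B)).
Qed.
(** Makes an arbitrary function w linear over A by keeping only its values at the second members of
    the dual basis; by [coind_sum] a linear w is left unchanged. *)
Definition trace_extend : coind u X := Coind trace_extend_subproof.
End Extend.

(** Pointwise lifts, chosen without any linearity, are corrected by [trace_extend]; this is the
    exactness of Hom_A(B, -). *)
Lemma coind_lift (X Y : lmodType A) (d : {linear X -> Y}) (f : coind u Y) :
  (forall b, exists w, f b = d w) -> exists psi : coind u X, f = coind_map d psi.
Proof.
move=> /choice[w wE]; exists (trace_extend w); apply: coind_eqP => b /=.
by rewrite coind_sum linear_sum; apply: eq_bigr => p _; rewrite wE linearZ.
Qed.

Lemma cohomologous_sum (X : cplx A) i (c : B * B -> A) (x y : B * B -> X (i + 1)) :
  (forall p, cohomologous (x p) (y p)) ->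
  cohomologous (\sum_(p <- l) c p *: x p) (\sum_(p <- l) c p *: y p).
Proof.
move=> /choice[w wE]; exists (\sum_(p <- l) c p *: w p).
by rewrite -sumrB linear_sum; apply: eq_bigr => p _; rewrite -scalerBr wE linearZ.
Qed.

Lemma adj_qis (J : cplx A) (r : cmap (cplx0 A^o) J) (g : cmap (res u (cplx0 B^o)) J) :
  qis r -> dhom g =D dhom r \oD dhom (ccomp (cmap0 t) (res0 u B^o)) -> qis (adj g).
Proof.
move=> qr gr.
(* The equation in D(A) fixes g only up to coboundaries. Degree 0 enters as -1 + 1, because [drel]
   lives in successor degrees. *)
have gE (b : B) : @cohomologous A J (-1) (g 0 b) (r 0 (t b)).
  have [|_] := @drel_deq A _ _ _ _ gr (-1) b (r 0 (t b)) erefl.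
    by rewrite -[LHS](@cm_dif A _ _ r 0) linear0.
  move=> /= h; apply: h.
  by exists (t b : A); split=> //; exact: cohomologous_refl.
apply: qisI => i.
  have [i0|i0] := eqVneq (i + 1) 0; last first.
    by move=> x _ _; rewrite (@ob0_eq0 B B^o _ x i0); exact: cohomologous_refl.
  have -> : i = -1 by apply/eqP; rewrite -addr_eq0 i0.
  (* [adj g] sends b0 to b |-> g (b b0). If this is a coboundary, then t (b b0) = 0 for all b, and
     the dual basis gives b0 = 0. *)
  move=> b0 _ [psi E]; have E' b : @cohomologous A J (-1) (g 0 (b * (b0 : B) : B)) 0.
    exists (psi b); rewrite subr0.
    by move: (congr1 (fun h => coind_fun h b) E); rewrite subr0.
  have t0 b : t (b * (b0 : B) : B) = 0.
    have [|||w] := @qis_inj A _ _ r qr (-1) (t (b * (b0 : B) : B)) 0.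
    - by [].
    - by rewrite linear0.
    - rewrite linear0; apply: cohomologous_trans (cohomologous_sym (gE _)) (E' b).
    by rewrite subr0.
  have -> : b0 = 0.
    by rewrite [b0]tl big1 // => p _; rewrite mulrC [_ * p.1]mulrC t0 rmorph0 mulr0.
  exact: cohomologous_refl.
have lift (y : coind u (J (i + 1))) : (forall b, cohomologous (y b) 0) ->
    @cohomologous B (coind_cplx u J) i y 0.
  move=> yb; have [|psi E] := @coind_lift _ _ (dif J i) y.
    by move=> b; have [w E] := yb b; exists w; rewrite -E subr0.
  by exists psi; rewrite subr0.
move=> y dy; have dyb b : dif J (i + 1) (y b) = 0.
  by move: (congr1 (fun h => coind_fun h b) dy).
have /choice[a aE] : forall b, exists a : cplx0 A^o (i + 1), cohomologous (r _ a) (y b).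
  by move=> b; have [a _ aE] := qis_surj qr (dyb b); exists a.
have [i0|i0] := eqVneq (i + 1) 0; last first.
  exists 0; first by rewrite linear0.
  rewrite linear0; apply: cohomologous_sym; apply: lift => b.
  apply: cohomologous_trans (cohomologous_sym (aE b)) _.
  rewrite (@ob0_eq0 A A^o _ (a b) i0) linear0; exact: cohomologous_refl.
have Ei : i = -1 by apply/eqP; rewrite -addr_eq0 i0.
(* This choice makes t (b b0) the sum of the t (b p.1) a(p.2); since a(p.2) represents the class of
   y at p.2, [coind_sum] shows that the sum represents y b. *)
subst i; pose b0 : B := \sum_(p <- l) u (a p.2 : A) * p.1.
exists (b0 : B); first by [].
suff [psi E] : @cohomologous B (coind_cplx u J) (-1) (adj g (-1 + 1) (b0 : B) - y) 0.
  by exists psi; rewrite -E subr0.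
apply: lift => b.
suff [w E] : @cohomologous A J (-1) (g 0 (b * b0 : B)) (y b) by exists w; rewrite subr0 -E.
apply: cohomologous_trans (gE _) _; rewrite coind_sum.
have -> : r 0 (t (b * b0 : B)) = \sum_(p <- l) (t (b * p.1 : B) : A) *: r 0 (a p.2).
  have -> : t (b * b0 : B) = \sum_(p <- l) (t (b * p.1 : B) : A) *: (a p.2 : A^o).
    have -> : b * b0 = \sum_(p <- l) (a p.2 : A) *: (b * p.1 : restr u B^o) :> restr u B^o.
      by rewrite mulr_sumr; apply: eq_bigr => p _; exact: mulrCA.
    rewrite linear_sum; apply: eq_bigr => p _; rewrite linearZ; exact: mulrC.
  rewrite linear_sum; apply: eq_bigr => p _; exact: (linearZ_LR (r 0)).
exact: cohomologous_sum.
Qed.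
End Nondegenerate.

(** * Rigidity of the trace *)

Lemma qis_id (R : comPzRingType) (X : cplx R) : qis (cid_map X).
Proof. by apply: qis_bij => // i y; exists y. Qed.

Lemma tmapK (A : comPzRingType) (X Y : cplx A) (p : cmap Y X) (q : cmap X Y) :
  (forall i x, p i (q i x) = x) -> forall n t, tmap p p n (tmap q q n t) = t.
Proof.
move=> qK n t; elim/tob_ind: t => [|x y Hx Hy|k x y]; first by rewrite !linear0.
  by rewrite !linearD Hx Hy.
apply: etrans (congr1 _ (tmap_funE q q x y)) _.
by apply: etrans (tmap_funE _ _ _ _) _; rewrite !qK.
Qed.

Lemma tmap_comp (A : comPzRingType) (X Y Z : cplx A) (g : cmap Y Z) (f : cmap X Y) n t :
  tmap (ccomp g f) (ccomp g f) n t = tmap g g n (tmap f f n t).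
Proof.
elim/tob_ind: t => [|x y Hx Hy|k x y]; first by rewrite !linear0.
  by rewrite !linearD Hx Hy.
apply: etrans (tmap_funE (ccomp g f) (ccomp g f) x y) _; apply: esym.
by apply: etrans (congr1 _ (tmap_funE f f x y)) _; exact: tmap_funE.
Qed.

Lemma res_id_nat (R : comPzRingType) (X Y : cplx R) (f : dmor X Y) :
  dhom (res_id Y) \oD f =D dres idfun f \oD dhom (res_id X).
Proof.
elim: f => {X Y} [X Y h|X Y s qs|X Y Z g IHg f IHf] /=.
- exact: deq_comp_ext.
- apply: (deq_cancel_qis (s := res_map idfun s)); first exact: qs.
  apply: deq_trans (deq_assoc _ _ _) _.
  apply: deq_trans (deq_congl _ (deq_comp_ext (g' := res_id Y) (f' := s) _)) _ => //.
  apply: deq_trans (deq_sym (deq_assoc _ _ _)) _.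
  apply: deq_trans (deq_congr _ (deq_invr qs)) _; apply: deq_trans (deq_idr _) _.
  apply: deq_sym; apply: deq_trans (deq_assoc _ _ _) _.
  apply: deq_trans (deq_congl _ (deq_invr _)) _; exact: deq_idl.
apply: deq_trans (deq_assoc _ _ _) _; apply: deq_trans (deq_congl _ IHg) _.
apply: deq_trans (deq_sym (deq_assoc _ _ _)) _.
apply: deq_trans (deq_congr _ IHf) _; exact: deq_assoc.
Qed.

Section SquareLift.
Variables (A B : comPzRingType) (u : {rmorphism A -> B}).
Let B0 := cplx0 B^o.
Variable S : square u B0.

Lemma ten_res_qis (P Q : cplx B) : qis (ten_res u P Q).
Proof. by apply: qis_bij => // i y; exists y. Qed.

(** Each b has a cocycle of P in degree 0 mapping exactly to it, as B[0] has no nonzero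
    coboundaries, and the dual basis makes the choice A-linear. Linearity over A is enough, since
    the squares are compared in D(A). *)
Lemma sqp_lift (t : {linear restr u B^o -> A^o}) l : trace_dual t l ->
  exists q : cmap (res u B0) (res u (sqP S)), forall i x, res_map u (sqp S) i (q i x) = x.
Proof.
move=> tl.
have /choice[w wE] : forall b : B, exists w : sqP S 0, dif (sqP S) 0 w = 0 /\ sqp S 0 w = b.
  move=> b; have [|w dw [y E]] := (sqp_qis S (-1)).2 b; first by [].
  by exists w; split=> //; apply/eqP; rewrite -subr_eq0 E.
pose q0 (b : restr u B^o) : restr u (sqP S 0) :=
  \sum_(p <- l) (t ((b : B) * p.1 : B) : A) *: (w p.2 : restr u (sqP S 0)).
have q0_lin : linear q0.
  move=> a b c; rewrite /q0 scaler_sumr -big_split; apply: eq_bigr => p _ /=.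
  rewrite scalerA -scalerDl; congr (_ *: _).
  rewrite -(linearP t a (b * p.1 : B) (c * p.1 : B)); congr (t _).
  change ((u a * (b : B) + (c : B)) * p.1 = u a * ((b : B) * p.1) + (c : B) * p.1).
  by rewrite mulrDl mulrA.
pose q1 : {linear restr u B^o -> res u (sqP S) 0} := HB.pack q0
  (GRing.isLinear.Build A (restr u B^o) (restr u (sqP S 0)) _ _ q0_lin).
have dq b : dif (res u (sqP S)) 0 (q1 b) = 0.
  rewrite linear_sum big1 // => p _; rewrite linearZ /= /restr_fun (wE _).1; exact: scaler0.
exists (ccomp (from0 dq) (res0 u B^o)) => i x.
have [i0|i0] := eqVneq i 0; last first.
  by rewrite (@res_deg0_eq0 A B u i x i0) !linear0.
subst i; change (res_map u (sqp S) 0 (q1 x) = x).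
rewrite linear_sum; apply: etrans (esym (tl x)).
apply: eq_bigr => p _; rewrite linearZ_LR; congr (u _ * _); exact: (wE _).2.
Qed.

Section Chain.
Variable s : {linear restr (mult u) B^o -> (en u)^o}.

Definition section_deg0 (b : restr u B^o) : tob (res u B0) (res u B0) 0 :=
  en_deg0_lin u (s (b : B)).
Fact section_deg0_linear : linear section_deg0.
Proof.
move=> a b c; rewrite /section_deg0 -linearP; congr (en_deg0_lin u _).
transitivity (s (mult u (to_en u a) * (b : B) : B) + s (c : B) : en u).
  rewrite -raddfD mult_left; exact: congr1.
rewrite secM; congr (_ + _).
elim/en_ind: (s (b : B)) => [|z w Hz Hw|x y]; first by rewrite mulr0 scaler0.
  by rewrite mulrDr scalerDr Hz Hw.
rewrite en_pureM mul1r; exact: tensorZl.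
Qed.
HB.instance Definition _ := GRing.isLinear.Build A (restr u B^o)
  (tob (res u B0) (res u B0) 0) _ section_deg0 section_deg0_linear.

Fact section_deg0_dif b : dif (tcplx (res u B0) (res u B0)) 0 (section_deg0 b) = 0.
Proof. exact: (@ten_dif0 A B u 0 (section_deg0 b)). Qed.
Definition section_map : cmap (res u B0) (tcplx (res u B0) (res u B0)) :=
  ccomp (from0 (Y := tcplx (res u B0) (res u B0)) section_deg0_dif) (res0 u B^o).

(** Evaluation at 1 turns b |-> (b' |-> s (b b')) into s. So over A the rigidifying morphism is the
    section itself, lifted to the resolutions by q (x) q. *)
Lemma ev_rho (rho : dmor B0 (Sq S)) (q : cmap (res u B0) (res u (sqP S))) :
  flat_hom u -> (forall i x, res_map u (sqp S) i (q i x) = x) -> is_rho s rho ->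
  dhom (ev (sqI S)) \oD dres u rho =D
  dhom (res_map (to_en u) (sqj S)) \oD dhom (ten_res u _ _) \oD dhom (tmap q q)
    \oD dhom section_map.
Proof.
move=> flat_u qK [c cE rhoE].
apply: deq_trans (deq_congr _ (dres_deq u rhoE)) _ => /=.
apply: (deq_trans (g := dhom (res_map (to_en u) c) \oD dhom (ten_res u _ _) \oD dhom section_map)).
  apply: deq_trans (deq_congr _ (deq_hom _ _)) _.
  apply: deq_trans (deq_hom _ _) _.
  apply: deq_sym; apply: deq_trans (deq_congl _ (deq_hom _ _)) _.
  apply: deq_trans (deq_hom _ _) _; apply: deq_ext => i x.
  have [i0|i0] := eqVneq i 0; last by rewrite (@res_deg0_eq0 A B u i x i0) !linear0.
  subst i; change (c 0 (en_deg0 (s (x : B))) = c 0 (en_deg0 (s ((x : B) * 1)))).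
  by rewrite mulr1.
apply: deq_congl.
(* c is specified only after composition with sqp (x) sqp, so the identity of B[0] (x) B[0] is
   written as sqp (x) sqp after q (x) q. *)
apply: (deq_trans (g := dhom (res_map (to_en u) c) \oD
   (dhom (res_map (to_en u) (ten_map u (sqp S))) \oD
      dhom (ccomp (ten_res u _ _) (tmap q q))))).
  apply: deq_congr; apply: deq_sym; apply: deq_trans (deq_hom _ _) _.
  apply: deq_ext => i x.
  change (tmap (res_map u (sqp S)) (res_map u (sqp S)) i (tmap q q i x) = x).
  exact: tmapK.
apply: deq_trans (deq_assoc _ _ _) _.
apply: deq_trans (deq_congl _ (dres_deq (to_en u) cE)) _.
apply: deq_trans (deq_congr _ (deq_sym (deq_hom _ _))) _; exact: deq_assoc.
Qed.
End Chain.
End SquareLift.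

Section RigidTrace.
Variables (A B : comPzRingType) (u : {rmorphism A -> B}).
Let A0 := cplx0 A^o.
Let B0 := cplx0 B^o.
Let i := (idfun : {rmorphism A -> A}).
Variables (SB : square u B0) (SA : square i A0).

Lemma tau_funK (a : A) : mult i (tau_fun a) = a.
Proof. by rewrite mult_pure mulr1. Qed.

Lemma flat_idfun : flat_hom i.
Proof.
have hb (M : lmodType A) : bilin (fun (_ : unit) (a : restr i A^o) (x : M) => (a : A) *: x).
  move=> _; split=> x a y z; last by rewrite scalerDr !scalerA mulrC.
  by rewrite -[a *: y]/(a * (y : A)) scalerDl scalerA.
pose h (M : lmodType A) : {linear btens i M -> M} := tlift (hb M).
have hp (M : lmodType A) (a : A) (x : M) : h M (bpure i a x) = a *: x.
  exact: (tlift_tensor (hb M)).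
have hK (M : lmodType A) (t : btens i M) : bpure i 1 (h M t) = t.
  elim/btens_ind: t => [|s1 t Hs Ht|a x].
  - by rewrite linear0; apply: (addrI (bpure i 1 0)); rewrite -tensorDr !addr0.
  - by rewrite linearD -[in RHS]Hs -[in RHS]Ht; exact: tensorDr.
  rewrite hp /bpure tensorZr -tensorZl; congr (tensor _ _); exact: mulr1.
move=> M N f f_inj s1 t E.
have hf w : h N (bmap i f w) = f (h M w).
  elim/btens_ind: w => [|w w' Hw Hw'|a x]; first by rewrite !linear0.
    by rewrite !linearD /= Hw Hw'.
  by rewrite bmap_pure !hp linearZ.
by rewrite -[s1]hK -[t]hK; congr bpure; apply: f_inj; rewrite -!hf; congr (h N _).
Qed.

(** A (x)_A A is A, so evaluation at 1 identifies Hom(A, Y) with Y; its inverse enters the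
    construction of [phi] in [rigid_trace]. *)
Lemma qis_ev_idfun (Y : cplx (en i)) :
  qis (ccomp (ev Y) (res_id (coind_cplx (mult i) Y))).
Proof.
apply: qis_bij => n.
  move=> f f0; apply: coind_eqP => a.
  transitivity (f (mult i (en_left i a) * 1)); first by rewrite mult_left mulr1.
  have f1 : f 1 = 0 by exact: f0.
  by rewrite coind_funZ f1 scaler0.
move=> y; exists (coind_sec (@tau_fun A) y).
exact: (scale1r (y : Y n)).
Qed.

(** Quasi-isomorphisms are cancelled until both sides are maps out of B[0]; what remains is (t (x)
    t)(s b) = t b (x) 1 in A (x) A. *)
Lemma rigid_trace (t : {linear restr u B^o -> A^o}) l
    (s : {linear restr (mult u) B^o -> (en u)^o})
    (rhoB : dmor B0 (Sq SB)) (rhoA : dmor A0 (Sq SA)) :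
  flat_hom u -> trace_dual t l -> (forall b : B, contract t (s b) = b) ->
  is_rho s rhoB -> is_rho_tau rhoA ->
  rigid_backward rhoB rhoA (dhom (ccomp (cmap0 t) (res0 u B^o))).
Proof.
move=> flat_u tl ts rhoBP rhoAP.
set theta := ccomp _ _.
have [q qK] := sqp_lift SB tl.
have [qA qAK] : exists q : cmap (res i A0) (res i (sqP SA)),
    forall n x, res_map i (sqp SA) n (q n x) = x.
  have lin : linear (fun a : restr i A^o => a : A^o) by [].
  pose t0 : {linear restr i A^o -> A^o} := HB.pack (fun a : restr i A^o => a : A^o)
    (GRing.isLinear.Build A (restr i A^o) A^o _ _ lin).
  (* Over A itself the identity is a trace form, with the dual pair (1, 1). *)
  apply: (@sqp_lift _ _ _ SA t0 [:: (1, 1)]) => a.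
  by rewrite big_seq1 /= !mulr1.
pose iota := ccomp (res_id A0) theta : cmap (res u B0) (res i A0).
pose f := ccomp qA iota.
have qq : qis q by apply: (qis_left (h := cid_map _) qK); [exact: (sqp_qis SB) | exact: qis_id].
pose S1 := ccomp (res_map (to_en u) (sqj SB)) (ccomp (ten_res u _ _) (tmap q q)).
have qt : qis (tmap q q).
  apply: (qis_left (h := cid_map _) (tmapK qK)); last exact: qis_id.
  have qp : qis (res_map u (sqp SB)) := sqp_qis SB.
  have kP : kflat (res u (sqP SB)) by exact: sqP_kflat.
  exact: (qis_tmap kP (kflat_deg0 flat_u) qp qp).
have qS1 : qis S1.
  apply: qis_comp; first exact: (sqj_qis SB).
  by apply: qis_comp qt; exact: ten_res_qis.
pose G := dhom (res_map (to_en i) (sqj SA)) \oD dhom (ten_res i _ _) \oD dhom (tmap f f).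
pose EA := ccomp (ev (sqI SA)) (res_id (Sq SA)).
have qEA : qis EA by exact: qis_ev_idfun.
(* S1 identifies B[0] (x) B[0] with the resolution of the tensor square, so g is forced by theta (x)
   theta; likewise phi is forced by g, as evaluation over A is invertible. *)
pose g := G \oD dinv qS1.
pose phi := dinv qEA \oD (g \oD dhom (ev (sqI SB))).
have gE : g \oD dhom (res_map (to_en u) (sqj SB)) \oD dhom (ten_res u _ _)
    \oD dhom (tmap q q) =D G.
  apply: (deq_trans (g := g \oD dhom S1)).
    apply: deq_trans (deq_sym (deq_assoc _ _ _)) _.
    apply: deq_trans (deq_sym (deq_assoc _ _ _)) _; apply: deq_congr.
    by apply: deq_trans (deq_congr _ (deq_hom _ _)) _; exact: deq_hom.
  apply: deq_trans (deq_sym (deq_assoc _ _ _)) _.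
  apply: deq_trans (deq_congr _ (deq_invl _)) _; exact: deq_idr.
have EAphi : dhom EA \oD phi =D g \oD dhom (ev (sqI SB)).
  apply: deq_trans (deq_assoc _ _ _) _.
  apply: deq_trans (deq_congl _ (deq_invr _)) _; exact: deq_idl.
have phiE : dhom (ev (sqI SA)) \oD dhom (res_id (Sq SA)) \oD phi =D g \oD dhom (ev (sqI SB)).
  by apply: deq_trans (deq_congl _ (deq_hom _ _)) _.
exists phi.
  exists (res u B0), q, f, g; split=> //.
  - exact: kflat_deg0.
  - apply: (deq_trans (g := dhom iota)).
      apply: deq_trans (deq_congl _ (deq_congl _ (deq_hom _ _))) _.
      apply: deq_trans (deq_congl _ (deq_hom _ _)) _.
      apply: deq_trans (deq_hom _ _) _; apply: deq_ext => n x.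
      by change (iota n (res_map u (sqp SB) n (q n x)) = iota n x); rewrite qK.
    apply: deq_sym; apply: deq_trans (deq_hom _ _) _; apply: deq_ext => n x.
    exact: qAK.
apply: (deq_cancel_qis qEA).
apply: deq_sym; apply: deq_trans (deq_assoc _ _ _) _.
apply: deq_trans (deq_congl _ EAphi) _.
apply: deq_trans (deq_sym (deq_assoc _ _ _)) _.
apply: deq_trans (deq_congr _ (ev_rho flat_u qK rhoBP)) _.
apply: deq_trans (deq_assoc _ _ _) _.
apply: (deq_trans (g := G \oD dhom (section_map s))).
  apply: deq_congl; apply: deq_trans gE.
  by apply: deq_trans (deq_assoc _ _ _) _; apply: deq_congl; exact: deq_assoc.
apply: deq_sym.
apply: (deq_trans (g := dhom (ev (sqI SA)) \oD dres i rhoA \oD dhom iota)).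
  apply: deq_trans (deq_congl _ (deq_sym (deq_hom _ _))) _.
  apply: deq_trans (deq_assoc _ _ _) _.
  apply: deq_trans (deq_congl _ (deq_sym (deq_assoc _ _ _))) _.
  apply: deq_trans (deq_congl _ (deq_congr _ (res_id_nat rhoA))) _.
  apply: deq_trans (deq_congl _ (deq_assoc _ _ _)) _.
  apply: deq_trans (deq_sym (deq_assoc _ _ _)) _; apply: deq_congr; exact: deq_hom.
apply: deq_trans (deq_congl _ (ev_rho flat_idfun qAK rhoAP)) _.
apply: deq_trans (deq_sym (deq_assoc _ _ _)) _.
apply: deq_trans (deq_sym (deq_assoc _ _ _)) _; apply: deq_sym.
apply: deq_trans (deq_sym (deq_assoc _ _ _)) _; apply: deq_congr.
apply: deq_sym; apply: deq_trans (deq_congr _ (deq_hom _ _)) _.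
apply: deq_comp_ext => n x.
apply: esym; rewrite tmap_comp.
rewrite -[RHS]/(tmap qA qA n (section_map (@tau_fun A) n (iota n x))).
congr (tmap qA qA n _).
have [n0|n0] := eqVneq n 0; last by rewrite (@res_deg0_eq0 A B u n x n0) !linear0.
subst n; change (tmap iota iota 0 (en_deg0 (s (x : B))) = en_deg0 (tau_fun (t x : A))).
(* On b (x) c both sides are t b (x) t c, because t (t b * c) = t b * t c and scalars cross the
   tensor sign. For z = s b the contraction is b. *)
suff trace_trace z : tmap iota iota 0 (en_deg0 z)
    = en_deg0 (en_pure i (t (contract t z : B) : A) 1) by rewrite trace_trace ts.
elim/en_ind: z => [|z w Hz Hw|b c].
- by rewrite contract0 en_deg00 !linear0 -[en_pure _ _ _]/(en_left i 0) rmorph0 en_deg00.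
- rewrite en_deg0D contractD linearD Hz Hw -en_deg0D -en_pureDl; congr (en_deg0 (en_pure i _ 1)).
  exact/esym/(linearD t).
rewrite en_deg0_pure contract_pure.
have -> : t (u (t b) * c) = t b * t c :> A by exact: (linearZ_LR t (t b) c).
have -> : en_pure i (t b * t c) 1 = en_pure i (t b) (t c).
  by rewrite mulrC (en_pure_swap i (t c) (t b)) mulr1.
rewrite en_deg0_pure; exact: (tmap_funE iota iota).
Qed.
End RigidTrace.

Theorem corollary14p15 (A B : comPzRingType) (u : {rmorphism A -> B})
    (noethA : noetherian A) (noethB : noetherian B)
    (u_finite : finite_hom u) (u_etale : etale_hom u)
    (SB : square u (cplx0 B^o))
    (SA : square (idfun : {rmorphism A -> A}) (cplx0 A^o))
    (rho_eet : dmor (cplx0 B^o) (Sq SB)) (rho_eetP : is_rho_eet rho_eet)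
    (rho_tau : dmor (cplx0 A^o) (Sq SA)) (rho_tauP : is_rho_tau rho_tau) :
  [/\ rigid_complex rho_eet,
      rigid_complex rho_tau,
      rigid_backward rho_eet rho_tau (tr_backward u)
    & nondegenerate_backward (tr_backward u)].
Proof.
have [_ flat_u unr] := u_etale.
have sK := secK (section_exists u_finite unr).
have [N [phi [m phim]]] := dual_basis noethA u_finite flat_u.
have ts (b : B) : contract (tr_oper u) (sec u b) = b.
  rewrite -[RHS](contract_section b sK phim).
  (* [tr_oper] is known to agree with [dual_trace] pointwise, so the two contractions are compared
     on pure tensors. *)
  elim/en_ind: (sec u b) => [|z w Hz Hw|x y]; first by rewrite !contract0.
    by rewrite !contractD Hz Hw.
  by rewrite !contract_pure (tr_operE phim).
have [l tl] := contract_dual ts.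
split.
- exact: (rigid_of_section sK flat_u rho_eetP).
- exact: (rigid_of_section (@tau_funK A) (@flat_idfun A) rho_tauP).
- exact: (rigid_trace flat_u tl ts rho_eetP rho_tauP).
by move=> J r g _ qr gr; apply: diso_qis; exact: (adj_qis tl qr gr).
Qed.
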